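(* Let $\mathrm{HSO}(4)=\{M\in \mathrm{Mat}_{4\times 4}(\mathbb{R}) \mid \mathrm{diag}(M)=(0,0,0,0),\ M\in \mathrm{SO}(4)\}\subseteq \mathbb{R}^{4\times 4}=\mathbb{R}^{16}$ be the variety of hollow special orthogonal $4\times 4$ matrices. Then $\mathrm{HSO}(4)$ is the union of $14$ irreducible surfaces (its irreducible components): six tori of degree four and eight spheres of degree two. Moreover, there exists a bijection between these $14$ components and the $14$ facets of the cuboctahedron $\mathcal{C}$ satisfying: 1. The six tori, each isomorphic to $\mathrm{SO}(2)\times \mathrm{SO}(2)\cong \mathbb{S}^1\times\mathbb{S}^1$, correspond to the six quadrilateral faces of $\mathcal{C}$. 2. The eight spheres, each isomorphic to $\mathbb{S}^2$, correspond to the eight triangular faces of $\mathcal{C}$. 3. Two distinct components intersect in a curve if and only if the corresponding facets share an edge. 4. Two distinct components intersect in points (i.e. in a nonempty finite set) if and only if the corresponding facets share a vertex (i.e. the two facets intersect exactly in a vertex). 5. The curve intersections of components are copies of $\mathrm{SO}(2)\cong\mathbb{S}^1$. 6. The point intersections of components are signed permutation matrices and their negatives, i.e. each is a copy $\{P,-P\}$ of $\mathbb{S}^0$ with $P$ a signed permutation matrix.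
   Context: $\mathrm{SO}(n)$ is the group of real $n\times n$ orthogonal matrices of determinant $1$. A matrix is hollow if all its diagonal entries are $0$. The degree of a real algebraic set in $\mathbb{R}^{N}$ is the degree of its Zariski closure in $\mathbb{C}^N$. $\mathbb{S}^k$ denotes the unit sphere in $\mathbb{R}^{k+1}$. The cuboctahedron $\mathcal{C}$ is the $3$-polytope which is the convex hull of the $12$ points obtained from $(\pm 1,\pm 1,0)$ by permuting coordinates; it has $14$ facets ($6$ squares and $8$ triangles), $24$ edges and $12$ vertices. A signed permutation matrix is a matrix with exactly one nonzero entry in each row and column, that entry being $\pm 1$. *)

(* Defs.v *)
From HB Require Import structures.
From mathcomp Require Import all_boot all_order all_fingroup all_algebra.
From mathcomp Require Import all_classical reals.
From mathcomp Require convex.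
From mathcomp Require Import complex mpoly.

Set Implicit Arguments.
Unset Strict Implicit.
Unset Printing Implicit Defensive.

Import Order.TTheory GRing.Theory Num.Theory.

Local Open Scope classical_set_scope.
Local Open Scope card_scope.
Local Open Scope ring_scope.

Section AffineGeometry.
Variable K : fieldType.

(* Points of K^n are row vectors; [x ord0] is the coordinate function of x. *)
Definition zero_locus n (S : set {mpoly K[n]}) : set 'rV[K]_n :=
  [set x | forall p, S p -> p.@[x ord0] = 0].

Definition vanishing_ideal n (A : set 'rV[K]_n) : set {mpoly K[n]} :=
  [set p | forall x, A x -> p.@[x ord0] = 0].

Definition algebraic n (A : set 'rV[K]_n) : Prop :=
  exists S : set {mpoly K[n]}, A = zero_locus S.

Definition zariski_closure n (A : set 'rV[K]_n) : set 'rV[K]_n :=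
  zero_locus (vanishing_ideal A).

Definition irreducible n (Z : set 'rV[K]_n) : Prop :=
  [/\ algebraic Z, Z !=set0 &
      forall A B : set 'rV[K]_n, algebraic A -> algebraic B ->
        Z `<=` A `|` B -> Z `<=` A \/ Z `<=` B].

Definition irreducible_components n (X : set 'rV[K]_n) : set (set 'rV[K]_n) :=
  [set Z | [/\ irreducible Z, Z `<=` X &
     forall Z', irreducible Z' -> Z' `<=` X -> Z `<=` Z' -> Z' = Z]].

Definition irreducible_chain n (X : set 'rV[K]_n) (d : nat) : Prop :=
  exists Z : nat -> set 'rV[K]_n,
    (forall i, (i <= d)%N -> irreducible (Z i) /\ Z i `<=` X) /\
    (forall i, (i < d)%N -> Z i `<` Z i.+1).

(* Krull dimension of an algebraic set X; it never holds for X empty. *)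
Definition has_dim n (X : set 'rV[K]_n) (d : nat) : Prop :=
  irreducible_chain X d /\ ~ irreducible_chain X d.+1.

Definition polynomial_map m n (f : 'rV[K]_m -> 'rV[K]_n) : Prop :=
  exists p : 'I_n -> {mpoly K[m]},
    forall x, f x = \row_(j < n) (p j).@[x ord0].

(* Isomorphism of affine algebraic sets. *)
Definition isomorphic m n (A : set 'rV[K]_m) (B : set 'rV[K]_n) : Prop :=
  exists (f : 'rV[K]_m -> 'rV[K]_n) (g : 'rV[K]_n -> 'rV[K]_m),
    [/\ polynomial_map f, polynomial_map g,
        forall x, A x -> B (f x) /\ g (f x) = x &
        forall y, B y -> A (g y) /\ f (g y) = y].

Definition prod_set m n (A : set 'rV[K]_m) (B : set 'rV[K]_n) :
    set 'rV[K]_(m + n) :=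
  [set x | A (lsubmx x) /\ B (rsubmx x)].

(* A set of matrices seen in affine space, entries listed row by row. *)
Definition flat m n (A : set 'M[K]_(m, n)) : set 'rV[K]_(m * n) :=
  mxvec @` A.

(* Meant for K algebraically closed: if k = dim X, a general affine subspace
   x *m L = b of codimension k meets X in exactly d points, "general" meaning
   that (L, b) avoids a proper hypersurface F = 0 of the parameter space. *)
Definition has_degree n (X : set 'rV[K]_n) (d : nat) : Prop :=
  exists2 k : nat, has_dim X k &
  exists2 F : {mpoly K[n * k + k]}, F != 0 &
  forall (L : 'M[K]_(n, k)) (b : 'rV[K]_k),
    F.@[(row_mx (mxvec L) b) ord0] != 0 ->
    X `&` [set x | x *m L = b] #= `I_d.

End AffineGeometry.

Section RealGeometry.
Variable R : realType.

Definition real_degree n (A : set 'rV[R]_n) (d : nat) : Prop :=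
  has_degree
    (zariski_closure ((fun x => map_mx (real_complex R) x) @` A)) d.

Definition SO n : set 'M[R]_n := [set M | M *m M^T = 1%:M /\ \det M = 1].

Definition hollow n : set 'M[R]_n := [set M | forall i, M i i = 0].

Definition HSO n : set 'M[R]_n := @hollow n `&` @SO n.

Definition sphere k : set 'rV[R]_k.+1 :=
  [set x | \sum_(i < k.+1) x ord0 i ^+ 2 = 1].

Definition signed_permutation n (P : 'M[R]_n) : Prop :=
  [/\ forall i, exists! j, P i j <> 0,
      forall j, exists! i, P i j <> 0 &
      forall i j, P i j <> 0 -> P i j = 1 \/ P i j = -1].

Definition convex_hull n (A : set 'rV[R]_n) : set 'rV[R]_n :=
  \bigcap_(B in [set B : set 'rV[R]_n | convex.convex_set B /\ A `<=` B]) B.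

(* d is the dimension of the affine hull of the nonempty set F, i.e. of the
   smallest U such that F is contained in x0 + U. *)
Definition affine_dim n (F : set 'rV[R]_n) (d : nat) : Prop :=
  exists (x0 : 'rV[R]_n) (U : {vspace 'rV[R]_n}),
    [/\ F x0, \dim U = d, forall x, F x -> x - x0 \in U &
        forall V : {vspace 'rV[R]_n},
          (forall x, F x -> x - x0 \in V) -> (U <= V)%VS].

Definition face n (P F : set 'rV[R]_n) : Prop :=
  exists (c : 'cV[R]_n) (b : R),
    (forall x, P x -> (x *m c) ord0 ord0 <= b) /\
    F = P `&` [set x | (x *m c) ord0 ord0 = b].

Definition vertex n (P F : set 'rV[R]_n) : Prop := face P F /\ affine_dim F 0.

Definition edge n (P F : set 'rV[R]_n) : Prop := face P F /\ affine_dim F 1.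

Definition facets n (P : set 'rV[R]_n) : set (set 'rV[R]_n) :=
  [set F | face P F /\ exists2 d, affine_dim P d.+1 & affine_dim F d].

Definition has_vertices n (P F : set 'rV[R]_n) (k : nat) : Prop :=
  [set v | vertex P v /\ v `<=` F] #= `I_k.

Definition cuboctahedron : set 'rV[R]_3 :=
  convex_hull
    [set x | exists (s : 'S_3) (a b : bool),
       x = col_perm s (\row_(i < 3) [:: (-1) ^+ a; (-1) ^+ b; 0]`_i)].

End RealGeometry.

Arguments SO : clear implicits.
Arguments hollow : clear implicits.
Arguments HSO : clear implicits.
Arguments sphere : clear implicits.
Arguments cuboctahedron : clear implicits.

(* Main.v *)
(* Every M in SO(4) has the form v |-> p v q for unit quaternions p, q, unique up
   to a common sign; so SO(4) is, in suitable linear coordinates, the set of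
   rank one 4x4 matrices p^T q of norm 1. In these coordinates the diagonal of M
   is a Hadamard transform of (p_i q_i), hence M is hollow iff p_i q_i = 0 for
   all i, i.e. iff p is supported on some set S of indices and q on its
   complement. For proper nonempty S this gives 14 pieces, linear images of S^2
   if #|S| is 1 or 3 and of S^1 x S^1 if #|S| = 2. The pieces of S and S' meet
   in the p^T q with p supported on A = S n S' and q on B = ~(S u S'): a circle
   if #|A| + #|B| = 3, two opposite points if #|A| = #|B| = 1, and nothing if A
   or B is empty.

   The cuboctahedron is the A3 root polytope, with vertices e_i - e_j; its
   nonempty proper faces are the hulls of {e_i - e_j | i in A, j in B} for A, B
   disjoint and nonempty, of dimension #|A| + #|B| - 2, and they intersect by the
   same rule.

   Over C the pieces become quadrics: z1^2 + z2^2 + z3^2 = 1, and two conics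
   which in null coordinates are s s' = 1 and t t' = 1. Intersecting with a
   generic plane of codimension 2 leads to a quadratic, resp. quartic, equation
   in one variable with nonzero discriminant. *)

From HB Require Import structures.
Require Import Defs.
From mathcomp Require Import all_boot all_order all_fingroup all_algebra.
From mathcomp Require Import all_classical reals.
From mathcomp Require Import separable interval_inference.
From mathcomp Require convex.
From mathcomp Require Import complex mpoly.
From mathcomp Require Import zify ring lra.

Set Implicit Arguments.
Unset Strict Implicit.
Unset Printing Implicit Defensive.

Import Order.TTheory GRing.Theory Num.Theory.

Local Open Scope classical_set_scope.
Local Open Scope card_scope.
Local Open Scope ring_scope.

(** * Zariski topology *)

(** Irreducibility, dimension and complex closure are studied for three models only: unit circle,
    unit sphere and torus. Every piece is the image of a model under a matrix with a one-sided
    inverse, and such images carry all of these notions along. The degree refers to the complex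
    closure, so the real points of a model must be shown dense in the complex model: rational
    parametrizations take natural parameters to real points, and a polynomial vanishing at all
    natural points is zero. Dimension is defined by chains of irreducible sets; the upper bound has
    to exclude chains of length 3, which would give three algebraically independent functions on a
    set that is finite over a plane. Tori and spheres are told apart by their degree, which is
    unique because two nonzero polynomials are both nonzero at some point. The passage from SO(4) to
    quaternions avoids group theory: the 2 x 2 minors of the coordinate matrix are linear
    combinations of quadrics given by orthogonality and by Hodge duality between pairs of rows. *)

Lemma card_image_finset (I : finType) (T : Type) (D : {set I}) (f : I -> T) :
  {in D &, injective f} -> f @` [set` D] #= `I_#|D|.
Proof.
move=> injf.
have injf' : {in [set` D] &, injective f}.
  by move=> i j; rewrite !inE /= => Di Dj; apply: injf.
apply: (card_eq_trans (inj_card_eq injf')).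
rewrite card_eq_sym (card_eql card_II).
have -> : [set` D] = (fun i : 'I_#|D| => enum_val i) @` [set: 'I_#|D|].
  apply/seteqP; split=> [i /= Di|_ [i _ <-]]; last exact: enum_valP.
  by exists (enum_rank_in Di i) => //; rewrite enum_rankK_in.
rewrite card_eq_sym; apply: inj_card_eq => i j _ _; exact: enum_val_inj.
Qed.

(** * Polynomials tested at natural points *)

Section NaturalPoints.
Variable K : numFieldType.

(** A monomial is determined by its exponent at the last variable together with its other exponents,
    so the coefficient of [m0] survives in [muni p] without cancellation. *)
Lemma muni_neq0 n (p : {mpoly K[n.+1]}) : p != 0 -> muni p != 0.
Proof.
rewrite -msupp_eq0 => p0.
have [m0 m0p] : exists m, m \in msupp p.
  by case: (msupp p) p0 => // m s _; exists m; rewrite mem_head.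
apply/eqP => /(congr1 (fun q : {poly {mpoly K[n]}} => q`_(m0 ord_max))).
rewrite muniE coef0 coef_sum.
move/(congr1 (mcoeff [multinom m0 (widen_ord (leqnSn n) i) | i < n])).
rewrite mcoeff0 raddf_sum /= (bigD1_seq m0) ?msupp_uniq //= big1 => [|m mm0].
  rewrite coefZ coefXn eqxx mulr1 mcoeffZ mcoeffX eqxx mulr1 addr0.
  by move/eqP; rewrite mcoeff_eq0 m0p.
rewrite coefZ coefXn; case: eqP => [e|_]; last by rewrite mulr0 mcoeff0.
rewrite mulr1 mcoeffZ mcoeffX; case: eqP => [/mnmP e'|_]; last by rewrite mulr0.
case/eqP: mm0; apply/mnmP => i; case: (unliftP ord_max i) => [j ->|-> //].
have := e' j; rewrite !mnmE /=.
by rewrite (_ : lift _ _ = widen_ord (leqnSn n) j) //; apply/val_inj; rewrite /= /bump leqNgt ltn_ord.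
Qed.

Lemma horner_muni n (p : {mpoly K[n.+1]}) (w : 'I_n -> K) (t : K) :
  (map_poly (meval w) (muni p)).[t] = p.@[fun i => oapp w t (unlift ord_max i)].
Proof.
rewrite muniE mevalE rmorph_sum /= horner_sum; apply: eq_bigr => m _.
rewrite !map_polyZ map_polyXn /= hornerZ hornerXn mevalZ mevalX.
rewrite big_ord_recr /= unlift_none /= mulrA; congr (_ * _ * _).
apply: eq_bigr => i _; rewrite mnmE.
by rewrite (_ : widen_ord _ i = lift ord_max i) ?liftK //;
  apply/val_inj; rewrite /= /bump leqNgt ltn_ord.
Qed.

(** Induction on n: at a natural point where the leading coefficient in the last variable is
    nonzero, a nonzero univariate polynomial remains, with finitely many roots, while natural
    numbers are distinct in characteristic 0. Natural points are real, even when the polynomial is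
    complex. *)
Lemma mpoly_nat_neq0 n (p : {mpoly K[n]}) :
  p != 0 -> exists v : 'I_n -> nat, p.@[fun i => (v i)%:R] != 0.
Proof.
elim: n p => [|n IHn] p p0.
  exists (fun=> 0%N); apply: contraNneq p0 => p0.
  have pE : p = (p@_0%MM)%:MP.
    apply/mpolyP => m; rewrite (_ : m = 0%MM) ?mcoeffC ?eqxx ?mulr1 //.
    by apply/mnmP => -[].
  by rewrite pE mevalC in p0; rewrite pE p0 mpolyC0.
have := muni_neq0 p0.
set q := muni p => q0.
have q1 : lead_coef q != 0 by rewrite lead_coef_eq0.
have [w w0] := IHn _ q1.
pose r := map_poly (meval (fun i => (w i)%:R)) q.
have r0 : r != 0.
  apply: contraNneq w0 => /(congr1 (fun s : {poly K} => s`_(size q).-1)).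
  by rewrite coef0 coef_map /lead_coef => ->.
have [t /negP tr] : exists t : nat, ~ root r t%:R.
  apply: contrapT => /forallNP h.
  pose s := [seq i%:R : K | i <- iota 0 (size r)].
  have /(max_poly_roots r0) : all (root r) s.
    by apply/allP => _ /mapP[i _ ->]; apply: contrapT; apply: h.
  rewrite map_inj_uniq ?iota_uniq; last first.
    by move=> i j /eqP; rewrite eqr_nat => /eqP.
  by move=> /(_ isT); rewrite size_map size_iota ltnn.
exists (fun i => oapp w t (unlift ord_max i)).
rewrite /root horner_muni in tr; apply: contraNneq tr => <-; apply/eqP.
by apply: meval_eq => i; case: (unlift _ _).
Qed.

End NaturalPoints.

(** * Irreducible sets, closures and linear embeddings *)

Section Zariski.
Variable K : fieldType.
Implicit Types n : nat.

Definition vanishes n (f : {mpoly K[n]}) (Z : set 'rV[K]_n) : Prop :=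
  forall x, Z x -> f.@[x ord0] = 0.

(** The vanishing ideal of [Z] is prime. Unlike [irreducible], this does not ask [Z] to be
    algebraic, so it passes to the image under any matrix. *)
Definition prime_set n (Z : set 'rV[K]_n) : Prop :=
  Z !=set0 /\ forall f g : {mpoly K[n]},
    vanishes (f * g) Z -> vanishes f Z \/ vanishes g Z.

Lemma vanishesS n (f : {mpoly K[n]}) Y Z :
  Y `<=` Z -> vanishes f Z -> vanishes f Y.
Proof. by move=> YZ fZ x /YZ /fZ. Qed.

Lemma algebraic_zero1 n (f : {mpoly K[n]}) :
  algebraic [set x : 'rV_n | f.@[x ord0] = 0].
Proof.
exists [set f]; apply/seteqP; split=> x /= fx; first by move=> _ ->.
exact: fx.
Qed.

Lemma algebraicI n (A B : set 'rV[K]_n) :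
  algebraic A -> algebraic B -> algebraic (A `&` B).
Proof.
move=> [S ->] [T ->]; exists (S `|` T); apply/seteqP; split=> x.
  by move=> [Sx Tx] p [/Sx|/Tx].
by move=> STx; split=> p Hp; apply: STx; [left|right].
Qed.

Lemma algebraic_sep n (A : set 'rV[K]_n) x :
  algebraic A -> ~ A x -> exists2 f, vanishes f A & f.@[x ord0] != 0.
Proof.
move=> [S ->] /existsNP[f] /not_implyP[Sf /eqP fx].
by exists f => // y; apply.
Qed.

Lemma irreducible_prime n (Z : set 'rV[K]_n) : irreducible Z -> prime_set Z.
Proof.
move=> [_ Z0 irrZ]; split=> // f g fg.
have [|Zf|Zg] := irrZ _ _ (algebraic_zero1 f) (algebraic_zero1 g).
- move=> x /fg /eqP; rewrite mevalM mulf_eq0.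
  by move=> /orP[] /eqP; [left|right].
- by left.
- by right.
Qed.

Lemma prime_irreducible n (Z : set 'rV[K]_n) :
  algebraic Z -> prime_set Z -> irreducible Z.
Proof.
move=> algZ [Z0 primeZ]; split=> // A B algA algB ZAB.
apply: contrapT => /not_orP[/existsNP[x /not_implyP[Zx Ax]]].
move=> /existsNP[y /not_implyP[Zy By]].
have [f fA fx] := algebraic_sep algA Ax.
have [g gB gy] := algebraic_sep algB By.
case: (primeZ f g) => [z /ZAB|/(_ _ Zx) /eqP|/(_ _ Zy) /eqP].
- by rewrite mevalM; move=> [/fA|/gB] ->; rewrite ?mul0r ?mulr0.
- by rewrite (negbTE fx).
- by rewrite (negbTE gy).
Qed.

(** If no [C i] contained [Z], each would have an equation [f i] that is not identically zero on
    [Z]; the product of these vanishes on [Z], against primality. *)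
Lemma prime_sub_bigcup n (I : finType) (D : pred I) (C : I -> set 'rV[K]_n)
    (Z : set 'rV[K]_n) :
  prime_set Z -> (forall i, D i -> algebraic (C i)) ->
  (forall x, Z x -> exists2 i, D i & C i x) -> exists2 i, D i & Z `<=` C i.
Proof.
move=> [[z Zz] primeZ] algC ZC; apply: contrapT => nZC.
have sep i : exists f, D i -> vanishes f (C i) /\ ~ vanishes f Z.
  case: (boolP (D i)) => [Di|_]; last by exists 0.
  have /existsNP[x /not_implyP[Zx Cx]] : ~ Z `<=` C i by move=> ZCi; apply: nZC; exists i.
  have [f fC fx] := algebraic_sep (algC _ Di) Cx.
  by exists f => _; split=> // /(_ _ Zx) /eqP; rewrite (negbTE fx).
pose f i := projT1 (cid (sep i)).
have fP i (Di : D i) : vanishes (f i) (C i) /\ ~ vanishes (f i) Z.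
  exact: (projT2 (cid (sep i)) Di).
have : ~ vanishes (\prod_(i | D i) f i) Z.
  elim/big_ind: _ => [/(_ _ Zz) /eqP|p q np nq pq|i /fP[]//].
    by rewrite meval1 oner_eq0.
  by case: (primeZ _ _ pq).
apply=> x Zx; have [i Di Cix] := ZC x Zx.
by rewrite (bigD1 i) //= mevalM (fP i Di).1 ?mul0r.
Qed.

(** An irreducible subset of the union lies in a single [C i], so maximal ones are among the [C i];
    incomparability makes each [C i] maximal. *)
Lemma irreducible_components_finite n (I : finType) (D : pred I)
    (C : I -> set 'rV[K]_n) :
  (forall i, D i -> irreducible (C i)) ->
  (forall i j, D i -> D j -> C i `<=` C j -> i = j) ->
  irreducible_components [set x | exists2 i, D i & C i x] = C @` [set` D].
Proof.
move=> irrC incC.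
have algC i : D i -> algebraic (C i) by move=> /irrC[].
apply/seteqP; split=> [Z [irrZ ZX maxZ]|_ [i /= Di <-]].
  have [i Di ZC] := prime_sub_bigcup (irreducible_prime irrZ) algC ZX.
  exists i => //; apply: maxZ (irrC _ Di) _ ZC.
  by move=> x Cx; exists i.
split=> [||Z irrZ ZX CZ]; first exact: irrC.
  by move=> x Cx; exists i.
have [j Dj ZC] := prime_sub_bigcup (irreducible_prime irrZ) algC ZX.
have ij : i = j by apply: incC => // x /CZ /ZC.
by apply/seteqP; split=> // x /ZC; rewrite -ij.
Qed.

Lemma zariski_closure_algebraic n (Z : set 'rV[K]_n) : algebraic (zariski_closure Z).
Proof. by exists (vanishing_ideal Z). Qed.

Lemma sub_zariski_closure n (Z : set 'rV[K]_n) : Z `<=` zariski_closure Z.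
Proof. by move=> x Zx p; apply. Qed.

Lemma zariski_closure_eq n (Z Y : set 'rV[K]_n) :
  Z `<=` Y -> algebraic Y -> (forall f, vanishes f Z -> vanishes f Y) ->
  zariski_closure Z = Y.
Proof.
move=> ZY algY YZ; apply/seteqP; split=> x; last first.
  by move=> Yx f fZ; apply: YZ Yx.
move=> Zx; apply: contrapT => Yx.
have [f fY fx] := algebraic_sep algY Yx.
case/eqP: fx; apply: Zx; exact: vanishesS ZY fY.
Qed.

Definition linear_form m n (A : 'M[K]_(m, n)) (j : 'I_n) : {mpoly K[m]} :=
  \sum_i A i j *: 'X_i.

Lemma meval_linear_form m n (A : 'M[K]_(m, n)) j (x : 'rV_m) :
  (linear_form A j).@[x ord0] = (x *m A) ord0 j.
Proof.
rewrite raddf_sum mxE; apply: eq_bigr => i _ /=.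
by rewrite mevalZ mevalXU mulrC.
Qed.

Definition pullback m n (A : 'M[K]_(m, n)) (f : {mpoly K[n]}) : {mpoly K[m]} :=
  f \mPo [tuple linear_form A j | j < n].

Lemma meval_pullback m n (A : 'M[K]_(m, n)) f (x : 'rV_m) :
  (pullback A f).@[x ord0] = f.@[(x *m A) ord0].
Proof.
rewrite comp_mpoly_meval; apply: meval_eq => j.
by rewrite tnth_mktuple meval_linear_form.
Qed.

Lemma algebraic_preimage m n (A : 'M[K]_(m, n)) (Y : set 'rV[K]_n) :
  algebraic Y -> algebraic [set x | Y (x *m A)].
Proof.
move=> [S ->]; exists (pullback A @` S); apply/seteqP; split=> x /= Sx.
  by move=> _ [p Sp <-]; rewrite meval_pullback; apply: Sx.
by move=> p Sp; rewrite -meval_pullback; apply: Sx; exists p.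
Qed.

Lemma polynomial_map_linear m n (A : 'M[K]_(m, n)) :
  polynomial_map (fun x : 'rV_m => x *m A).
Proof.
exists (linear_form A) => x; apply/rowP => j.
by rewrite [RHS]mxE meval_linear_form.
Qed.

Lemma algebraic_eq_linear m n (A B : 'M[K]_(m, n)) :
  algebraic [set x : 'rV_m | x *m A = x *m B].
Proof.
exists [set linear_form (A - B) j | j in setT]; apply/seteqP; split=> x /= xAB.
  by move=> _ [j _ <-]; rewrite meval_linear_form mulmxBr xAB subrr mxE.
apply/rowP => j; apply/eqP; rewrite -subr_eq0; apply/eqP.
have := xAB _ (ex_intro2 _ _ j I erefl).
by rewrite meval_linear_form mulmxBr !mxE.
Qed.

Definition mximage m n (E : 'M[K]_(m, n)) (Y : set 'rV[K]_m) : set 'rV[K]_n :=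
  (fun y => y *m E) @` Y.

Lemma prime_mximage m n (E : 'M[K]_(m, n)) Y :
  prime_set Y -> prime_set (mximage E Y).
Proof.
have vE f Z : vanishes f (mximage E Z) <-> vanishes (pullback E f) Z.
  split=> fZ x => [Zx|[y Zy <-]]; last by rewrite -meval_pullback fZ.
  by rewrite meval_pullback; apply: fZ; exists x.
move=> [[y Yy] primeY]; split=> [|f g]; first by exists (y *m E), y.
rewrite !vE => fg; apply: primeY => x /fg.
by rewrite mevalM !meval_pullback mevalM.
Qed.

Section LinearEmbedding.
Variables (m n : nat) (E : 'M[K]_(m, n)) (E' : 'M[K]_(n, m)).
Hypothesis EK : E *m E' = 1%:M.

(** A preimage cut by linear equations is visibly algebraic; the factor [1%:M] gives the equations
    the shape of [algebraic_eq_linear]. *)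
Lemma mximage_preim Y : mximage E Y = [set x | Y (x *m E')] `&` [set x | x *m (E' *m E) = x *m 1%:M].
Proof.
apply/seteqP; split=> [_ [y Yy <-]|x [/= Yx xE]].
  by rewrite /= -mulmxA EK !mulmx1 mulmxA -(mulmxA y) EK mulmx1.
by exists (x *m E') => //; rewrite -mulmxA xE mulmx1.
Qed.

Lemma mximageE Y y : mximage E Y (y *m E) = Y y.
Proof.
rewrite mximage_preim /= -mulmxA EK !mulmx1 mulmxA -(mulmxA y) EK mulmx1.
by apply/propext; split=> [[]|].
Qed.

Lemma algebraic_mximage Y : algebraic Y -> algebraic (mximage E Y).
Proof.
move=> algY; rewrite mximage_preim; apply: algebraicI.
  exact: algebraic_preimage.
exact: algebraic_eq_linear.
Qed.

Lemma irreducible_mximage Y : irreducible Y -> irreducible (mximage E Y).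
Proof.
move=> irrY; apply: prime_irreducible; last exact/prime_mximage/irreducible_prime.
by apply: algebraic_mximage; case: irrY.
Qed.

(** Chains are carried back by [E']. For subsets of the image, mapping by [E'] agrees with taking
    the preimage under [E]: the first description gives primality, the second algebraicity. *)
Lemma irreducible_chain_mximage Y d :
  irreducible_chain (mximage E Y) d <-> irreducible_chain Y d.
Proof.
split=> [[Z [irrZ ltZ]]|[Z [irrZ ltZ]]]; last first.
  exists (fun i => mximage E (Z i)); split=> i id.
    have [irr ZY] := irrZ i id; split; first exact: irreducible_mximage.
    by move=> _ [y Zy <-]; exists y => //; apply: ZY.
  have [ZZ nZZ] := ltZ i id; split=> [_ [y Zy <-]|le].
    by exists y => //; apply: ZZ.
  apply: nZZ => y Zy.
  by have := le (y *m E); rewrite !mximageE; apply.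
have ZE i x : (i <= d)%N -> Z i x -> x *m E' *m E = x.
  by move=> /irrZ[_ ZY] /ZY; rewrite mximage_preim /= => -[_]; rewrite mulmxA mulmx1.
have ZP i : (i <= d)%N -> mximage E' (Z i) = [set y | Z i (y *m E)].
  move=> id; apply/seteqP; split=> [_ [x Zx <-]|y Zy].
    by rewrite /= (ZE i).
  by exists (y *m E) => //; rewrite -mulmxA EK mulmx1.
exists (fun i => mximage E' (Z i)); split=> i id.
  have [irr ZY] := irrZ i id; split; last first.
    by rewrite ZP // => y /= /ZY; rewrite mximageE.
  apply: prime_irreducible; last exact/prime_mximage/irreducible_prime.
  by rewrite ZP //; apply: algebraic_preimage; case: irr.
have [ZZ nZZ] := ltZ i id; split=> [_ [y Zy <-]|le].
  by exists y => //; apply: ZZ.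
apply: nZZ => x Zx.
have := le (x *m E'); rewrite (ZP i) ?(ltnW id) //= (ZE i.+1) //; apply.
by exists x.
Qed.

Lemma has_dim_mximage Y d : has_dim (mximage E Y) d <-> has_dim Y d.
Proof. by rewrite /has_dim !irreducible_chain_mximage. Qed.

End LinearEmbedding.

Lemma irreducible_set1 n (x : 'rV[K]_n) : irreducible [set x].
Proof.
split; [|by exists x|].
  exists [set ('X_j - (x ord0 j)%:MP) | j in setT]; apply/seteqP; split=> y.
    by move=> -> _ [j _ <-]; rewrite mevalB mevalXU mevalC subrr.
  move=> Hy; apply/rowP => j; have := Hy _ (ex_intro2 _ _ j I erefl).
  by rewrite mevalB mevalXU mevalC => /eqP; rewrite subr_eq0 => /eqP.
by move=> A B _ _ /(_ x erefl) [Ax|Bx]; [left|right] => _ ->.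
Qed.

Lemma irreducible_chain_le n (X : set 'rV[K]_n) d d' :
  (d <= d')%N -> irreducible_chain X d' -> irreducible_chain X d.
Proof.
move=> dd' [Z [irrZ ltZ]]; exists Z; split=> i id.
  by apply: irrZ; apply: leq_trans dd'.
by apply: ltZ; apply: leq_trans dd'.
Qed.

Lemma has_dim_inj n (X : set 'rV[K]_n) d d' :
  has_dim X d -> has_dim X d' -> d = d'.
Proof.
move=> [cd ncd] [cd' ncd'].
case: (ltngtP d d') => // lt; [case: ncd|case: ncd']; exact: irreducible_chain_le lt _.
Qed.

Lemma irreducible_chain_extend n (X Y : set 'rV[K]_n) d :
  irreducible Y -> X `<` Y -> irreducible_chain X d -> irreducible_chain Y d.+1.
Proof.
move=> irrY [XY nXY] [Z [irrZ ltZ]].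
exists (fun i => if (i <= d)%N then Z i else Y); split=> i id.
  case: ifP => [/irrZ[irr ZX]|_]; last by split.
  by split=> // x /ZX /XY.
rewrite -ltnS id; case: ifP => [|/negbT]; rewrite -?leqNgt => id'; first exact: ltZ.
have -> : i = d by apply/eqP; rewrite eqn_leq -ltnS id.
have [_ ZX] := irrZ d (leqnn d).
by split=> [x /ZX /XY //|le]; apply: nXY => x /le /ZX.
Qed.

(** An irreducible subset of a finite set is covered by points, hence lies in one of them and has no
    strictly smaller nonempty subset. *)
Lemma irreducible_chain_finite n (X : set 'rV[K]_n) d :
  finite_set X -> irreducible_chain X d -> d = 0%N.
Proof.
move=> finX [Z [irrZ ltZ]]; case: d irrZ ltZ => // d irrZ ltZ; exfalso.
have [irr1 Z1X] := irrZ 1%N isT.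
have [[/irreducible_prime[[z0 Zz0] _] _] [Z01 nZ10]] := (irrZ 0%N isT, ltZ 0%N isT).
have /finite_seqP[s Zs] : finite_set (Z 1%N) by apply: sub_finite_set finX.
have [||i _ ZI] := @prime_sub_bigcup n 'I_(size s) predT (fun i => [set s`_i]) _ (irreducible_prime irr1).
- by move=> i _; case: (irreducible_set1 s`_i).
- by move=> x; rewrite Zs => /= /(nthP 0)[i si <-]; exists (Ordinal si).
apply: nZ10 => x /ZI ->; by have /ZI <- := Z01 _ Zz0.
Qed.

End Zariski.

(** * Unirational sets *)

Section UnirationalSets.
Variables (K : numFieldType) (m n : nat).
Variables (phi : 'I_n -> {mpoly K[m]}) (r : {mpoly K[m]}).

(** [f] composed with [phi / r], times a power of [r] that clears all denominators. On the support
    [mdeg mu < msize f], so the subtraction in the exponent never truncates. *)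
Definition homogenized_pullback (f : {mpoly K[n]}) : {mpoly K[m]} :=
  \sum_(mu <- msupp f)
    f@_mu *: (\prod_i phi i ^+ mu i * r ^+ (msize f - mdeg mu)).

Lemma meval_homogenized_pullback f (a : 'I_m -> K) : r.@[a] != 0 ->
  (homogenized_pullback f).@[a] =
  r.@[a] ^+ msize f * f.@[fun i => (phi i).@[a] / r.@[a]].
Proof.
move=> ra; rewrite raddf_sum /= [f.@[_]]mevalE mulr_sumr.
apply: eq_big_seq => mu /msize_mdeg_lt /ltnW lemu.
rewrite mevalZ mevalM rmorph_prod rmorphXn /= [RHS]mulrCA; congr (_ * _).
rewrite [in RHS](eq_bigr (fun i => (phi i).@[a] ^+ mu i * r.@[a] ^- mu i)); last first.
  by move=> i _; rewrite expr_div_n.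
rewrite big_split /= [RHS]mulrCA; congr (_ * _).
  by apply: eq_bigr => i _; rewrite rmorphXn.
by rewrite prodfV prodrXr -mdegE -expfB_cond ?(negbTE ra).
Qed.

(* Clearing denominators turns the vanishing of f on the image of phi / r into
   the vanishing of a polynomial on K^m, which can be tested on N^m. *)
Lemma unirational_prime (W Y : set 'rV[K]_n) :
  r != 0 ->
  (forall v : 'I_m -> nat, let a i := (v i)%:R in
     r.@[a] != 0 -> W (\row_i ((phi i).@[a] / r.@[a]))) ->
  (forall y, Y y -> exists2 a, r.@[a] != 0 &
     forall i, y ord0 i = (phi i).@[a] / r.@[a]) ->
  forall f g, vanishes (f * g) W -> vanishes f Y \/ vanishes g Y.
Proof.
move=> r0 Wnat Yparam f g fgW.
have zeroY h : homogenized_pullback h = 0 -> vanishes h Y.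
  move=> h0 y /Yparam[a ra ya].
  have /eqP := meval_homogenized_pullback h ra.
  rewrite h0 meval0 eq_sym mulf_eq0 expf_eq0 (negbTE ra) andbF /= => /eqP <-.
  exact: meval_eq.
(* The extra factor [r] makes the product vanish also at natural points where the parametrization is
   undefined. *)
have : homogenized_pullback f * homogenized_pullback g * r = 0.
  apply: contrapT => /eqP /mpoly_nat_neq0[v].
  have [r0'|ra] := eqVneq (r.@[fun i => (v i)%:R]) 0.
    by rewrite mevalM r0' mulr0 eqxx.
  rewrite !mevalM !meval_homogenized_pullback //.
  rewrite mulrACA -mevalM.
  have := fgW _ (Wnat v ra); set b := (fun i => _ / _) => fg0.
  rewrite (_ : (f * g).@[b] = 0) ?mulr0 ?mul0r ?eqxx //.
  by rewrite -fg0; apply: meval_eq => i; rewrite mxE.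
move/eqP; rewrite !mulf_eq0 (negbTE r0) orbF.
by move=> /orP[] /eqP /zeroY; [left|right].
Qed.

(** With [W] the real points of a complex set [Y], this gives both the irreducibility of [Y] and the
    density of [W]. A polynomial [f] vanishing on [W] is handled by primality applied to [f * f]. *)
Lemma unirational_closure (W Y : set 'rV[K]_n) :
  r != 0 -> algebraic Y -> W `<=` Y ->
  (forall v : 'I_m -> nat, let a i := (v i)%:R in
     r.@[a] != 0 -> W (\row_i ((phi i).@[a] / r.@[a]))) ->
  (forall y, Y y -> exists2 a, r.@[a] != 0 &
     forall i, y ord0 i = (phi i).@[a] / r.@[a]) ->
  irreducible Y /\ zariski_closure W = Y.
Proof.
move=> r0 algY WY Wnat Yparam.
have prime := unirational_prime r0 Wnat Yparam; split; last first.
  apply: zariski_closure_eq => // f fW.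
  by case: (prime f f) => // x Wx; rewrite mevalM fW ?mul0r.
apply: prime_irreducible => //; split=> [|f g fg]; last first.
  by apply: prime; apply: vanishesS fg.
have [v rv] := mpoly_nat_neq0 r0.
by have := Wnat v rv; move=> /WY; exists (\row_i ((phi i).@[fun i => (v i)%:R] / r.@[fun i => (v i)%:R])).
Qed.

End UnirationalSets.

(** * The models: circle, sphere and torus *)

Lemma ord2P (P : 'I_2 -> Prop) : P ord0 -> P (lift ord0 ord0) -> forall i, P i.
Proof.
move=> P0 P1 [[|[|//]] lti]; first by rewrite (_ : Ordinal _ = ord0) //; apply/val_inj.
by rewrite (_ : Ordinal _ = lift ord0 ord0) //; apply/val_inj.
Qed.

Lemma ord3P (P : 'I_3 -> Prop) : P ord0 -> P (lift ord0 ord0) ->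
  P (lift ord0 (lift ord0 ord0)) -> forall i, P i.
Proof.
move=> P0 P1 P2 i; case: (unliftP ord0 i) => [j ->|-> //].
by apply: (ord2P (P := fun j => P (lift ord0 j))).
Qed.

Lemma ord4P (P : 'I_4 -> Prop) : P ord0 -> P (lift ord0 ord0) ->
  P (lift ord0 (lift ord0 ord0)) -> P (lift ord0 (lift ord0 (lift ord0 ord0))) ->
  forall i, P i.
Proof.
move=> P0 P1 P2 P3 i; case: (unliftP ord0 i) => [j ->|-> //].
by apply: (ord3P (P := fun j => P (lift ord0 j))).
Qed.

(** A version of [sphere] over an arbitrary field, because the same equations are needed over the
    complex numbers; over the reals both unfold to the same set. *)
Definition unit_sphere (K : fieldType) k : set 'rV[K]_k.+1 :=
  [set x | \sum_(i < k.+1) x ord0 i ^+ 2 = 1].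
Arguments unit_sphere : clear implicits.

Definition torus (K : fieldType) : set 'rV[K]_(2 + 2) :=
  prod_set (unit_sphere K 1) (unit_sphere K 1).
Arguments torus : clear implicits.

Section Models.
Variable K : fieldType.

Lemma unit_sphere_algebraic k : algebraic (unit_sphere K k).
Proof.
have := @algebraic_zero1 K k.+1 (\sum_i 'X_i ^+ 2 - 1); congr algebraic.
apply/seteqP; split=> x /=; rewrite mevalB meval1 raddf_sum /=;
  rewrite (eq_bigr (fun i => x ord0 i ^+ 2)) => [|i _]; rewrite ?rmorphXn /= ?mevalXU //.
  by move/eqP; rewrite subr_eq0 => /eqP.
by move=> ->; rewrite subrr.
Qed.

Lemma prod_set_algebraic p q (A : set 'rV[K]_p) (B : set 'rV[K]_q) :
  algebraic A -> algebraic B -> algebraic (prod_set A B).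
Proof.
move=> algA algB.
have -> : prod_set A B = [set x | A (x *m (col_mx 1%:M 0))] `&`
                         [set x | B (x *m (col_mx 0 1%:M))].
  have lE (x : 'rV[K]_(p + q)) : x *m (col_mx 1%:M 0) = lsubmx x.
    by rewrite -{1}[x]hsubmxK mul_row_col mulmx1 mulmx0 addr0.
  have rE (x : 'rV[K]_(p + q)) : x *m (col_mx 0 1%:M) = rsubmx x.
    by rewrite -{1}[x]hsubmxK mul_row_col mulmx1 mulmx0 add0r.
  by apply/seteqP; split=> x; rewrite /prod_set /= lE rE.
by apply: algebraicI; apply: algebraic_preimage.
Qed.

Lemma torus_algebraic : algebraic (torus K).
Proof. by apply: prod_set_algebraic; apply: unit_sphere_algebraic. Qed.

Lemma torusE x : torus K x <->
  x ord0 ord0 ^+ 2 + x ord0 (lift ord0 ord0) ^+ 2 = 1 /\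
  x ord0 (lift ord0 (lift ord0 ord0)) ^+ 2 +
  x ord0 (lift ord0 (lift ord0 (lift ord0 ord0))) ^+ 2 = 1.
Proof.
rewrite /torus /prod_set /unit_sphere /= !big_ord_recl !big_ord0 !addr0 !mxE.
have -> : lshift 2 (ord0 : 'I_2) = ord0 :> 'I_(2 + 2) by apply/val_inj.
have -> : lshift 2 (lift ord0 ord0 : 'I_2) = lift ord0 ord0 :> 'I_(2 + 2).
  by apply/val_inj.
have -> : rshift 2 (ord0 : 'I_2) = lift ord0 (lift ord0 ord0) :> 'I_(2 + 2).
  by apply/val_inj.
have -> // : rshift 2 (lift ord0 ord0 : 'I_2) = lift ord0 (lift ord0 (lift ord0 ord0)) :> 'I_(2 + 2).
by apply/val_inj.
Qed.

Lemma unit_sphere1E x : unit_sphere K 1 x <->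
  x ord0 ord0 ^+ 2 + x ord0 (lift ord0 ord0) ^+ 2 = 1.
Proof. by rewrite /unit_sphere /= !big_ord_recl !big_ord0 !addr0. Qed.

Lemma unit_sphere2E x : unit_sphere K 2 x <->
  x ord0 ord0 ^+ 2 + x ord0 (lift ord0 ord0) ^+ 2 +
  x ord0 (lift ord0 (lift ord0 ord0)) ^+ 2 = 1.
Proof. by rewrite /unit_sphere /= !big_ord_recl !big_ord0 !addr0 addrA. Qed.

End Models.

Section RealPoints.
Variables (F K : numFieldType) (iota : {rmorphism F -> K}).

(** With [iota] the identity, the results below concern [K] alone; with [real_complex] they describe
    the complex Zariski closure. *)
Definition real_points n (Z : set 'rV[F]_n) : set 'rV[K]_n := map_mx iota @` Z.

Lemma real_points_sphere k : real_points (unit_sphere F k) `<=` unit_sphere K k.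
Proof.
move=> _ [x xS <-]; rewrite /unit_sphere /= -[RHS](rmorph1 iota) -xS rmorph_sum.
by apply: eq_bigr => i _; rewrite mxE rmorphXn.
Qed.

Lemma real_points_torus : real_points (torus F) `<=` torus K.
Proof.
move=> _ [x /torusE[x1 x2] <-]; apply/torusE; rewrite !mxE -!rmorphXn -!rmorphD /=.
by rewrite x1 x2 rmorph1.
Qed.

(** Real and imaginary part of (a + ib)^2, to be divided by the norm a^2 + b^2: the half-angle
    parametrization in homogeneous form, which also reaches (-1, 0). *)
Definition circle_num : 'I_2 -> {mpoly K[2]} :=
  nth 0 [:: 'X_ord0 ^+ 2 - 'X_(lift ord0 ord0) ^+ 2; 'X_ord0 * 'X_(lift ord0 ord0) *+ 2].

Definition circle_den : {mpoly K[2]} := 'X_ord0 ^+ 2 + 'X_(lift ord0 ord0) ^+ 2.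

Lemma meval_circle (a : 'I_2 -> K) :
  ((circle_num ord0).@[a] = a ord0 ^+ 2 - a (lift ord0 ord0) ^+ 2) *
  ((circle_num (lift ord0 ord0)).@[a] = a ord0 * a (lift ord0 ord0) *+ 2) *
  (circle_den.@[a] = a ord0 ^+ 2 + a (lift ord0 ord0) ^+ 2).
Proof.
rewrite /circle_num /circle_den /= mevalB mevalMn mevalD !rmorphXn /= mevalM !mevalXU.
by do !split.
Qed.

Lemma circle_nat (a b : nat) : (a%:R ^+ 2 + b%:R ^+ 2 : K) != 0 ->
  exists2 x : 'rV[F]_2, unit_sphere F 1 x &
    iota (x ord0 ord0) = (a%:R ^+ 2 - b%:R ^+ 2) / (a%:R ^+ 2 + b%:R ^+ 2) /\
    iota (x ord0 (lift ord0 ord0)) = (a%:R * b%:R *+ 2) / (a%:R ^+ 2 + b%:R ^+ 2).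
Proof.
move=> ab0.
have ab0' : (a%:R ^+ 2 + b%:R ^+ 2 : F) != 0.
  by rewrite -(fmorph_eq0 iota) rmorphD !rmorphXn /= !rmorph_nat.
exists (\row_i nth 0 [:: (a%:R ^+ 2 - b%:R ^+ 2) / (a%:R ^+ 2 + b%:R ^+ 2);
                     (a%:R * b%:R *+ 2) / (a%:R ^+ 2 + b%:R ^+ 2)] i).
  by apply/unit_sphere1E; rewrite !mxE /=; field.
rewrite !mxE /=; split.
  by rewrite !(rmorphXn, fmorph_div, rmorphB, rmorphD) /= !(rmorph_nat iota).
by rewrite fmorph_div rmorphMn rmorphM rmorphD !rmorphXn /= !(rmorph_nat iota).
Qed.

(** The parameters (1 + x, y) bisect the angle of (x, y), with a^2 + b^2 = 2 (1 + x). They fail only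
    for x = -1, where the equation forces y = 0, also over the complex numbers, and (0, 1)
    serves. *)
Lemma circle_param (x y : K) : x ^+ 2 + y ^+ 2 = 1 -> exists a b : K,
  [/\ a ^+ 2 + b ^+ 2 != 0, x = (a ^+ 2 - b ^+ 2) / (a ^+ 2 + b ^+ 2) &
      y = (a * b *+ 2) / (a ^+ 2 + b ^+ 2)].
Proof.
move=> xy.
have yE : y ^+ 2 = 1 - x ^+ 2 by rewrite -xy; ring.
have [x1|x1] := eqVneq (1 + x) 0.
  have xE : x = -1 by apply/eqP; rewrite -addr_eq0 addrC x1.
  have y0 : y = 0 by apply/eqP; rewrite -sqrf_eq0 yE xE; apply/eqP; ring.
  by exists 0, 1; rewrite xE y0 expr0n /= expr1n add0r oner_eq0; split=> //; field.
have rE : (1 + x) ^+ 2 + y ^+ 2 = 2 * (1 + x) by rewrite yE; ring.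
by exists (1 + x), y; rewrite rE mulf_neq0 ?pnatr_eq0 //; split=> //; rewrite ?yE; field.
Qed.

Lemma circle_closure : irreducible (unit_sphere K 1) /\
  zariski_closure (real_points (unit_sphere F 1)) = unit_sphere K 1.
Proof.
apply: (unirational_closure (phi := circle_num) (r := circle_den)).
- apply/eqP => /(congr1 (meval (fun i : 'I_2 => if i == ord0 then 1 else 0 : K))).
  by rewrite meval0 meval_circle /= expr1n expr0n addr0 => /eqP; rewrite oner_eq0.
- exact: unit_sphere_algebraic.
- exact: real_points_sphere.
- move=> v /=; rewrite meval_circle => /circle_nat[x xS [x0 x1]].
  by exists x => //; apply/rowP; apply: ord2P; rewrite !mxE ?meval_circle.
- move=> y /unit_sphere1E /circle_param[a [b [ab0 y0 y1]]].
  exists (fun i : 'I_2 => if i == ord0 then a else b); first by rewrite meval_circle.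
  by apply: ord2P; rewrite !meval_circle.
Qed.

(** Two circle parametrizations brought to a common denominator, since [unirational_closure] takes a
    single [r]. *)
Definition torus_num : 'I_4 -> {mpoly K[4]} :=
  nth 0 [:: ('X_ord0 ^+ 2 - 'X_(lift ord0 ord0) ^+ 2) *
            ('X_(lift ord0 (lift ord0 ord0)) ^+ 2 + 'X_(lift ord0 (lift ord0 (lift ord0 ord0))) ^+ 2);
            ('X_ord0 * 'X_(lift ord0 ord0) *+ 2) *
            ('X_(lift ord0 (lift ord0 ord0)) ^+ 2 + 'X_(lift ord0 (lift ord0 (lift ord0 ord0))) ^+ 2);
            ('X_(lift ord0 (lift ord0 ord0)) ^+ 2 - 'X_(lift ord0 (lift ord0 (lift ord0 ord0))) ^+ 2) *
            ('X_ord0 ^+ 2 + 'X_(lift ord0 ord0) ^+ 2);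
            ('X_(lift ord0 (lift ord0 ord0)) * 'X_(lift ord0 (lift ord0 (lift ord0 ord0))) *+ 2) *
            ('X_ord0 ^+ 2 + 'X_(lift ord0 ord0) ^+ 2)].

Definition torus_den : {mpoly K[4]} :=
  ('X_ord0 ^+ 2 + 'X_(lift ord0 ord0) ^+ 2) *
  ('X_(lift ord0 (lift ord0 ord0)) ^+ 2 + 'X_(lift ord0 (lift ord0 (lift ord0 ord0))) ^+ 2).

Lemma meval_torus (v : 'I_4 -> K) :
  let a := v ord0 in let b := v (lift ord0 ord0) in
  let c := v (lift ord0 (lift ord0 ord0)) in
  let d := v (lift ord0 (lift ord0 (lift ord0 ord0))) in
  ((torus_num ord0).@[v] = (a ^+ 2 - b ^+ 2) * (c ^+ 2 + d ^+ 2)) *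
  ((torus_num (lift ord0 ord0)).@[v] = (a * b *+ 2) * (c ^+ 2 + d ^+ 2)) *
  ((torus_num (lift ord0 (lift ord0 ord0))).@[v] = (c ^+ 2 - d ^+ 2) * (a ^+ 2 + b ^+ 2)) *
  ((torus_num (lift ord0 (lift ord0 (lift ord0 ord0)))).@[v] =
     (c * d *+ 2) * (a ^+ 2 + b ^+ 2)) *
  (torus_den.@[v] = (a ^+ 2 + b ^+ 2) * (c ^+ 2 + d ^+ 2)).
Proof.
rewrite /torus_num /torus_den /=.
rewrite !(rmorphXn, mevalB, mevalMn, mevalD, mevalM) /= !mevalXU.
by do !split.
Qed.

Lemma torus_closure : irreducible (torus K) /\
  zariski_closure (real_points (torus F)) = torus K.
Proof.
apply: (unirational_closure (phi := torus_num) (r := torus_den)).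
- apply/eqP => /(congr1 (meval (fun i : 'I_4 => if odd i then 0 else 1 : K))).
  by rewrite meval0 meval_torus /= expr1n expr0n addr0 mulr1 => /eqP; rewrite oner_eq0.
- exact: torus_algebraic.
- exact: real_points_torus.
- move=> v /=; rewrite meval_torus mulf_eq0 negb_or => /andP[ab0 cd0].
  have [x /unit_sphere1E xS [x0 x1]] := circle_nat ab0.
  have [y /unit_sphere1E yS [y0 y1]] := circle_nat cd0.
  exists (row_mx x y).
    by rewrite /torus /prod_set /= row_mxKl row_mxKr; split; apply/unit_sphere1E.
  have e0 : ord0 = lshift 2 (ord0 : 'I_2) :> 'I_(2 + 2) by apply/val_inj.
  have e1 : lift ord0 ord0 = lshift 2 (lift ord0 ord0 : 'I_2) :> 'I_(2 + 2).
    by apply/val_inj.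
  have e2 : lift ord0 (lift ord0 ord0) = rshift 2 (ord0 : 'I_2) :> 'I_(2 + 2).
    by apply/val_inj.
  have e3 : lift ord0 (lift ord0 (lift ord0 ord0)) = rshift 2 (lift ord0 ord0 : 'I_2) :> 'I_(2 + 2).
    by apply/val_inj.
  apply/rowP; apply: ord4P; rewrite [LHS]mxE [RHS]mxE !meval_torus.
  + by rewrite {1}e0 row_mxEl x0; field; rewrite ?ab0 ?cd0.
  + by rewrite {1}e1 row_mxEl x1; field; rewrite ?ab0 ?cd0.
  + by rewrite {1}e2 row_mxEr y0; field; rewrite ?ab0 ?cd0.
  + by rewrite {1}e3 row_mxEr y1; field; rewrite ?ab0 ?cd0.
- move=> y /torusE[/circle_param[a [b [ab0 y0 y1]]] /circle_param[c [d [cd0 y2 y3]]]].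
  exists (nth 0 [:: a; b; c; d]); first by rewrite meval_torus mulf_neq0.
  by apply: ord4P; rewrite !meval_torus /= ?(y0, y1, y2, y3); field; rewrite ?ab0 ?cd0.
Qed.

(* Unlike the stereographic parametrization, the Hopf map reaches every point
   of the sphere, over C as well as over R. *)
Definition hopf_num : 'I_3 -> {mpoly K[4]} :=
  nth 0 [:: ('X_ord0 * 'X_(lift ord0 (lift ord0 ord0)) +
             'X_(lift ord0 ord0) * 'X_(lift ord0 (lift ord0 (lift ord0 ord0)))) *+ 2;
            ('X_(lift ord0 ord0) * 'X_(lift ord0 (lift ord0 ord0)) -
             'X_ord0 * 'X_(lift ord0 (lift ord0 (lift ord0 ord0)))) *+ 2;
            'X_ord0 ^+ 2 + 'X_(lift ord0 ord0) ^+ 2 -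
            'X_(lift ord0 (lift ord0 ord0)) ^+ 2 - 'X_(lift ord0 (lift ord0 (lift ord0 ord0))) ^+ 2].

Definition hopf_den : {mpoly K[4]} :=
  'X_ord0 ^+ 2 + 'X_(lift ord0 ord0) ^+ 2 +
  'X_(lift ord0 (lift ord0 ord0)) ^+ 2 + 'X_(lift ord0 (lift ord0 (lift ord0 ord0))) ^+ 2.

Lemma meval_hopf (v : 'I_4 -> K) :
  let a := v ord0 in let b := v (lift ord0 ord0) in
  let c := v (lift ord0 (lift ord0 ord0)) in
  let d := v (lift ord0 (lift ord0 (lift ord0 ord0))) in
  ((hopf_num ord0).@[v] = (a * c + b * d) *+ 2) *
  ((hopf_num (lift ord0 ord0)).@[v] = (b * c - a * d) *+ 2) *
  ((hopf_num (lift ord0 (lift ord0 ord0))).@[v] = a ^+ 2 + b ^+ 2 - c ^+ 2 - d ^+ 2) *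
  (hopf_den.@[v] = a ^+ 2 + b ^+ 2 + c ^+ 2 + d ^+ 2).
Proof.
rewrite /hopf_num /hopf_den /=.
rewrite !(rmorphXn, mevalB, mevalMn, mevalD, mevalM) /= !mevalXU.
by do !split.
Qed.

Lemma sphere_closure : irreducible (unit_sphere K 2) /\
  zariski_closure (real_points (unit_sphere F 2)) = unit_sphere K 2.
Proof.
apply: (unirational_closure (phi := hopf_num) (r := hopf_den)).
- apply/eqP => /(congr1 (meval (fun i : 'I_4 => if i == ord0 then 1 else 0 : K))).
  by rewrite meval0 meval_hopf /= expr1n expr0n !addr0 => /eqP; rewrite oner_eq0.
- exact: unit_sphere_algebraic.
- exact: real_points_sphere.
- move=> v /=; rewrite meval_hopf.
  set a := v _; set b := v _; set c := v _; set d := v _ => r0.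
  have r0' : (a%:R ^+ 2 + b%:R ^+ 2 + c%:R ^+ 2 + d%:R ^+ 2 : F) != 0.
    by rewrite -(fmorph_eq0 iota) !rmorphD !rmorphXn /= !rmorph_nat.
  set r : F := _ + _ in r0'.
  exists (\row_i (nth 0 [:: (a%:R * c%:R + b%:R * d%:R) *+ 2;
     (b%:R * c%:R - a%:R * d%:R) *+ 2; a%:R ^+ 2 + b%:R ^+ 2 - c%:R ^+ 2 - d%:R ^+ 2] i / r)).
    by apply/unit_sphere2E; rewrite !mxE /= /r; field.
  have rE : iota r = a%:R ^+ 2 + b%:R ^+ 2 + c%:R ^+ 2 + d%:R ^+ 2.
    by rewrite /r !(rmorphD, rmorphXn) /= !(rmorph_nat iota).
  apply/rowP; apply: ord3P; rewrite !mxE /= !meval_hopf fmorph_div rE /=; congr (_ / _).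
  + by rewrite rmorphMn rmorphD !rmorphM /= !(rmorph_nat iota).
  + by rewrite rmorphMn rmorphB !rmorphM /= !(rmorph_nat iota).
  + by rewrite !(rmorphB, rmorphD, rmorphXn) /= !(rmorph_nat iota).
- move=> p /unit_sphere2E; set x := p _ _; set y := p _ _; set z := p _ _ => xyz.
  (* Over the complex numbers the plane z = -1 cuts the sphere in the two lines x^2 + y^2 = 0, which
     the parameters (x/2, y/2, 1, 0) reach. Elsewhere (1 + z, 0, x, -y) works, with denominator 2 (1
     + z). *)
  have [z1|z1] := eqVneq (1 + z) 0.
    have zE : z = -1 by apply/eqP; rewrite -addr_eq0 addrC z1.
    have xE : x ^+ 2 = - y ^+ 2.
      have -> : x ^+ 2 = (x ^+ 2 + y ^+ 2 + z ^+ 2) - y ^+ 2 - z ^+ 2 by ring.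
      by rewrite xyz zE; ring.
    exists (nth 0 [:: x / 2; y / 2; 1; 0]); rewrite meval_hopf /=.
      rewrite !expr_div_n xE mulNr addNr add0r expr1n expr0n addr0; exact: oner_neq0.
    rewrite (_ : _ + 0 ^+ 2 = 1); last by rewrite !expr_div_n xE; ring.
    apply: ord3P; rewrite !meval_hopf /= -?/x -?/y -?/z; [by field|by field|].
    by rewrite !expr_div_n xE zE; field.
  have yE : y ^+ 2 = 1 - x ^+ 2 - z ^+ 2 by rewrite -xyz; ring.
  exists (nth 0 [:: 1 + z; 0; x; - y]); rewrite meval_hopf /=.
    rewrite (_ : _ + _ = 2 * (1 + z)) ?mulf_neq0 ?pnatr_eq0 //.
    by rewrite sqrrN yE; ring.
  rewrite (_ : _ + (- y) ^+ 2 = 2 * (1 + z)); last by rewrite sqrrN yE; ring.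
  apply: ord3P; rewrite !meval_hopf /= -?/x -?/y -?/z ?sqrrN ?yE; by field.
Qed.

End RealPoints.

(** * Dimension *)

Section AlgebraicIndependence.
Variables (K : fieldType) (n : nat).

Lemma prime_exp (Z : set 'rV[K]_n) f m :
  prime_set Z -> vanishes (f ^+ m) Z -> vanishes f Z.
Proof.
move=> [[z Zz] primeZ]; elim: m => [/(_ z Zz) /eqP|m IHm].
  by rewrite expr0 meval1 oner_eq0.
by rewrite exprS => /primeZ[].
Qed.

(** For the least m with [z m] false, the sum is f^m times (g m + a multiple of f) on [Z'];
    primality cancels f^m, and on [Z], where f vanishes, only [g m] remains. In the applications
    [z i] says that all constants occurring in [g i] are zero. *)
Lemma leading_term_vanishes (Z Z' : set 'rV[K]_n) f (g : nat -> {mpoly K[n]})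
    (z : nat -> Prop) k :
  prime_set Z' -> Z `<=` Z' -> vanishes f Z -> ~ vanishes f Z' ->
  (forall i, z i -> g i = 0) ->
  vanishes (\sum_(i < k) g i * f ^+ i) Z' ->
  (exists2 i, (i < k)%N & ~ z i) ->
  exists2 i, (i < k)%N & ~ z i /\ vanishes (g i) Z.
Proof.
move=> primeZ' ZZ' fZ fZ' gz sum0 [i0 i0k zi0].
have ex : exists i, (i < k)%N && `[< ~ z i >] by exists i0; rewrite i0k; apply/asboolP.
case: (ex_minnP ex) => m /andP[mk /asboolP zm] minm.
have zlt i : (i < m)%N -> z i.
  move=> im; apply: contrapT => zi; have := minm i.
  rewrite (ltn_trans im mk) /=; move/asboolP: zi => -> /(_ isT).
  by rewrite leqNgt im.
exists m => //; split=> // x Zx.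
have : vanishes (f ^+ m * \sum_(m <= i < k) g i * f ^+ (i - m)) Z'.
  congr vanishes: sum0.
  rewrite -(big_mkord xpredT (fun i => g i * f ^+ i)) (big_cat_nat (n := m)) //=; last exact: ltnW.
  rewrite big_nat big1 => [|i /andP[_ /zlt /gz ->]]; last by rewrite mul0r.
  rewrite add0r mulr_sumr !big_nat; apply: eq_bigr => i /andP[mi _].
  by rewrite mulrCA -exprD subnKC.
case/primeZ'.2 => [/(prime_exp primeZ')//|/(_ x (ZZ' _ Zx))].
rewrite big_ltn // subnn expr0 mulr1 mevalD raddf_sum /= big_nat big1 ?addr0 //.
move=> i /andP[mi _]; rewrite mevalM rmorphXn /= fZ // expr0n.
by rewrite subn_eq0 leqNgt mi mulr0.
Qed.

(* A function vanishing on Z_i but not on Z_{i+1}, for each i < 3: these three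
   functions are algebraically independent on Z_3. *)
Lemma chain3_independent (X : set 'rV[K]_n) : irreducible_chain X 3 ->
  exists f1 f2 f3 : {mpoly K[n]}, forall k (c : 'I_k -> 'I_k -> 'I_k -> K),
    vanishes (\sum_a (\sum_b (\sum_d (c a b d)%:MP * f1 ^+ d) * f2 ^+ b) * f3 ^+ a) X ->
    forall a b d, c a b d = 0.
Proof.
move=> [Z [irrZ ltZ]].
have primeZ i : (i <= 3)%N -> prime_set (Z i) by move=> /irrZ[/irreducible_prime].
have sep i : (i < 3)%N -> exists f, vanishes f (Z i) /\ ~ vanishes f (Z i.+1).
  move=> i3; have [_ /existsNP[x /not_implyP[Zx Zx']]] := ltZ i i3.
  have [[algZ _ _] _] := irrZ i (ltnW i3).
  have [f fZ fx] := algebraic_sep algZ Zx'.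
  by exists f; split=> // /(_ x Zx) /eqP; rewrite (negbTE fx).
have [[f1 [f1Z f1Z']] [f2 [f2Z f2Z']] [f3 [f3Z f3Z']]] := And3 (sep 0%N isT) (sep 1%N isT) (sep 2%N isT).
exists f1, f2, f3 => k c sum0 a0 b0 d0; apply: contrapT => c0.
case: k c sum0 a0 b0 d0 c0 => [c _ []//|k c sum0 a0 b0 d0 c0].
(* Passing from [Z 3] to [Z 2] isolates the coefficient of one power of [f3]; the next two descents
   do the same for [f2] and [f1], until a nonzero constant vanishes on the nonempty [Z 0]. [inord]
   extends the coefficients to all natural indices. *)
pose g3 a := \sum_b (\sum_d (c (inord a) b d)%:MP * f1 ^+ d) * f2 ^+ b.
have [|||||||a _ [za ga]] := @leading_term_vanishes (Z 2%N) (Z 3%N) f3 g3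
    (fun a => forall b d, c (inord a) b d = 0) k.+1 => //.
- exact: primeZ.
- by case: (ltZ 2%N isT).
- move=> i z0; rewrite /g3 big1 // => b _; rewrite big1 ?mul0r // => d _.
  by rewrite z0 mpolyC0 mul0r.
- have [_ ZX] := irrZ 3%N isT; apply: (vanishesS ZX); congr vanishes: sum0.
  by apply: eq_bigr => a _; rewrite /g3 inord_val.
- by exists a0 => // /(_ b0 d0); rewrite inord_val.
pose g2 b := \sum_d (c (inord a) (inord b) d)%:MP * f1 ^+ d.
have [|||||||b _ [zb gb]] := @leading_term_vanishes (Z 1%N) (Z 2%N) f2 g2
    (fun b => forall d, c (inord a) (inord b) d = 0) k.+1 => //.
- exact: primeZ.
- by case: (ltZ 1%N isT).
- move=> i z0; rewrite /g2 big1 // => d _.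
  by rewrite z0 mpolyC0 mul0r.
- by congr vanishes: ga; apply: eq_bigr => b _; rewrite /g2 inord_val.
- move/existsNP: za => [b zb]; exists b => // zb'; apply: zb => d.
  by rewrite -(zb' d) inord_val.
pose g1 d := (c (inord a) (inord b) (inord d))%:MP_[n].
have [|||||||d _ [zd gd]] := @leading_term_vanishes (Z 0%N) (Z 1%N) f1 g1
    (fun d => c (inord a) (inord b) (inord d) = 0) k.+1 => //.
- exact: primeZ.
- by case: (ltZ 0%N isT).
- by move=> i; rewrite /g1 => ->; rewrite mpolyC0.
- by congr vanishes: gb; apply: eq_bigr => d _; rewrite /g1 inord_val.
- by move/existsNP: zb => [d zd]; exists d => //; rewrite inord_val.
by have [[z0 Zz0] _] := primeZ 0%N isT; have := gd _ Zz0; rewrite mevalC.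
Qed.

End AlgebraicIndependence.

(** The rank is at most the number of columns, so the left kernel contains a nonzero row. *)
Lemma dependent_rows (K : fieldType) (I J : finType) (c : I -> J -> K) :
  (#|J| < #|I|)%N -> exists2 v : I -> K, (exists i, v i != 0) &
    forall j, \sum_i v i * c i j = 0.
Proof.
move=> JI; pose M := \matrix_(i < #|I|, j < #|J|) c (enum_val i) (enum_val j).
have : kermx M != 0.
  rewrite kermx_eq0 /row_free; apply: contraTneq JI => <-.
  by rewrite -leqNgt rank_leq_col.
move=> ker0; pose v := nz_row (kermx M).
have vM : v *m M = 0 by apply/sub_kermxP; exact: nz_row_sub.
have v0 : v != 0 by rewrite nz_row_eq0.
exists (fun i => v ord0 (enum_rank i)).
  apply: contrapT => /forallNP v0'; case/eqP: v0; apply/rowP => i.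
  by have := v0' (enum_val i); rewrite enum_valK mxE => /negP/negPn/eqP.
move=> j; have /rowP/(_ (enum_rank j)) := vM; rewrite !mxE => e; rewrite -[RHS]e.
rewrite [RHS](reindex_onto enum_rank enum_val) /= => [|i _]; last exact: enum_valK.
by apply: eq_big => i; rewrite ?enum_rankK ?eqxx // !mxE !enum_rankK.
Qed.

Lemma msizeM_leq (K : fieldType) n (p q : {mpoly K[n]}) :
  (msize (p * q) <= (msize p + msize q).-1)%N.
Proof.
have [->|p0] := eqVneq p 0; first by rewrite mul0r msize0.
have [->|q0] := eqVneq q 0; first by rewrite mulr0 msize0.
by rewrite msizeM.
Qed.

(** * Sets finite over a plane have no chain of length 3 *)

Section FiniteOverPlane.
Variables (K : fieldType) (n : nat) (X : set 'rV[K]_n) (r : nat).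
Variables (e : 'I_r -> {mpoly K[n]}) (s : 'I_2 -> {mpoly K[n]}).

(** Noether normalization with a degree bound: on [X] the functions form a module generated by the
    [e k] over the polynomials in the two functions [s], and [D] bounds the degree of the
    coefficients. *)
Definition spanned D (f : {mpoly K[n]}) : Prop :=
  exists2 P : 'I_r -> {mpoly K[2]}, (forall k, (msize (P k) <= D.+1)%N) &
    forall x : 'rV_n, X x -> f.@[x ord0] =
      \sum_k (e k).@[x ord0] * (P k).@[fun i => (s i).@[x ord0]].

Lemma spannedW D D' f : (D <= D')%N -> spanned D f -> spanned D' f.
Proof.
move=> DD' [P sP fP]; exists P => // k; exact: leq_trans (sP k) _.
Qed.

Lemma spannedD D f g : spanned D f -> spanned D g -> spanned D (f + g).
Proof.
move=> [P sP fP] [Q sQ gQ]; exists (fun k => P k + Q k) => [k|x Xx].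
  by apply: leq_trans (msizeD_le _ _) _; rewrite geq_max sP sQ.
rewrite mevalD fP // gQ // -big_split /=; apply: eq_bigr => k _.
by rewrite mevalD mulrDr.
Qed.

Lemma spannedZ D c f : spanned D f -> spanned D (c *: f).
Proof.
move=> [P sP fP]; exists (fun k => c *: P k) => [k|x Xx].
  exact: leq_trans (msizeZ_le _ _) (sP k).
rewrite mevalZ fP // mulr_sumr; apply: eq_bigr => k _.
by rewrite mevalZ mulrCA.
Qed.

Lemma spanned0 D : spanned D 0.
Proof.
exists (fun=> 0) => [k|x Xx]; first by rewrite msize0.
by rewrite meval0 big1 // => k _; rewrite meval0 mulr0.
Qed.

Hypothesis span1 : spanned 0 1.
Hypothesis spanX : forall j k, spanned 2 ('X_j * e k).

(** A variable acts on the generators by a matrix with entries of degree at most 2 in [s], as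
    expected for quadrics, where a square of a coordinate is rewritten. *)
Lemma spannedX D j f : spanned D f -> spanned D.+2 ('X_j * f).
Proof.
move=> [P sP fP].
pose Q k := projT1 (cid2 (spanX j k)).
have sQ k l : (msize (Q k l) <= 3)%N by rewrite /Q; case: cid2.
have eQ k (x : 'rV_n) : X x -> ('X_j * e k).@[x ord0] =
      \sum_l (e l).@[x ord0] * (Q k l).@[fun i => (s i).@[x ord0]].
  by rewrite /Q; case: cid2 => /= ? _; apply.
exists (fun l => \sum_k Q k l * P k) => [l|x Xx].
  apply: leq_trans (msize_sum _ _ _) _; apply/bigmax_leqP => k _.
  apply: leq_trans (msizeM_leq _ _) _.
  by have := sP k; have := sQ k l; lia.
rewrite mevalM fP // mulr_sumr.
transitivity (\sum_k \sum_l (e l).@[x ord0] * (Q k l * P k).@[fun i => (s i).@[x ord0]]).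
  apply: eq_bigr => k _; rewrite mulrA -mevalM eQ // mulr_suml.
  by apply: eq_bigr => l _; rewrite mevalM mulrA.
rewrite exchange_big /=; apply: eq_bigr => l _.
by rewrite raddf_sum /= mulr_sumr.
Qed.

Lemma spanned_mpoly d f : (msize f <= d.+1)%N -> spanned d.*2 f.
Proof.
have spanm : forall m : 'X_{1..n}, spanned (mdeg m).*2 'X_[m].
  move=> m; move: {2}(mdeg m) (erefl (mdeg m)) => k; elim: k m => [|k IHk] m mk.
    by move/eqP: mk; rewrite mdeg_eq0 => /eqP ->; rewrite mdeg0 mpolyX0.
  have [i mi] : exists i, m i != 0%N.
    apply: contrapT => /forallNP m0; have : m = 0%MM.
      by apply/mnmP => i; rewrite mnm0E; apply/eqP/negPn/negP; apply: m0.
    by move=> m00; rewrite m00 mdeg0 in mk.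
  have [m' mE] : exists m', m = (U_(i) + m')%MM.
    by exists (m - U_(i))%MM; rewrite addmC submK // lep1mP.
  have mk' : mdeg m' = k by move: mk; rewrite mE mdegD mdeg1 => -[].
  rewrite mE mdegD mdeg1 add1n doubleS mpolyXD; apply: spannedX; exact: IHk.
rewrite -ltnS => sf; rewrite [f]mpolyE; rewrite big_seq.
elim/big_ind: _ => [|p q|m mf]; [exact: spanned0|exact: spannedD|].
apply: spannedZ; apply: spannedW (spanm m).
by rewrite leq_double -ltnS; apply: leq_trans (msize_mdeg_lt mf) _.
Qed.

Lemma card_bmultinom2 D : (#|{: 'X_{1..2 < D}}| <= D ^ 2)%N.
Proof.
case: D => [|D].
  by rewrite leqn0; apply/eqP/eq_card0 => m; have := bmdeg m.
have mlt (m : 'X_{1..2 < D.+1}) i : (m i < D.+1)%N.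
  apply: leq_ltn_trans (bmdeg m); rewrite mdegE (bigD1 i) //=; exact: leq_addr.
have : injective (fun m : 'X_{1..2 < D.+1} =>
    (inord (m ord0) : 'I_D.+1, inord (m (lift ord0 ord0)) : 'I_D.+1)).
  move=> m m' [] /(congr1 val) /= e0 /(congr1 val) /= e1.
  apply/val_inj/mnmP; apply: ord2P.
    by move: e0; rewrite !inordK.
  by move: e1; rewrite !inordK.
by move=> /leq_card; rewrite card_prod card_ord mulnn.
Qed.

(* k^3 monomials in f1, f2, f3 live in a space of dimension O(k^2). *)
Lemma no_chain3 : ~ irreducible_chain X 3.
Proof.
move=> /chain3_independent[f1 [f2 [f3 indep]]].
pose d := maxn (msize f1) (maxn (msize f2) (msize f3)).
have [sf1 sf2 sf3] : [/\ (msize f1 <= d)%N, (msize f2 <= d)%N & (msize f3 <= d)%N].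
  by rewrite /d; split; lia.
have sexp (f : {mpoly K[n]}) a : (msize f <= d)%N -> (msize (f ^+ a) <= (a * d).+1)%N.
  move=> sf; elim: a => [|a IHa]; first by rewrite expr0 msize1.
  rewrite exprS; apply: leq_trans (msizeM_leq _ _) _; rewrite mulSn; lia.
(* Each [F t] has degree at most 3kd, hence coefficients of degree at most D = 6kd in [s]. There are
   at most r (D + 1)^2 <= k^2 r (6d + 1)^2 such coefficients, fewer than k^3 by the choice of
   [k]. *)
pose k := (r * (6 * d + 1) ^ 2).+1.
pose F (t : 'I_k * 'I_k * 'I_k) := f1 ^+ t.2 * f2 ^+ t.1.2 * f3 ^+ t.1.1.
pose D := (3 * k * d).*2.
have spanF t : spanned D (F t).
  apply: spanned_mpoly; rewrite /F.
  apply: leq_trans (msizeM_leq _ _) _.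
  have s12 := msizeM_leq (f1 ^+ t.2) (f2 ^+ t.1.2).
  have := sexp _ t.2 sf1; have := sexp _ t.1.2 sf2; have := sexp _ t.1.1 sf3.
  have lt1 : (t.2 * d <= k * d)%N by rewrite leq_mul2r (ltnW (ltn_ord _)) orbT.
  have lt2 : (t.1.2 * d <= k * d)%N by rewrite leq_mul2r (ltnW (ltn_ord _)) orbT.
  have lt3 : (t.1.1 * d <= k * d)%N by rewrite leq_mul2r (ltnW (ltn_ord _)) orbT.
  rewrite -mulnA; move: s12 lt1 lt2 lt3; lia.
pose P t := projT1 (cid2 (spanF t)).
have sP t l : (msize (P t l) <= D.+1)%N by rewrite /P; case: cid2.
have eP t (x : 'rV_n) : X x -> (F t).@[x ord0] =
      \sum_l (e l).@[x ord0] * (P t l).@[fun i => (s i).@[x ord0]].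
  by rewrite /P; case: cid2 => /= ? _; apply.
pose c t (j : 'I_r * 'X_{1..2 < D.+1}) := (P t j.1)@_j.2.
have [|v [t0 vt0] vc] := @dependent_rows K _ _ c.
  rewrite !card_prod !card_ord.
  apply: leq_ltn_trans (leq_mul (leqnn r) (card_bmultinom2 D.+1)) _.
  have : (D.+1 <= k * (6 * d + 1))%N.
    by rewrite /D -muln2 -[_.+1]addn1 mulnDr muln1 leq_add // [(3 * k)%N]mulnC; lia.
  rewrite -(leq_exp2r _ _ (isT : 0 < 2)%N) expnMn => leD.
  apply: leq_ltn_trans (leq_mul (leqnn r) leD) _.
  by rewrite mulnCA -mulnn ltn_pmul2l ?muln_gt0 // /k ltnSn.
case/eqP: vt0; have -> : t0 = (t0.1.1, t0.1.2, t0.2) by case: t0 => -[].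
apply: (indep k (fun a b d => v (a, b, d))) => x Xx.
transitivity (\sum_t v t * (F t).@[x ord0]).
  rewrite raddf_sum /=.
  transitivity (\sum_(a < k) \sum_(b < k) \sum_(d' < k) v (a, b, d') * (F (a, b, d')).@[x ord0]).
    apply: eq_bigr => a _; rewrite mevalM raddf_sum mulr_suml; apply: eq_bigr => b _ /=.
    rewrite mevalM raddf_sum !mulr_suml; apply: eq_bigr => d' _ /=.
    by rewrite !mevalM mevalC !mulrA.
  by rewrite pair_big pair_big; apply: eq_bigr => -[[a b] d'] _.
transitivity (\sum_t \sum_l \sum_(m : 'X_{1..2 < D.+1})
    (e l).@[x ord0] * 'X_[m].@[fun i => (s i).@[x ord0]] * (v t * c t (l, m))).
  apply: eq_bigr => t _; rewrite eP // mulr_sumr; apply: eq_bigr => l _.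
  rewrite [P t l](mpolywE (sP t l)) raddf_sum /= !mulr_sumr.
  apply: eq_bigr => m _; rewrite mevalZ /c /=.
  by ring.
rewrite exchange_big big1 //= => l _; rewrite exchange_big big1 //= => m _.
by rewrite -mulr_sumr vc mulr0.
Qed.

End FiniteOverPlane.

Section ModelDimensions.
Variable K : numFieldType.

Lemma spanned_monomial n (X : set 'rV[K]_n) r (e : 'I_r -> {mpoly K[n]}) s D f l q :
  (msize q <= D.+1)%N ->
  (forall x : 'rV_n, X x ->
     f.@[x ord0] = (e l).@[x ord0] * q.@[fun i => (s i).@[x ord0]]) ->
  spanned X e s D f.
Proof.
move=> sq fq; exists (fun k => if k == l then q else 0) => [k|x Xx].
  by case: ifP; rewrite ?msize0.
rewrite fq // (bigD1 l) //= eqxx big1 ?addr0 // => k /negbTE ->.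
by rewrite meval0 mulr0.
Qed.

Lemma msize_variable n (i : 'I_n) : (msize ('X_i : {mpoly K[n]}) <= 3)%N.
Proof. by rewrite msizeX mdeg1. Qed.

Lemma msize_square n (i : 'I_n) : (msize (- 'X_i ^+ 2 : {mpoly K[n]}) <= 3)%N.
Proof.
rewrite msizeN expr2; apply: leq_trans (msizeM_leq _ _) _.
by rewrite !msizeX !mdeg1.
Qed.

Lemma msizeD_leq n (p q : {mpoly K[n]}) d :
  (msize p <= d)%N -> (msize q <= d)%N -> (msize (p + q) <= d)%N.
Proof.
by move=> pd qd; apply: leq_trans (msizeD_le _ _) _; rewrite geq_max pd qd.
Qed.

Lemma msize_1 n d : (msize (1 : {mpoly K[n]}) <= d.+1)%N.
Proof. by rewrite msize1. Qed.

(** By z^2 = 1 - x^2 - y^2, the functions 1 and z span over the polynomials in x and y. *)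
Lemma sphere_no_chain3 : ~ irreducible_chain (unit_sphere K 2) 3.
Proof.
pose e : 'I_2 -> {mpoly K[3]} := nth 0 [:: 1; 'X_(lift ord0 (lift ord0 ord0))].
pose s : 'I_2 -> {mpoly K[3]} := nth 0 [:: 'X_ord0; 'X_(lift ord0 ord0)].
pose c : {mpoly K[2]} := 1 + - 'X_ord0 ^+ 2 + - 'X_(lift ord0 ord0) ^+ 2.
apply: (@no_chain3 K 3 _ 2 e s).
  apply: (spanned_monomial (l := ord0) (q := 1)) => [|x _]; first exact: msize_1.
  by rewrite !meval1 mulr1.
apply: ord3P; apply: ord2P; rewrite /e /=.
- apply: (spanned_monomial (l := ord0) (q := 'X_ord0)) => [|x _]; first exact: msize_variable.
  by rewrite /= !mevalM !mevalXU !meval1 /= ?mevalXU; ring.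
- apply: (spanned_monomial (l := lift ord0 ord0) (q := 'X_ord0)) => [|x _]; first exact: msize_variable.
  by rewrite /= !mevalM !mevalXU /= ?mevalXU; ring.
- apply: (spanned_monomial (l := ord0) (q := 'X_(lift ord0 ord0))) => [|x _]; first exact: msize_variable.
  by rewrite /= !mevalM !mevalXU !meval1 /= ?mevalXU; ring.
- apply: (spanned_monomial (l := lift ord0 ord0) (q := 'X_(lift ord0 ord0))) => [|x _]; first exact: msize_variable.
  by rewrite /= !mevalM !mevalXU /= ?mevalXU; ring.
- apply: (spanned_monomial (l := lift ord0 ord0) (q := 1)) => [|x _]; first exact: msize_1.
  by rewrite /= !mevalM !mevalXU !meval1.
- apply: (spanned_monomial (l := ord0) (q := c)) => [|x /unit_sphere2E xS].
    by rewrite /c; do 2?apply: msizeD_leq; rewrite ?msize_square ?msize_1.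
  rewrite /c !mevalD !mevalN !(rmorphXn, mevalM) /= !mevalXU !meval1 /= ?mevalXU.
  have zE : x ord0 (lift ord0 (lift ord0 ord0)) ^+ 2 =
            1 - x ord0 ord0 ^+ 2 - x ord0 (lift ord0 ord0) ^+ 2 by rewrite -xS; ring.
  by ring: zE.
Qed.

Lemma torus_no_chain3 : ~ irreducible_chain (torus K) 3.
Proof.
pose u0 : 'I_4 := ord0; pose u1 : 'I_4 := lift ord0 ord0.
pose v0 : 'I_4 := lift ord0 (lift ord0 ord0).
pose v1 : 'I_4 := lift ord0 (lift ord0 (lift ord0 ord0)).
pose e : 'I_4 -> {mpoly K[4]} := nth 0 [:: 1; 'X_u1; 'X_v1; 'X_u1 * 'X_v1].
pose s : 'I_2 -> {mpoly K[4]} := nth 0 [:: 'X_u0; 'X_v0].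
pose S : {mpoly K[2]} := 'X_ord0; pose T : {mpoly K[2]} := 'X_(lift ord0 ord0).
have S3 : (msize S <= 3)%N by exact: msize_variable.
have T3 : (msize T <= 3)%N by exact: msize_variable.
have S2 : (msize (1 + - S ^+ 2) <= 3)%N by apply: msizeD_leq; rewrite ?msize_square ?msize_1.
have T2 : (msize (1 + - T ^+ 2) <= 3)%N by apply: msizeD_leq; rewrite ?msize_square ?msize_1.
(* Row j and column k hold the pair (l, q) for which X_j e_k = q e_l on the torus, by u1^2 = 1 -
   u0^2 and v1^2 = 1 - v0^2. As values of l, the names [u0], [u1], [v0], [v1] stand for the numbers
   0 to 3. *)
pose table : seq (seq ('I_4 * {mpoly K[2]})) :=
  [:: [:: (u0, S); (u1, S); (v0, S); (v1, S)];
      [:: (u1, 1); (u0, 1 + - S ^+ 2); (v1, 1); (v0, 1 + - S ^+ 2)];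
      [:: (u0, T); (u1, T); (v0, T); (v1, T)];
      [:: (v0, 1); (v1, 1); (u0, 1 + - T ^+ 2); (u1, 1 + - T ^+ 2)]].
apply: (@no_chain3 K 4 _ 4 e s).
  apply: (spanned_monomial (l := u0) (q := 1)) => [|x _]; first exact: msize_1.
  by rewrite !meval1 mulr1.
move=> j k; pose lq := nth (u0, 1) (nth [::] table j) k.
apply: (spanned_monomial (l := lq.1) (q := lq.2)) => [|x /torusE].
  by rewrite /lq; elim/ord4P: j {lq}; elim/ord4P: k => /=; rewrite ?msize_1.
rewrite -/u0 -/u1 -/v0 -/v1 /lq => -[xu xv].
have xu' : x ord0 u1 ^+ 2 = 1 - x ord0 u0 ^+ 2 by rewrite -xu; ring.
have xv' : x ord0 v1 ^+ 2 = 1 - x ord0 v0 ^+ 2 by rewrite -xv; ring.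
elim/ord4P: j {lq}; elim/ord4P: k; rewrite /e /= -?/u0 -?/u1 -?/v0 -?/v1;
  rewrite /S /T ?mevalD ?mevalN ?rmorphXn ?mevalM /= ?mevalXU ?mevalM ?meval1 /= ?mevalXU
          -?/u0 -?/u1 -?/v0 -?/v1; ring: xu' xv'.
Qed.

(** The chain consists of a point, a plane circle and [Y]. The condition on [y] places it off the
    plane of the circle, which makes the last inclusion strict. *)
Lemma surface_dim2 n (Y : set 'rV[K]_n) (E : 'M[K]_(2, n)) E' y :
  irreducible Y -> ~ irreducible_chain Y 3 -> E *m E' = 1%:M ->
  mximage E (unit_sphere K 1) `<=` Y -> Y y -> y *m E' *m E != y -> has_dim Y 2.
Proof.
move=> irrY noY EK EY Yy yE; split=> //.
apply: (irreducible_chain_extend (X := mximage E (unit_sphere K 1))) => //.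
  split=> // le; have [z _ zE] := le y Yy; case/eqP: yE.
  by rewrite -zE -(mulmxA z) EK mulmx1.
pose a : 'rV[K]_2 := \row_i (i == ord0)%:R; pose b : 'rV[K]_2 := - a.
have aS : unit_sphere K 1 a by apply/unit_sphere1E; rewrite !mxE /= expr1n expr0n addr0.
have bS : unit_sphere K 1 b.
  by apply/unit_sphere1E; rewrite !mxE /= !sqrrN expr1n expr0n addr0.
have [irrC _] := circle_closure (idfun : {rmorphism K -> K}).
apply: (irreducible_chain_extend (X := [set a *m E])).
- exact: irreducible_mximage EK _ irrC.
- split=> [_ ->|le]; first by exists a.
  have /(congr1 (fun x => x *m E')) : b *m E = a *m E by apply: le; exists b.
  rewrite -!mulmxA EK !mulmx1 => /rowP/(_ ord0) /eqP; rewrite !mxE /=.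
  by rewrite eq_sym -subr_eq0 opprK -mulr2n mulr1n pnatr_eq0.
exists (fun=> [set a *m E]); split=> // i; rewrite leqn0 => _.
by split=> //; apply: irreducible_set1.
Qed.

Lemma sphere_dim : has_dim (unit_sphere K 2) 2.
Proof.
have [irrY _] := sphere_closure (idfun : {rmorphism K -> K}).
pose E : 'M[K]_(2, 3) := pid_mx 2; pose E' : 'M[K]_(3, 2) := pid_mx 2.
pose z : 'rV[K]_3 := \row_i (i == lift ord0 (lift ord0 ord0))%:R.
apply: (@surface_dim2 _ _ E E' z) => //.
- exact: sphere_no_chain3.
- by rewrite mul_pid_mx -pid_mx_1.
- move=> _ [x /unit_sphere1E xS <-]; apply/unit_sphere2E.
  by rewrite !mxE !big_ord_recl !big_ord0 !mxE /= !mulr1 !mulr0 !addr0 add0r expr0n addr0.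
- by apply/unit_sphere2E; rewrite !mxE /= expr1n expr0n !add0r.
- apply/eqP => /rowP/(_ (lift ord0 (lift ord0 ord0))) /eqP.
  rewrite !mxE !big_ord_recl big_ord0 !mxE /= !mulr0 !addr0 eq_sym.
  by rewrite oner_eq0.
Qed.

Lemma torus_dim : has_dim (torus K) 2.
Proof.
have [irrY _] := torus_closure (idfun : {rmorphism K -> K}).
pose E : 'M[K]_(2, 2 + 2) := row_mx 1%:M 1%:M.
pose E' : 'M[K]_(2 + 2, 2) := col_mx 1%:M 0.
pose a : 'rV[K]_2 := \row_i (i == ord0)%:R.
have aS : unit_sphere K 1 a by apply/unit_sphere1E; rewrite !mxE /= expr1n expr0n addr0.
have bS : unit_sphere K 1 (- a).
  by apply/unit_sphere1E; rewrite !mxE /= !sqrrN expr1n expr0n addr0.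
apply: (@surface_dim2 _ _ E E' (row_mx a (- a))) => //.
- exact: torus_no_chain3.
- by rewrite mul_row_col mulmx1 mulmx0 addr0.
- move=> _ [x xS <-].
  by rewrite /E mul_mx_row mulmx1 /torus /prod_set /= row_mxKl row_mxKr.
- by rewrite /torus /prod_set /= row_mxKl row_mxKr.
- rewrite mul_row_col mulmx1 mulmx0 addr0 mul_mx_row mulmx1; apply/eqP.
  move=> /eq_row_mx[_ /rowP/(_ ord0) /eqP]; rewrite !mxE /=.
  by rewrite -subr_eq0 opprK -mulr2n mulr1n pnatr_eq0.
Qed.

(** For the upper bound, a chain of length 2 on the circle, moved to the diagonal of the torus and
    completed by the whole torus, would be a chain of length 3 there. *)
Lemma circle_dim : has_dim (unit_sphere K 1) 1.
Proof.
have [irrC _] := circle_closure (idfun : {rmorphism K -> K}).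
have [irrY _] := torus_closure (idfun : {rmorphism K -> K}).
pose a : 'rV[K]_2 := \row_i (i == ord0)%:R.
have aS : unit_sphere K 1 a by apply/unit_sphere1E; rewrite !mxE /= expr1n expr0n addr0.
have bS : unit_sphere K 1 (- a).
  by apply/unit_sphere1E; rewrite !mxE /= !sqrrN expr1n expr0n addr0.
have ab : - a <> a.
  move=> /rowP/(_ ord0) /eqP; rewrite !mxE /=.
  by rewrite eq_sym -subr_eq0 opprK -mulr2n mulr1n pnatr_eq0.
pose E : 'M[K]_(2, 2 + 2) := row_mx 1%:M 1%:M.
pose E' : 'M[K]_(2 + 2, 2) := col_mx 1%:M 0.
have EK : E *m E' = 1%:M by rewrite mul_row_col mulmx1 mulmx0 addr0.
split.
  apply: (irreducible_chain_extend (X := [set a])) => //.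
    by split=> [_ ->//|/(_ (- a) bS)].
  exists (fun=> [set a]); split=> // i; rewrite leqn0 => _.
  by split=> //; apply: irreducible_set1.
move=> chainC; apply: torus_no_chain3.
apply: (irreducible_chain_extend (X := mximage E (unit_sphere K 1))) => //; last first.
  by apply/(irreducible_chain_mximage EK).
split=> [_ [x xS <-]|le].
  by rewrite /E mul_mx_row mulmx1 /torus /prod_set /= row_mxKl row_mxKr.
have [|x _] := le (row_mx a (- a)).
  by rewrite /torus /prod_set /= row_mxKl row_mxKr.
by rewrite /E mul_mx_row mulmx1 => /eq_row_mx[-> /esym /ab].
Qed.

End ModelDimensions.

(** * Degree *)

Section DegreeInvariance.
Variable K : numFieldType.

Lemma rV_mpoly_neq0 n (p : {mpoly K[n]}) :
  p != 0 -> exists w : 'rV[K]_n, p.@[w ord0] != 0.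
Proof.
move=> /mpoly_nat_neq0[v pv]; exists (\row_i (v i)%:R).
by rewrite (@meval_eq _ _ _ (fun i => (v i)%:R)) // => i; rewrite mxE.
Qed.

(** Slicing the image by (L, b) amounts to slicing [Y] by (E L, b). The map from L to E L is onto
    because of [E'], so the exceptional polynomial stays nonzero when pulled back. *)
Lemma has_degree_mximage m n (E : 'M[K]_(m, n)) E' (Y : set 'rV[K]_m) d :
  E *m E' = 1%:M -> has_degree Y d -> has_degree (mximage E Y) d.
Proof.
move=> EK [k dimY [F F0 FY]]; exists k; first exact/(has_dim_mximage EK).
pose A : 'M[K]_(n * k + k, m * k + k) := block_mx (lin_mulmx E) 0 0 1%:M.
have AE (L : 'M_(n, k)) (b : 'rV_k) :
    row_mx (mxvec L) b *m A = row_mx (mxvec (E *m L)) b.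
  by rewrite mul_row_block !mulmx0 mulmx1 addr0 add0r mul_vec_lin.
exists (pullback A F).
  have [w Fw] := rV_mpoly_neq0 F0.
  apply: contraNneq Fw => A0.
  pose w' := row_mx (mxvec (E' *m vec_mx (lsubmx w))) (rsubmx w).
  have <- : w' *m A = w by rewrite AE mulmxA EK mul1mx vec_mxK hsubmxK.
  by rewrite -meval_pullback A0 meval0.
move=> L b; rewrite meval_pullback AE => /FY; apply: card_eq_trans.
have -> : mximage E Y `&` [set x | x *m L = b] =
          mximage E (Y `&` [set y | y *m (E *m L) = b]).
  apply/seteqP; split=> [_ [[y Yy <-] /= yL]|_ [y [Yy /= yL] <-]].
    by exists y => //; split=> //=; rewrite mulmxA.
  by split; [exists y|rewrite /= -mulmxA].
apply: inj_card_eq => x y _ _ /(congr1 (fun z => z *m E')).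
by rewrite -!mulmxA EK !mulmx1.
Qed.

(** Since [F * F'] is nonzero, some affine subspace is general for both conditions, and its section
    has both cardinalities. *)
Lemma has_degree_inj n (X : set 'rV[K]_n) d d' :
  has_degree X d -> has_degree X d' -> d = d'.
Proof.
move=> [k dimX [F F0 FX]] [k' dimX'].
rewrite -(has_dim_inj dimX dimX') => -[F' F'0 F'X].
have [w] := rV_mpoly_neq0 (mulf_neq0 F0 F'0).
rewrite mevalM mulf_eq0 negb_or -[w]hsubmxK -[lsubmx w]vec_mxK.
move=> /andP[/FX Xd /F'X Xd']; apply/card_eq_II.
by apply: card_eq_trans Xd'; rewrite card_eq_sym.
Qed.

(** Coordinate functions of the parameter space. The elimination formulas below are written over an
    arbitrary ring, so that they can be read at these polynomials to define [F] and at numbers to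
    use it. *)
Definition coef_var n k (i : 'I_n) (j : 'I_k) : {mpoly K[n * k + k]} :=
  'X_(lshift k (mxvec_index i j)).

Definition rhs_var n k (j : 'I_k) : {mpoly K[n * k + k]} := 'X_(rshift (n * k) j).

Lemma meval_coef_var n k (L : 'M[K]_(n, k)) b i j :
  (coef_var i j).@[(row_mx (mxvec L) b) ord0] = L i j.
Proof. by rewrite mevalXU row_mxEl mxvecE. Qed.

Lemma meval_rhs_var n k (L : 'M[K]_(n, k)) (b : 'rV_k) j :
  (rhs_var n j).@[(row_mx (mxvec L) b) ord0] = b ord0 j.
Proof. by rewrite mevalXU row_mxEr. Qed.

End DegreeInvariance.

Section SimpleRoots.
Variable K : closedFieldType.

(** Such a [p] is coprime to its derivative, hence separable, so the full list of its roots has no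
    repetition. *)
Lemma card_simple_roots (p : {poly K}) n : size p = n.+1 ->
  (forall x, p.[x] = 0 -> p^`().[x] != 0) -> [set x | p.[x] = 0] #= `I_n.
Proof.
move=> sp simple; have [r pE] := closed_field_poly_normal p.
have lc0 : lead_coef p != 0 by rewrite lead_coef_eq0 -size_poly_gt0 sp.
have sr : size r = n.
  by have := sp; rewrite {1}pE size_scale // size_prod_XsubC => -[].
have ur : uniq r.
  rewrite -separable_prod_XsubC -(@eqp_separable _ p).
    by rewrite unlock; apply/Pdiv.ClosedField.coprimepP => x /rootP /simple; rewrite /root.
  by rewrite {1}pE; apply: eqp_scale.
have -> : [set x | p.[x] = 0] = (fun i : 'I_(size r) => r`_i) @` [set` [set: 'I_(size r)]%SET].
  apply/seteqP; split=> [x /= px|_ [i _ <-] /=].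
    have : x \in r by rewrite -root_prod_XsubC -(rootZ _ _ lc0) -pE; apply/rootP.
    by move=> /(nthP 0)[i ir <-]; exists (Ordinal ir) => //=; rewrite inE.
  by apply/rootP; rewrite pE rootZ // root_prod_XsubC mem_nth.
rewrite -sr; have := @card_image_finset _ _ [set: 'I_(size r)]%SET (fun i => r`_i).
rewrite cardsT card_ord; apply => i j _ _ /eqP.
by rewrite nth_uniq // => /eqP/val_inj.
Qed.

Lemma card_quadratic_roots (a b c : K) : a != 0 -> b ^+ 2 - 4 * a * c != 0 ->
  [set x | a * x ^+ 2 + b * x + c = 0] #= `I_2.
Proof.
move=> a0 disc0; pose p := Poly [:: c; b; a].
have pE x : p.[x] = a * x ^+ 2 + b * x + c by rewrite horner_Poly /=; ring.
have -> : [set x | a * x ^+ 2 + b * x + c = 0] = [set x | p.[x] = 0].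
  by apply/seteqP; split=> x /=; rewrite pE.
apply: card_simple_roots; first by rewrite (PolyK (c := 0)).
have -> : p^`() = Poly [:: b; 2 * a].
  apply/polyP => -[|[|[|i]]]; rewrite coef_deriv !coef_Poly /= ?nth_nil ?mul0rn //; ring.
move=> x; rewrite pE => px; apply: contraNneq disc0.
rewrite horner_Poly /= => dpx; apply/eqP.
(* The discriminant equals p'(x)^2 - 4 a p(x) for every x. *)
transitivity ((((0 * x + 2 * a) * x + b)) ^+ 2 - 4 * a * (a * x ^+ 2 + b * x + c)).
  by ring.
by rewrite px dpx; ring.
Qed.

End SimpleRoots.

(** The classical discriminant of a x^4 + b x^3 + c x^2 + d x + e. *)
Definition quartic_disc (R : pzRingType) (a b c d e : R) : R :=
  256 * a ^+ 3 * e ^+ 3 - 192 * a ^+ 2 * b * d * e ^+ 2 - 128 * a ^+ 2 * c ^+ 2 * e ^+ 2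
  + 144 * a ^+ 2 * c * d ^+ 2 * e - 27 * a ^+ 2 * d ^+ 4 + 144 * a * b ^+ 2 * c * e ^+ 2
  - 6 * a * b ^+ 2 * d ^+ 2 * e - 80 * a * b * c ^+ 2 * d * e + 18 * a * b * c * d ^+ 3
  + 16 * a * c ^+ 4 * e - 4 * a * c ^+ 3 * d ^+ 2 - 27 * b ^+ 4 * e ^+ 2
  + 18 * b ^+ 3 * c * d * e - 4 * b ^+ 3 * d ^+ 3 - 4 * b ^+ 2 * c ^+ 3 * e
  + b ^+ 2 * c ^+ 2 * d ^+ 2.

Lemma rmorph_quartic_disc (R S : pzRingType) (f : {rmorphism R -> S}) a b c d e :
  f (quartic_disc a b c d e) = quartic_disc (f a) (f b) (f c) (f d) (f e).
Proof.
by rewrite /quartic_disc !(rmorph_nat, rmorphXn, rmorphB, rmorphD, rmorphM).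
Qed.

Lemma card_quartic_roots (K : closedFieldType) (a b c d e : K) :
  a != 0 -> quartic_disc a b c d e != 0 ->
  [set x | a * x ^+ 4 + b * x ^+ 3 + c * x ^+ 2 + d * x + e = 0] #= `I_4.
Proof.
move=> a0 disc0; pose p := Poly [:: e; d; c; b; a].
have pE x : p.[x] = a * x ^+ 4 + b * x ^+ 3 + c * x ^+ 2 + d * x + e.
  by rewrite horner_Poly /=; ring.
have -> : [set x | a * x ^+ 4 + b * x ^+ 3 + c * x ^+ 2 + d * x + e = 0] =
          [set x | p.[x] = 0].
  by apply/seteqP; split=> x /=; rewrite pE.
apply: card_simple_roots; first by rewrite (PolyK (c := 0)).
have -> : p^`() = Poly [:: d; 2 * c; 3 * b; 4 * a].
  by apply/polyP => -[|[|[|[|[|i]]]]]; rewrite coef_deriv !coef_Poly /= ?nth_nil ?mul0rn //; ring.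
move=> x; rewrite pE horner_Poly /= => px; apply: contraNneq disc0 => dpx.
(* Solving p'(x) = 0 for d and p(x) = 0 for e turns the discriminant into the zero polynomial in a,
   b, c, x. *)
have dE : d = - (4 * a * x ^+ 3 + 3 * b * x ^+ 2 + 2 * c * x).
  by apply/eqP; rewrite -addr_eq0 -dpx; apply/eqP; ring.
have eE : e = - (a * x ^+ 4 + b * x ^+ 3 + c * x ^+ 2 + d * x).
  by apply/eqP; rewrite -addr_eq0 -px; apply/eqP; ring.
by rewrite eE dE /quartic_disc; apply/eqP; ring.
Qed.

Section ModelDegrees.
Variable K : numClosedFieldType.

Lemma sphere_degree : has_degree (unit_sphere K 2) 2.
Proof.
exists 2%N; first exact: sphere_dim.
pose i0 : 'I_3 := ord0; pose i1 : 'I_3 := lift ord0 ord0.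
pose i2 : 'I_3 := lift ord0 (lift ord0 ord0).
pose j0 : 'I_2 := ord0; pose j1 : 'I_2 := lift ord0 ord0.
(* By Cramer's rule the first two coordinates on the line are (p0 + p1 z) / m and (q0 + q1 z) / m,
   and the sphere equation becomes a z^2 + h z + c = 0. [F] asks that m, a and the discriminant be
   nonzero. *)
pose m (R : pzRingType) (l : 'I_3 -> 'I_2 -> R) := l i0 j0 * l i1 j1 - l i0 j1 * l i1 j0.
pose p0 (R : pzRingType) (l : 'I_3 -> 'I_2 -> R) (b : 'I_2 -> R) := b j0 * l i1 j1 - b j1 * l i1 j0.
pose p1 (R : pzRingType) (l : 'I_3 -> 'I_2 -> R) := l i2 j1 * l i1 j0 - l i2 j0 * l i1 j1.
pose q0 (R : pzRingType) (l : 'I_3 -> 'I_2 -> R) (b : 'I_2 -> R) := l i0 j0 * b j1 - l i0 j1 * b j0.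
pose q1 (R : pzRingType) (l : 'I_3 -> 'I_2 -> R) := l i0 j1 * l i2 j0 - l i0 j0 * l i2 j1.
pose a R l := p1 R l ^+ 2 + q1 R l ^+ 2 + m R l ^+ 2.
pose h R l b := 2 * (p0 R l b * p1 R l + q0 R l b * q1 R l).
pose c R l b := p0 R l b ^+ 2 + q0 R l b ^+ 2 - m R l ^+ 2.
pose F R l b := m R l * a R l * (h R l b ^+ 2 - 4 * a R l * c R l b).
pose Fpoly := F _ (@coef_var K 3 2) (@rhs_var K 3 2).
have FE (L : 'M[K]_(3, 2)) (b : 'rV_2) : Fpoly.@[(row_mx (mxvec L) b) ord0] = F K L (b ord0).
  rewrite /Fpoly /F /a /h /c /m /p0 /p1 /q0 /q1.
  by rewrite !(rmorph_nat, rmorphXn, rmorphB, rmorphD, rmorphM) /= !meval_coef_var !meval_rhs_var.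
exists Fpoly.
  apply/eqP => F0.
  (* With b = 0 this is the line x0 = x1 = 0, where m = a = 1 and the equation is z^2 - 1 = 0, of
     discriminant 4. *)
  pose L : 'M[K]_(3, 2) := \matrix_(i, j) (i == j :> nat)%:R.
  have /eqP := FE L 0; rewrite F0 meval0 /F /a /h /c /m /p0 /p1 /q0 /q1 !mxE /=.
  rewrite (_ : _ * _ = 4%:R); last by ring.
  by rewrite eq_sym pnatr_eq0.
move=> L b; rewrite FE /F !mulf_eq0 !negb_or.
set l : 'I_3 -> 'I_2 -> K := fun_of_matrix L; set bb : 'I_2 -> K := b ord0.
rewrite -/l -/bb.
move=> /andP[/andP[m0 a0] disc0].
pose f z : 'rV[K]_3 := \row_i nth 0 [:: (p0 K l bb + p1 K l * z) / m K l;
                                (q0 K l bb + q1 K l * z) / m K l; z] i.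
apply: card_eq_trans (card_quadratic_roots a0 disc0).
have -> : unit_sphere K 2 `&` [set x | x *m L = b] =
          f @` [set z | a K l * z ^+ 2 + h K l bb * z + c K l bb = 0].
  apply/seteqP; split=> [x [/unit_sphere2E xS /= xL]|_ [z /= zr <-]].
    set x0 := x ord0 i0; set x1 := x ord0 i1; set z := x ord0 i2.
    have bE j : bb j = x0 * l i0 j + (x1 * l i1 j + z * l i2 j).
      by rewrite /bb -xL mxE !big_ord_recl big_ord0 addr0.
    have x0E : x0 = (p0 K l bb + p1 K l * z) / m K l.
      by apply: (mulIf m0); rewrite divfK // /p0 /p1 /m !bE; ring.
    have x1E : x1 = (q0 K l bb + q1 K l * z) / m K l.
      by apply: (mulIf m0); rewrite divfK // /q0 /q1 /m !bE; ring.
    exists z => /=; last by apply/rowP; apply: ord3P; rewrite !mxE /= -/x0 -/x1.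
    have e0 : x0 * m K l = p0 K l bb + p1 K l * z by rewrite x0E divfK.
    have e1 : x1 * m K l = q0 K l bb + q1 K l * z by rewrite x1E divfK.
    transitivity ((p0 K l bb + p1 K l * z) ^+ 2 + (q0 K l bb + q1 K l * z) ^+ 2
                  + m K l ^+ 2 * z ^+ 2 - m K l ^+ 2).
      by rewrite /a /h /c; ring.
    by rewrite -e0 -e1 -{2}[m K l ^+ 2]mulr1 -xS -/x0 -/x1 -/z; ring.
  split.
    apply/unit_sphere2E; rewrite !mxE /=; apply: (mulIf (expf_neq0 2 m0)).
    rewrite mul1r; apply/eqP; rewrite -subr_eq0 -[X in _ == X]zr; apply/eqP.
    by rewrite /a /h /c; field.
  apply/rowP; apply: ord2P; rewrite !mxE !big_ord_recl big_ord0 !mxE /= -?/l -?/bb addr0;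
    by rewrite /p0 /p1 /q0 /q1 /m in m0 *; rewrite -/(l _ _); field.
by apply: inj_card_eq => z z' _ _ /rowP/(_ i2); rewrite !mxE.
Qed.

(** The torus in null coordinates (s, s', t, t'). As s' = 1/s, two linear equations express t and t'
    as Laurent polynomials in s, so a single unknown remains. *)
Definition hyperbolas : set 'rV[K]_(2 + 2) :=
  [set x | x ord0 ord0 * x ord0 (lift ord0 ord0) = 1 /\
           x ord0 (lift ord0 (lift ord0 ord0)) *
           x ord0 (lift ord0 (lift ord0 (lift ord0 ord0))) = 1].

(* The null coordinates u1 +- i u2 of each factor. *)
Definition null_coords : 'M[K]_(2 + 2) := \matrix_(i, j)
  nth 0 (nth [::] [:: [:: 1; 1; 0; 0]; [:: 'i; - 'i; 0; 0];
                      [:: 0; 0; 1; 1]; [:: 0; 0; 'i; - 'i]] i) j.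

Definition null_coords_inv : 'M[K]_(2 + 2) := \matrix_(i, j)
  nth 0 (nth [::] [:: [:: 1 / 2; - 'i / 2; 0; 0]; [:: 1 / 2; 'i / 2; 0; 0];
                      [:: 0; 0; 1 / 2; - 'i / 2]; [:: 0; 0; 1 / 2; 'i / 2]] i) j.

Lemma null_coordsK : null_coords_inv *m null_coords = 1%:M.
Proof.
have ii := sqrCi K.
apply/matrixP; elim/ord4P; elim/ord4P;
  rewrite !mxE !big_ord_recl big_ord0 !mxE /=; by field: ii.
Qed.

Lemma null_coordsVK : null_coords *m null_coords_inv = 1%:M.
Proof. exact: mulmx1C null_coordsK. Qed.

Lemma torus_hyperbolas : torus K = mximage null_coords_inv hyperbolas.
Proof.
have ii := sqrCi K.
rewrite (mximage_preim null_coordsK) null_coordsVK.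
apply/seteqP; split=> x.
  move=> /torusE[xu xv]; split=> //=; split; rewrite !mxE !big_ord_recl !big_ord0 !mxE /=.
    by rewrite -[RHS]xu; ring: ii.
  by rewrite -[RHS]xv; ring: ii.
move=> [[]]; rewrite !mxE !big_ord_recl !big_ord0 !mxE /= => xu xv _.
by apply/torusE; split; [rewrite -[RHS]xu|rewrite -[RHS]xv]; ring: ii.
Qed.

Lemma hyperbolas_degree : has_degree hyperbolas 4.
Proof.
exists 2%N.
  by apply/(has_dim_mximage null_coordsK); rewrite -torus_hyperbolas; apply: torus_dim.
pose i0 : 'I_4 := ord0; pose i1 : 'I_4 := lift ord0 ord0.
pose i2 : 'I_4 := lift ord0 (lift ord0 ord0).
pose i3 : 'I_4 := lift ord0 (lift ord0 (lift ord0 ord0)).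
pose j0 : 'I_2 := ord0; pose j1 : 'I_2 := lift ord0 ord0.
(* Cramer's rule gives m t = p0 s + p1 + p2 / s and m t' = q0 s + q1 + q2 / s; the equation t t' =
   1, multiplied by m^2 s^2, is the quartic with coefficients [a], [b1], [c], [d], [e]. A nonzero
   [e] keeps s = 0 from being a root. *)
pose m (R : pzRingType) (l : 'I_4 -> 'I_2 -> R) := l i2 j0 * l i3 j1 - l i2 j1 * l i3 j0.
pose p0 (R : pzRingType) (l : 'I_4 -> 'I_2 -> R) := l i3 j0 * l i0 j1 - l i3 j1 * l i0 j0.
pose p1 (R : pzRingType) (l : 'I_4 -> 'I_2 -> R) (b : 'I_2 -> R) := l i3 j1 * b j0 - l i3 j0 * b j1.
pose p2 (R : pzRingType) (l : 'I_4 -> 'I_2 -> R) := l i3 j0 * l i1 j1 - l i3 j1 * l i1 j0.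
pose q0 (R : pzRingType) (l : 'I_4 -> 'I_2 -> R) := l i2 j1 * l i0 j0 - l i2 j0 * l i0 j1.
pose q1 (R : pzRingType) (l : 'I_4 -> 'I_2 -> R) (b : 'I_2 -> R) := l i2 j0 * b j1 - l i2 j1 * b j0.
pose q2 (R : pzRingType) (l : 'I_4 -> 'I_2 -> R) := l i2 j1 * l i1 j0 - l i2 j0 * l i1 j1.
pose a R l := p0 R l * q0 R l.
pose b1 R l b := p0 R l * q1 R l b + p1 R l b * q0 R l.
pose c R l b := p0 R l * q2 R l + p1 R l b * q1 R l b + p2 R l * q0 R l - m R l ^+ 2.
pose d R l b := p1 R l b * q2 R l + p2 R l * q1 R l b.
pose e R l := p2 R l * q2 R l.
pose F R l b := m R l * a R l * e R l * quartic_disc (a R l) (b1 R l b) (c R l b) (d R l b) (e R l).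
pose Fpoly := F _ (@coef_var K 4 2) (@rhs_var K 4 2).
have FE (L : 'M[K]_(4, 2)) (b : 'rV_2) : Fpoly.@[(row_mx (mxvec L) b) ord0] = F K L (b ord0).
  rewrite /Fpoly /F rmorphM rmorph_quartic_disc /a /b1 /c /d /e /m /p0 /p1 /p2 /q0 /q1 /q2.
  by rewrite !(rmorph_nat, rmorphXn, rmorphB, rmorphD, rmorphM) /= !meval_coef_var !meval_rhs_var.
exists Fpoly.
  apply/eqP => F0.
  (* For this [L] and b = 0 the quartic is s^4 - 2, of discriminant -2048, and m a e = -2; hence the
     value 4096. *)
  pose L : 'M[K]_(4, 2) := \matrix_(i, j)
    nth 0 (nth [::] [:: [:: 1; 1]; [:: 2; - 1]; [:: 1; 0]; [:: 0; 1]] i) j.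
  have /eqP := FE L 0; rewrite F0 meval0 /F /a /b1 /c /d /e /m /p0 /p1 /p2 /q0 /q1 /q2 !mxE /=.
  rewrite (_ : _ * _ = 4096%:R); last by rewrite /quartic_disc; ring.
  by rewrite eq_sym pnatr_eq0.
move=> L b; rewrite FE /F !mulf_eq0 !negb_or.
set l : 'I_4 -> 'I_2 -> K := fun_of_matrix L; set bb : 'I_2 -> K := b ord0.
rewrite -/l -/bb => /andP[/andP[/andP[m0 /andP[p00 q00]] /andP[p20 q20]] disc0].
have a0 : a K l != 0 by rewrite mulf_neq0.
have e0 : e K l != 0 by rewrite mulf_neq0.
pose f s : 'rV[K]_(2 + 2) := \row_i nth 0 [:: s; s^-1;
   (p0 K l * s + p1 K l bb + p2 K l / s) / m K l;
   (q0 K l * s + q1 K l bb + q2 K l / s) / m K l] i.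
apply: card_eq_trans (card_quartic_roots a0 disc0).
set quartic := fun s => a K l * s ^+ 4 + b1 K l bb * s ^+ 3 + c K l bb * s ^+ 2 + d K l bb * s + e K l.
have quarticE s : quartic s = (p0 K l * s ^+ 2 + p1 K l bb * s + p2 K l) *
    (q0 K l * s ^+ 2 + q1 K l bb * s + q2 K l) - m K l ^+ 2 * s ^+ 2.
  by rewrite /quartic /a /b1 /c /d /e; ring.
have -> : hyperbolas `&` [set x | x *m L = b] = f @` [set s | quartic s = 0].
  apply/seteqP; split=> [x [[/= xs xt] /= xL]|_ [s /= sr <-]].
    move: xs xt.
    set s := x ord0 i0; set s' := x ord0 i1; set t := x ord0 i2; set t' := x ord0 i3.
    move=> xs xt.
    have s0 : s != 0 by apply: contra_eq_neq xs => ->; rewrite mul0r eq_sym oner_eq0.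
    have s'E : s' = s^-1 by apply: (mulfI s0); rewrite xs divff.
    have bE j : bb j = s * l i0 j + (s' * l i1 j + (t * l i2 j + t' * l i3 j)).
      by rewrite /bb -xL mxE !big_ord_recl big_ord0 addr0.
    have et : t * m K l = p0 K l * s + p1 K l bb + p2 K l * s'.
      by rewrite /m /p0 /p1 /p2 !bE; ring.
    have et' : t' * m K l = q0 K l * s + q1 K l bb + q2 K l * s'.
      by rewrite /m /q0 /q1 /q2 !bE; ring.
    exists s => /=; last first.
      apply/rowP; apply: ord4P; rewrite !mxE /= -/s -/s' -/t -/t' -?s'E -?et -?et' ?mulfK //.
    rewrite quarticE.
    transitivity (s ^+ 2 * (t * m K l) * (t' * m K l) - m K l ^+ 2 * s ^+ 2).
      by rewrite et et' s'E; field.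
    by ring: xt.
  have s0 : s != 0.
    apply: contra_eq_neq sr => ->; rewrite quarticE (_ : _ - _ = e K l) // /e; ring.
  split.
    split; rewrite !mxE /=; first exact: divff.
    have m20 : m K l ^+ 2 * s ^+ 2 != 0 by rewrite mulf_neq0 ?expf_neq0.
    apply: (mulIf m20); apply/eqP; rewrite -subr_eq0 mul1r -sr quarticE; apply/eqP.
    by field; rewrite m0.
  apply/rowP; apply: ord2P; rewrite !mxE !big_ord_recl big_ord0 !mxE /= -?/l -?/bb addr0;
    by rewrite /p0 /p1 /p2 /q0 /q1 /q2 /m in m0 *; rewrite -/(l _ _); field; rewrite m0.
by apply: inj_card_eq => z z' _ _ /rowP/(_ i0); rewrite !mxE.
Qed.

Lemma torus_degree : has_degree (torus K) 4.
Proof.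
rewrite torus_hyperbolas; exact: has_degree_mximage null_coordsK hyperbolas_degree.
Qed.

End ModelDegrees.

(** * Linear copies of the model varieties *)

Lemma lift_lift0 n (i : 'I_n.+1) : lift (lift ord0 i) ord0 = ord0 :> 'I_n.+2.
Proof. exact/val_inj. Qed.

Lemma lift_liftS n (i : 'I_n.+1) (j : 'I_n) :
  lift (lift ord0 i) (lift ord0 j) = lift ord0 (lift i j).
Proof. by apply/val_inj; rewrite /= /bump !add1n ltnS addnS. Qed.

Lemma det_mx2 (R : comPzRingType) (M : 'M[R]_2) : \det M =
  M ord0 ord0 * M (lift ord0 ord0) (lift ord0 ord0)
  - M ord0 (lift ord0 ord0) * M (lift ord0 ord0) ord0.
Proof.
rewrite (expand_det_row _ ord0) !big_ord_recl big_ord0 /cofactor !det_mx11 !mxE /=.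
by rewrite lift_lift0; ring.
Qed.

Lemma det_mx3 (R : comPzRingType) (M : 'M[R]_3)
    (i0 := ord0) (i1 := lift ord0 ord0) (i2 := lift ord0 (lift ord0 ord0)) :
  \det M = M i0 i0 * (M i1 i1 * M i2 i2 - M i1 i2 * M i2 i1)
         - M i0 i1 * (M i1 i0 * M i2 i2 - M i1 i2 * M i2 i0)
         + M i0 i2 * (M i1 i0 * M i2 i1 - M i1 i1 * M i2 i0).
Proof.
rewrite (expand_det_row _ ord0) !big_ord_recl big_ord0 /cofactor !det_mx2 !mxE /=.
by rewrite !(lift_liftS, lift_lift0) -/i0 -/i1 -/i2; ring.
Qed.

(** Laplace expansion along the first two rows, that is, the pairing of two bivectors in the form
    used by [bivector_duality]. *)
Lemma det_mx4 (R : comPzRingType) (M : 'M[R]_4)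
    (i0 := ord0) (i1 := lift ord0 ord0) (i2 := lift ord0 (lift ord0 ord0))
    (i3 := lift ord0 (lift ord0 (lift ord0 ord0)))
    (minor := fun i j k l : 'I_4 => M i k * M j l - M i l * M j k) :
  \det M = minor i0 i1 i0 i1 * minor i2 i3 i2 i3 - minor i0 i1 i0 i2 * minor i2 i3 i1 i3
         + minor i0 i1 i0 i3 * minor i2 i3 i1 i2 + minor i0 i1 i1 i2 * minor i2 i3 i0 i3
         - minor i0 i1 i1 i3 * minor i2 i3 i0 i2 + minor i0 i1 i2 i3 * minor i2 i3 i0 i1.
Proof.
rewrite (expand_det_row _ ord0) !big_ord_recl big_ord0 /cofactor !det_mx3 !mxE /=.
by rewrite !(lift_liftS, lift_lift0) -/i0 -/i1 -/i2 -/i3 /minor; ring.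
Qed.

Section LinearIsomorphism.
Variable K : fieldType.

(** The matrices are mutually inverse only on the two sets, which may sit in spaces of different
    dimensions, as the circle in the plane and SO(2) among 2 x 2 matrices. *)
Definition linear_iso m n (X : set 'rV[K]_m) (Y : set 'rV[K]_n) : Prop :=
  exists (A : 'M[K]_(m, n)) (B : 'M[K]_(n, m)),
    (forall x, X x -> Y (x *m A) /\ x *m A *m B = x) /\
    (forall y, Y y -> X (y *m B) /\ y *m B *m A = y).

Lemma linear_iso_isomorphic m n (X : set 'rV[K]_m) (Y : set 'rV[K]_n) :
  linear_iso X Y -> isomorphic X Y.
Proof.
move=> [A [B [XY YX]]]; exists (fun x => x *m A), (fun y => y *m B).
by split=> //; apply: polynomial_map_linear.
Qed.

Lemma linear_iso_trans m n p (X : set 'rV[K]_m) (Y : set 'rV[K]_n) (Z : set 'rV[K]_p) :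
  linear_iso X Y -> linear_iso Y Z -> linear_iso X Z.
Proof.
move=> [A [B [XY YX]]] [A' [B' [YZ ZY]]]; exists (A *m A'), (B' *m B).
split=> [x /XY[Yx xAB]|z /ZY[Yz zBA]]; rewrite !mulmxA.
  by have [Zx xE] := YZ _ Yx; rewrite xE xAB.
by have [Xz zE] := YX _ Yz; rewrite zE zBA.
Qed.

Lemma linear_iso_mximage m n (E : 'M[K]_(m, n)) E' Y :
  E *m E' = 1%:M -> linear_iso (mximage E Y) Y.
Proof.
move=> EK; exists E', E; split=> [_ [y Yy <-]|y Yy]; last first.
  by rewrite -mulmxA EK mulmx1; split=> //; exists y.
by rewrite -(mulmxA y) EK mulmx1.
Qed.

Lemma linear_iso_prod m n (X : set 'rV[K]_m) (Y : set 'rV[K]_n) :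
  linear_iso X Y -> linear_iso (prod_set X X) (prod_set Y Y).
Proof.
move=> [A [B [XY YX]]]; exists (block_mx A 0 0 A), (block_mx B 0 0 B).
split=> x [/= x1 x2]; rewrite /prod_set /= -{1 2 3}[x]hsubmxK !mul_row_block !mulmx0 !addr0 !add0r.
  have [Y1 e1] := XY _ x1; have [Y2 e2] := XY _ x2.
  by rewrite row_mxKl row_mxKr e1 e2 hsubmxK.
have [X1 e1] := YX _ x1; have [X2 e2] := YX _ x2.
by rewrite row_mxKl row_mxKr e1 e2 hsubmxK.
Qed.

Lemma linear_matrix m n (f : 'rV[K]_m -> 'rV[K]_n) :
  linear f -> exists A : 'M[K]_(m, n), forall x, x *m A = f x.
Proof.
move=> lf; pose F := GRing.isLinear.Build _ _ _ _ f lf.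
pose g : {linear 'rV[K]_m -> 'rV[K]_n} := HB.pack f F.
by exists (lin1_mx g) => x; rewrite mul_rV_lin1.
Qed.

End LinearIsomorphism.

Section LinearCopies.
Variable R : realType.
Local Notation toC := (real_complex R).

Lemma linear_iso_SO2 : linear_iso (unit_sphere R 1) (flat (SO R 2)).
Proof.
pose f (x : 'rV[R]_2) : 'rV[R]_(2 * 2) := mxvec (\matrix_(i, j)
  nth 0 (nth [::] [:: [:: x ord0 ord0; - x ord0 (lift ord0 ord0)];
                      [:: x ord0 (lift ord0 ord0); x ord0 ord0]] i) j).
pose g (y : 'rV[R]_(2 * 2)) : 'rV[R]_2 := \row_j vec_mx y j ord0.
have lf : linear f.
  move=> a x y; rewrite /f -linearP /=; congr mxvec.
  by apply/matrixP; elim/ord2P; elim/ord2P; rewrite !mxE /= ?opprD ?mulrN.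
have lg : linear g by move=> a x y; apply/rowP => j; rewrite !mxE.
have [A AE] := linear_matrix lf; have [B BE] := linear_matrix lg.
exists A, B; split=> [x /unit_sphere1E xS|_ [M [/matrixP MM detM] <-]]; rewrite AE ?BE.
  split; last by apply/rowP; apply: ord2P; rewrite /g /f mxE mxvecK !mxE.
  exists (vec_mx (f x)); last by rewrite vec_mxK.
  rewrite /f mxvecK; split; last first.
    by rewrite det_mx2 !mxE /= -xS; ring.
  apply/matrixP; elim/ord2P; elim/ord2P; rewrite !mxE !big_ord_recl big_ord0 !mxE /=.
  - by rewrite -[RHS]xS; ring.
  - by ring.
  - by ring.
  - by rewrite -[RHS]xS; ring.
set a := M ord0 ord0; set b := M ord0 (lift ord0 ord0).
set c := M (lift ord0 ord0) ord0; set d := M (lift ord0 ord0) (lift ord0 ord0).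
have h00 := MM ord0 ord0; have h11 := MM (lift ord0 ord0) (lift ord0 ord0).
move: h00 h11 detM; rewrite det_mx2 !mxE !big_ord_recl !big_ord0 !mxE /= -/a -/b -/c -/d.
move=> h00 h11 detM.
(* The two squared row norms minus twice the determinant give this sum of squares; its vanishing
   yields the rotation shape d = a, c = -b. *)
have sq : (a - d) ^+ 2 + (b + c) ^+ 2 = 0.
  transitivity ((a * a + (b * b + 0)) + (c * c + (d * d + 0)) - 2 * (a * d - b * c)); first by ring.
  by rewrite h00 h11 detM; ring.
have /eqP : (a - d) ^+ 2 + (b + c) ^+ 2 = 0 by [].
rewrite paddr_eq0 ?sqr_ge0 // !sqrf_eq0 subr_eq0 addr_eq0 => /andP[/eqP ad /eqP bc].
have gE : g (mxvec M) = \row_j nth 0 [:: a; c] j.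
  by apply/rowP; apply: ord2P; rewrite [RHS]mxE /g mxE mxvecK.
rewrite gE; split.
  by apply/unit_sphere1E; rewrite !mxE /= -[RHS]h00 bc; ring.
rewrite /f; congr mxvec; apply/matrixP; elim/ord2P; elim/ord2P; rewrite !mxE /= -?/a -?/b -?/c -?/d ?bc ?ad //.
Qed.

(** The complex closure of a linear copy is the complex copy of the closure: polynomials are pulled
    back to the model, where the density is known. *)
Lemma real_degree_mximage m n (E : 'M[R]_(m, n)) E' (Z : set 'rV[R]_m)
    (Y : set 'rV[R[i]]_m) d :
  E *m E' = 1%:M -> zariski_closure (real_points toC Z) = Y -> has_degree Y d ->
  real_degree (mximage E Z) d.
Proof.
move=> EK YE Yd; rewrite /real_degree.
pose Ec := map_mx toC E; pose Ec' := map_mx toC E'.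
have EcK : Ec *m Ec' = 1%:M by rewrite -map_mxM EK map_mx1.
have -> : zariski_closure ((fun x => map_mx toC x) @` mximage E Z) = mximage Ec Y.
  apply: zariski_closure_eq.
  - move=> _ [_ [z Zz <-] <-]; exists (map_mx toC z); last by rewrite map_mxM.
    by rewrite -YE; apply: sub_zariski_closure; exists z.
  - by apply: (algebraic_mximage EcK); rewrite -YE; apply: zariski_closure_algebraic.
  - move=> f fZ _ [y Yy <-]; rewrite -meval_pullback.
    rewrite -YE in Yy; apply: Yy => _ [z Zz <-].
    by rewrite meval_pullback -map_mxM; apply: fZ; exists (z *m E) => //; exists z.
exact: has_degree_mximage EcK Yd.
Qed.

Section Copy.
Variables (n : nat).

Lemma sphere_copy (E : 'M[R]_(3, n)) E' (Z := mximage E (unit_sphere R 2)) :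
  E *m E' = 1%:M ->
  [/\ irreducible Z, has_dim Z 2, isomorphic Z (sphere R 2) & real_degree Z 2].
Proof.
move=> EK; have [irrS _] := sphere_closure (idfun : {rmorphism R -> R}).
have [_ closS] := sphere_closure (toC : {rmorphism R -> R[i]}).
split.
- exact: irreducible_mximage EK _ irrS.
- exact/(has_dim_mximage EK)/sphere_dim.
- exact: linear_iso_isomorphic (linear_iso_mximage _ EK).
- exact: real_degree_mximage EK closS (sphere_degree _).
Qed.

Lemma torus_copy (E : 'M[R]_(2 + 2, n)) E' (Z := mximage E (torus R)) :
  E *m E' = 1%:M ->
  [/\ irreducible Z, has_dim Z 2,
      isomorphic Z (prod_set (sphere R 1) (sphere R 1)) /\
      isomorphic Z (prod_set (flat (SO R 2)) (flat (SO R 2))) & real_degree Z 4].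
Proof.
move=> EK; have [irrS _] := torus_closure (idfun : {rmorphism R -> R}).
have [_ closS] := torus_closure (toC : {rmorphism R -> R[i]}).
split.
- exact: irreducible_mximage EK _ irrS.
- exact/(has_dim_mximage EK)/torus_dim.
- split; first exact: linear_iso_isomorphic (linear_iso_mximage _ EK).
  apply: linear_iso_isomorphic; apply: linear_iso_trans (linear_iso_mximage _ EK) _.
  exact: linear_iso_prod linear_iso_SO2.
- exact: real_degree_mximage EK closS (torus_degree _).
Qed.

Lemma circle_copy (E : 'M[R]_(2, n)) E' (Z := mximage E (unit_sphere R 1)) :
  E *m E' = 1%:M ->
  [/\ has_dim Z 1, isomorphic Z (flat (SO R 2)) & isomorphic Z (sphere R 1)].
Proof.
move=> EK; split.
- exact/(has_dim_mximage EK)/circle_dim.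
- apply: linear_iso_isomorphic; apply: linear_iso_trans (linear_iso_mximage _ EK) _.
  exact: linear_iso_SO2.
- exact: linear_iso_isomorphic (linear_iso_mximage _ EK).
Qed.

End Copy.
End LinearCopies.

(** * Quaternions and SO(4) *)

Local Notation i0 := (ord0 : 'I_4).
Local Notation i1 := (lift ord0 ord0 : 'I_4).
Local Notation i2 := (lift ord0 (lift ord0 ord0) : 'I_4).
Local Notation i3 := (lift ord0 (lift ord0 (lift ord0 ord0)) : 'I_4).

Section Quaternions.
Variable R : realType.
Implicit Types x M : 'M[R]_4.

(* For x = p^T q, the matrix of v |-> p v q on the quaternions. *)
Definition quat_mx x : 'M[R]_4 := \matrix_(i, j) nth 0 (nth [::]
 [:: [:: x i0 i0 - x i1 i1 - x i2 i2 - x i3 i3; - x i0 i1 - x i1 i0 + x i2 i3 - x i3 i2;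
         - x i0 i2 - x i1 i3 - x i2 i0 + x i3 i1; - x i0 i3 + x i1 i2 - x i2 i1 - x i3 i0];
     [:: x i1 i0 + x i0 i1 - x i3 i2 + x i2 i3; - x i1 i1 + x i0 i0 + x i3 i3 + x i2 i2;
         - x i1 i2 + x i0 i3 - x i3 i0 - x i2 i1; - x i1 i3 - x i0 i2 - x i3 i1 + x i2 i0];
     [:: x i2 i0 + x i3 i1 + x i0 i2 - x i1 i3; - x i2 i1 + x i3 i0 - x i0 i3 - x i1 i2;
         - x i2 i2 + x i3 i3 + x i0 i0 + x i1 i1; - x i2 i3 - x i3 i2 + x i0 i1 - x i1 i0];
     [:: x i3 i0 - x i2 i1 + x i1 i2 + x i0 i3; - x i3 i1 - x i2 i0 - x i1 i3 + x i0 i2;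
         - x i3 i2 - x i2 i3 + x i1 i0 - x i0 i1; - x i3 i3 + x i2 i2 + x i1 i1 + x i0 i0]] i) j.

(** A quarter of the transpose of the linear map [quat_mx], whose values at the matrix units are
    pairwise orthogonal of squared norm 4. *)
Definition quat_coord M : 'M[R]_4 := \matrix_(i, j) (nth 0 (nth [::]
 [:: [:: M i0 i0 + M i1 i1 + M i2 i2 + M i3 i3; - M i0 i1 + M i1 i0 + M i2 i3 - M i3 i2;
         - M i0 i2 - M i1 i3 + M i2 i0 + M i3 i1; - M i0 i3 + M i1 i2 - M i2 i1 + M i3 i0];
     [:: - M i0 i1 + M i1 i0 - M i2 i3 + M i3 i2; - M i0 i0 - M i1 i1 + M i2 i2 + M i3 i3;
         M i0 i3 - M i1 i2 - M i2 i1 + M i3 i0; - M i0 i2 - M i1 i3 - M i2 i0 - M i3 i1];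
     [:: - M i0 i2 + M i1 i3 + M i2 i0 - M i3 i1; - M i0 i3 - M i1 i2 - M i2 i1 - M i3 i0;
         - M i0 i0 + M i1 i1 - M i2 i2 + M i3 i3; M i0 i1 + M i1 i0 - M i2 i3 - M i3 i2];
     [:: - M i0 i3 - M i1 i2 + M i2 i1 + M i3 i0; M i0 i2 - M i1 i3 + M i2 i0 - M i3 i1;
         - M i0 i1 - M i1 i0 - M i2 i3 - M i3 i2; - M i0 i0 + M i1 i1 + M i2 i2 - M i3 i3]] i) j
  / 4).

Lemma quat_mxK : cancel quat_mx quat_coord.
Proof. by move=> x; apply/matrixP; elim/ord4P; elim/ord4P; rewrite mxE /= !mxE /=; field. Qed.

Lemma quat_coordK : cancel quat_coord quat_mx.
Proof. by move=> x; apply/matrixP; elim/ord4P; elim/ord4P; rewrite mxE /= !mxE /=; field. Qed.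

Lemma quat_mx_linear : linear quat_mx.
Proof. by move=> a x y; apply/matrixP; elim/ord4P; elim/ord4P; rewrite mxE /= !mxE /=; ring. Qed.

Lemma quat_coord_linear : linear quat_coord.
Proof. by move=> a x y; apply/matrixP; elim/ord4P; elim/ord4P; rewrite mxE /= !mxE /=; field. Qed.

Definition quat_left (p : 'rV[R]_4) : 'M[R]_4 := \matrix_(i, j) nth 0 (nth [::]
  [:: [:: p ord0 i0; - p ord0 i1; - p ord0 i2; - p ord0 i3];
      [:: p ord0 i1; p ord0 i0; - p ord0 i3; p ord0 i2];
      [:: p ord0 i2; p ord0 i3; p ord0 i0; - p ord0 i1];
      [:: p ord0 i3; - p ord0 i2; p ord0 i1; p ord0 i0]] i) j.

Definition quat_right (q : 'rV[R]_4) : 'M[R]_4 := \matrix_(i, j) nth 0 (nth [::]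
  [:: [:: q ord0 i0; - q ord0 i1; - q ord0 i2; - q ord0 i3];
      [:: q ord0 i1; q ord0 i0; q ord0 i3; - q ord0 i2];
      [:: q ord0 i2; - q ord0 i3; q ord0 i0; q ord0 i1];
      [:: q ord0 i3; q ord0 i2; - q ord0 i1; q ord0 i0]] i) j.

(** Associativity, p v q = p (v q): [quat_left] and [quat_right] are the matrices of the two
    one-sided multiplications. *)
Lemma quat_mx_rank1 (p q : 'rV[R]_4) : quat_mx (p^T *m q) = quat_left p *m quat_right q.
Proof.
by apply/matrixP; elim/ord4P; elim/ord4P;
  rewrite mxE /= [RHS]mxE !big_ord_recl big_ord0 !mxE /= !big_ord1 !mxE; ring.
Qed.

Lemma unit_rV4 (p : 'rV[R]_4) : p *m p^T = 1%:M ->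
  p ord0 i0 ^+ 2 + p ord0 i1 ^+ 2 + p ord0 i2 ^+ 2 + p ord0 i3 ^+ 2 = 1.
Proof.
move/matrixP/(_ ord0 ord0); rewrite !mxE eqxx !big_ord_recl big_ord0 !mxE /= mulr1n.
by move=> e; rewrite -[RHS]e; ring.
Qed.

Lemma quat_left_SO p : p *m p^T = 1%:M -> SO R 4 (quat_left p).
Proof.
move=> /unit_rV4 p1; split.
  by apply/matrixP; elim/ord4P; elim/ord4P; rewrite mxE !big_ord_recl !big_ord0 !mxE /=
     ?mulr1n -?[in RHS]p1; ring.
(* The determinant of left multiplication by p is the square of p0^2 + p1^2 + p2^2 + p3^2. *)
by rewrite det_mx4 !mxE /= -[RHS](expr1n _ 2) -[in RHS]p1; ring.
Qed.

Lemma quat_right_SO q : q *m q^T = 1%:M -> SO R 4 (quat_right q).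
Proof.
move=> /unit_rV4 q1; split.
  by apply/matrixP; elim/ord4P; elim/ord4P; rewrite mxE !big_ord_recl !big_ord0 !mxE /=
     ?mulr1n -?[in RHS]q1; ring.
by rewrite det_mx4 !mxE /= -[RHS](expr1n _ 2) -[in RHS]q1; ring.
Qed.

Lemma SO_mul n (A B : 'M[R]_n) : SO R n A -> SO R n B -> SO R n (A *m B).
Proof.
move=> [AA dA] [BB dB]; split; last by rewrite det_mulmx dA dB mulr1.
by rewrite trmx_mul mulmxA -(mulmxA A) BB mulmx1.
Qed.

(* Hodge duality: for an oriented orthonormal basis a, b, c, d, the bivector
   dual to a /\ b is c /\ d, since the squared norm of their difference is
   1 + 1 - 2 det(a, b, c, d). *)
Lemma bivector_duality (a0 a1 a2 a3 b0 b1 b2 b3 c0 c1 c2 c3 d0 d1 d2 d3 : R) :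
  a0 * a0 + a1 * a1 + a2 * a2 + a3 * a3 = 1 ->
  b0 * b0 + b1 * b1 + b2 * b2 + b3 * b3 = 1 ->
  a0 * b0 + a1 * b1 + a2 * b2 + a3 * b3 = 0 ->
  c0 * c0 + c1 * c1 + c2 * c2 + c3 * c3 = 1 ->
  d0 * d0 + d1 * d1 + d2 * d2 + d3 * d3 = 1 ->
  c0 * d0 + c1 * d1 + c2 * d2 + c3 * d3 = 0 ->
  (a0 * b1 - a1 * b0) * (c2 * d3 - c3 * d2) - (a0 * b2 - a2 * b0) * (c1 * d3 - c3 * d1)
  + (a0 * b3 - a3 * b0) * (c1 * d2 - c2 * d1) + (a1 * b2 - a2 * b1) * (c0 * d3 - c3 * d0)
  - (a1 * b3 - a3 * b1) * (c0 * d2 - c2 * d0) + (a2 * b3 - a3 * b2) * (c0 * d1 - c1 * d0) = 1 ->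
  [/\ [/\ (a0 * b1 - a1 * b0) - (c2 * d3 - c3 * d2) = 0,
          (a0 * b2 - a2 * b0) + (c1 * d3 - c3 * d1) = 0 &
          (a0 * b3 - a3 * b0) - (c1 * d2 - c2 * d1) = 0],
      (a1 * b2 - a2 * b1) - (c0 * d3 - c3 * d0) = 0,
      (a1 * b3 - a3 * b1) + (c0 * d2 - c2 * d0) = 0 &
      (a2 * b3 - a3 * b2) - (c0 * d1 - c1 * d0) = 0].
Proof.
set aa := (X in X = 1 -> _); move=> aa1.
set bb := (X in X = 1 -> _); move=> bb1.
set ab := (X in X = 0 -> _); move=> ab0.
set cc := (X in X = 1 -> _); move=> cc1.
set dd := (X in X = 1 -> _); move=> dd1.
set cd := (X in X = 0 -> _); move=> cd0.
set det := (X in X = 1 -> _); move=> det1.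
set e1 := (X in [/\ [/\ X = _, _ & _], _, _ & _]).
set e2 := (X in [/\ [/\ _, X = _ & _], _, _ & _]).
set e3 := (X in [/\ [/\ _, _ & X = _], _, _ & _]).
set e4 := (X in [/\ _, X = _, _ & _]).
set e5 := (X in [/\ _, _, X = _ & _]).
set e6 := (X in [/\ _, _, _ & X = _]).
have sum0 : e1 ^+ 2 + e2 ^+ 2 + e3 ^+ 2 + e4 ^+ 2 + e5 ^+ 2 + e6 ^+ 2 = 0.
  (* Lagrange's identity: the squared norm of a bivector is the Gram determinant of its two
     vectors. *)
  transitivity (aa * bb - ab ^+ 2 + (cc * dd - cd ^+ 2) - 2 * det).
    by rewrite /e1 /e2 /e3 /e4 /e5 /e6 /aa /bb /ab /cc /dd /cd /det; ring.
  by rewrite aa1 bb1 ab0 cc1 dd1 cd0 det1; ring.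
move: sum0 => /eqP.
rewrite !paddr_eq0 ?addr_ge0 ?sqr_ge0 // !sqrf_eq0.
by move=> /andP[/andP[/andP[/andP[/andP[/eqP-> /eqP->] /eqP->] /eqP->] /eqP->] /eqP->].
Qed.

End Quaternions.

(** Once the bundle of quadratic equations is unpacked, [lra] takes the products of entries as
    atoms, so that finding the combination is linear algebra. *)
Ltac minor_from h :=
  clear -h; rewrite /= in h;
  repeat match goal with H : (_ * _)%type |- _ => destruct H end; lra.

Section SpecialOrthogonal4.
Variable R : realType.

Lemma SO4_duality (M : 'M[R]_4) a b c d :
  SO R 4 M -> uniq [:: a; b; c; d] ->
  \det (\matrix_(i, j) M (nth a [:: a; b; c; d] i) j) = 1 ->
  [/\ [/\ (M a i0 * M b i1 - M a i1 * M b i0) - (M c i2 * M d i3 - M c i3 * M d i2) = 0,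
          (M a i0 * M b i2 - M a i2 * M b i0) + (M c i1 * M d i3 - M c i3 * M d i1) = 0 &
          (M a i0 * M b i3 - M a i3 * M b i0) - (M c i1 * M d i2 - M c i2 * M d i1) = 0],
      (M a i1 * M b i2 - M a i2 * M b i1) - (M c i0 * M d i3 - M c i3 * M d i0) = 0,
      (M a i1 * M b i3 - M a i3 * M b i1) + (M c i0 * M d i2 - M c i2 * M d i0) = 0 &
      (M a i2 * M b i3 - M a i3 * M b i2) - (M c i0 * M d i1 - M c i1 * M d i0) = 0].
Proof.
move=> [MM _] /= /and4P[ab bc cd _] detM.
have row i j : M i i0 * M j i0 + M i i1 * M j i1 + M i i2 * M j i2 + M i i3 * M j i3 = (i == j)%:R.
  have /matrixP/(_ i j) := MM; rewrite !mxE !big_ord_recl big_ord0 !mxE => <-; ring.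
move: ab bc cd; rewrite !inE !negb_or => /and3P[ab ac ad] /andP[bc bd] cd.
apply: bivector_duality; rewrite ?row ?eqxx ?(negbTE ab) ?(negbTE cd) //.
by rewrite -[RHS]detM det_mx4 !mxE.
Qed.

(** The quaternionic factorization in implicit form: the minors are combinations of orthonormality
    of rows, orthonormality of columns, and the duality equations. *)
Lemma SO4_rank1 (M : 'M[R]_4) (x := quat_coord M) : SO R 4 M ->
  forall a b c d, x a b * x c d = x a d * x c b.
Proof.
move=> MSO; have [MM detM] := MSO.
have row i j : M i i0 * M j i0 + M i i1 * M j i1 + M i i2 * M j i2 + M i i3 * M j i3 = (i == j)%:R.
  have /matrixP/(_ i j) := MM; rewrite !mxE !big_ord_recl big_ord0 !mxE => <-; ring.
have col i j : M i0 i * M i0 j + M i1 i * M i1 j + M i2 i * M i2 j + M i3 i * M i3 j = (i == j)%:R.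
  have /matrixP/(_ i j) := mulmx1C MM; rewrite !mxE !big_ord_recl big_ord0 !mxE => <-; ring.
rewrite det_mx4 in detM.
(* The three ways of splitting the rows into two pairs, each listed as an even permutation so that
   the determinant stays 1. *)
have [||[da1 da2 da3] da4 da5 da6] := @SO4_duality M i0 i1 i2 i3 MSO.
- by [].
- by rewrite det_mx4 !mxE.
have [||[db1 db2 db3] db4 db5 db6] := @SO4_duality M i0 i2 i3 i1 MSO.
- by [].
- by rewrite det_mx4 !mxE /= -[RHS]detM; ring.
have [||[dc1 dc2 dc3] dc4 dc5 dc6] := @SO4_duality M i0 i3 i1 i2 MSO.
- by [].
- by rewrite det_mx4 !mxE /= -[RHS]detM; ring.
(* Give the product of [M i j] and [M k l] as weight the exclusive or of i, j, k, l. The quadrics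
   are homogeneous for it, and so are the minors of [x], since [x a b] only involves [M i j] with
   the same exclusive or as a, b; [h0] to [h3] collect the weights 0 to 3. *)
have h0 := (row i0 i0, row i1 i1, row i2 i2, row i3 i3, col i0 i0, col i1 i1, col i2 i2,
            col i3 i3, da1, da6, db2, db5, dc3, dc4).
have h1 := (row i0 i1, row i2 i3, col i0 i1, col i2 i3, db3, db4, dc2, dc5).
have h2 := (row i0 i2, row i1 i3, col i0 i2, col i1 i3, da3, da4, dc1, dc6).
have h3 := (row i0 i3, row i1 i2, col i0 i3, col i1 i2, da2, da5, db1, db6).
move=> {row col da1 da2 da3 da4 da5 da6 db1 db2 db3 db4 db5 db6 dc1 dc2 dc3 dc4 dc5 dc6 detM MM MSO}.
(* Each 2x2 minor of x is a linear combination of the quadrics collected in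
   one of h0, h1, h2, h3. *)
have lt_rank1 (a b c d : 'I_4) : (a < c)%N -> (b < d)%N -> x a b * x c d = x a d * x c b.
  rewrite /x; elim/ord4P: a; elim/ord4P: c => // _.
  - by elim/ord4P: b; elim/ord4P: d => // _; rewrite !mxE /=;
      [ minor_from h0 | minor_from h3 | minor_from h2
      | minor_from h2 | minor_from h3 | minor_from h0 ].
  - by elim/ord4P: b; elim/ord4P: d => // _; rewrite !mxE /=;
      [ minor_from h3 | minor_from h0 | minor_from h1
      | minor_from h1 | minor_from h0 | minor_from h3 ].
  - by elim/ord4P: b; elim/ord4P: d => // _; rewrite !mxE /=;
      [ minor_from h2 | minor_from h1 | minor_from h0
      | minor_from h0 | minor_from h1 | minor_from h2 ].
  - by elim/ord4P: b; elim/ord4P: d => // _; rewrite !mxE /=;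
      [ minor_from h2 | minor_from h1 | minor_from h0
      | minor_from h0 | minor_from h1 | minor_from h2 ].
  - by elim/ord4P: b; elim/ord4P: d => // _; rewrite !mxE /=;
      [ minor_from h3 | minor_from h0 | minor_from h1
      | minor_from h1 | minor_from h0 | minor_from h3 ].
  - by elim/ord4P: b; elim/ord4P: d => // _; rewrite !mxE /=;
      [ minor_from h0 | minor_from h3 | minor_from h2
      | minor_from h2 | minor_from h3 | minor_from h0 ].
move=> a b c d.
case: (ltngtP a c) => [ac|ca|/val_inj <-]; last by rewrite mulrC.
  case: (ltngtP b d) => [bd|db|/val_inj <-//]; first exact: lt_rank1.
  by rewrite -lt_rank1.
case: (ltngtP b d) => [bd|db|/val_inj <-//].
  by rewrite mulrC [RHS]mulrC -lt_rank1.
by rewrite mulrC [RHS]mulrC lt_rank1.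
Qed.

End SpecialOrthogonal4.

(** * Segre sets *)

Section SegreSets.
Variable R : realType.

(** [q] is the row through a nonzero entry divided by its norm [N], and [p] lists the factors by
    which the rows are multiples of [q]. *)
Lemma rank1_unit m n (x : 'M[R]_(m, n)) :
  (forall a b c d, x a b * x c d = x a d * x c b) ->
  \sum_i \sum_j x i j ^+ 2 = 1 ->
  exists (p : 'rV[R]_m) (q : 'rV[R]_n),
    [/\ p *m p^T = 1%:M, q *m q^T = 1%:M & x = p^T *m q].
Proof.
move=> x_rank1 x_norm.
have [a [b xab]] : exists a b, x a b != 0.
  apply: contrapT => x0; move/eqP: x_norm; rewrite big1 => [|i _]; first by rewrite eq_sym oner_eq0.
  rewrite big1 // => j _; apply/eqP; rewrite expf_eq0 /=; apply/negPn/negP => xij.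
  by apply: x0; exists i, j.
pose N := Num.sqrt (\sum_j x a j ^+ 2).
have N2 : N ^+ 2 = \sum_j x a j ^+ 2.
  by rewrite sqr_sqrtr // sumr_ge0 // => j _; rewrite sqr_ge0.
have N0 : N != 0.
  rewrite -sqrf_eq0 N2 psumr_eq0 => [|j _]; last exact: sqr_ge0.
  by apply/allPn; exists b; rewrite ?mem_index_enum // sqrf_eq0.
pose q : 'rV[R]_n := \row_j (x a j / N); pose p : 'rV[R]_m := \row_i (x i b * N / x a b).
have pq : x = p^T *m q.
  apply/matrixP => i j; rewrite mxE big_ord1 !mxE.
  have -> : x i b * N / x a b * (x a j / N) = (x a j * x i b) / x a b by field; rewrite xab N0.
  by rewrite -x_rank1 mulrAC divff // mul1r.
have dotE k (u : 'rV[R]_k) : u *m u^T = (\sum_j u ord0 j ^+ 2)%:M.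
  apply/matrixP => i j; rewrite !ord1 !mxE eqxx mulr1n.
  by apply: eq_bigr => l _; rewrite mxE expr2.
have qq : q *m q^T = 1%:M.
  rewrite dotE (eq_bigr (fun j => N ^- 2 * x a j ^+ 2)) => [|j _].
    by rewrite -mulr_sumr -N2 mulVf // expf_neq0.
  by rewrite mxE expr_div_n mulrC.
exists p, q; split=> //; rewrite dotE; congr (_%:M); rewrite -[RHS]x_norm.
apply: eq_bigr => i _; transitivity (p ord0 i ^+ 2 * \sum_j q ord0 j ^+ 2).
  have /matrixP/(_ ord0 ord0) := qq; rewrite dotE !mxE eqxx !mulr1n => ->.
  by rewrite mulr1.
rewrite mulr_sumr; apply: eq_bigr => j _.
by rewrite [in RHS]pq [in RHS]mxE big_ord1 [p^T _ _]mxE exprMn.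
Qed.

Definition supported n (p : 'rV[R]_n) (A : {set 'I_n}) : Prop :=
  forall i, i \notin A -> p ord0 i = 0.

Definition segre (A B : {set 'I_4}) : set 'M[R]_4 :=
  [set x | exists (p q : 'rV[R]_4), [/\ p *m p^T = 1%:M, q *m q^T = 1%:M,
     supported p A, supported q B & x = p^T *m q]].

Lemma segre_delta (A B : {set 'I_4}) i j : i \in A -> j \in B ->
  segre A B (delta_mx i j).
Proof.
move=> iA jB; exists (delta_mx 0 i), (delta_mx 0 j).
have unit k : delta_mx (0 : 'I_1) k *m (delta_mx (0 : 'I_1) k)^T = 1%:M :> 'M[R]_1.
  by rewrite trmx_delta mul_delta_mx; apply/matrixP => a b; rewrite !ord1 !mxE.
have supp (k : 'I_4) (D : {set 'I_4}) : k \in D -> supported (delta_mx 0 k) D.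
  by move=> kD l lD; rewrite mxE /=; case: eqP => // lk; rewrite lk kD in lD.
by split=> //; [exact: supp|exact: supp|rewrite trmx_delta mul_delta_mx].
Qed.

Lemma segreI A B A' B' : segre A B `&` segre A' B' = segre (A :&: A') (B :&: B').
Proof.
apply/seteqP; split=> x; last first.
  move=> [p [q [pp qq pA qB ->]]].
  by split; exists p, q; split=> // i iD; [apply: pA|apply: qB|apply: pA|apply: qB];
    apply: contra iD; rewrite inE => /andP[].
move=> [[p [q [pp qq pA qB ->]]] [p' [q' [pp' qq' pA' qB' pq]]]].
exists p', q'; split=> // i.
  rewrite inE negb_and => /orP[iA|/pA'//].
  (* Multiplication by the transpose of [q'] recovers [p'] from the common product, so [p'] is zero
     wherever [p] is. *)
  have : (p^T *m q *m q'^T) i ord0 = (p'^T *m q' *m q'^T) i ord0 by rewrite pq.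
  by rewrite -!mulmxA qq' mulmx1 !mxE big_ord1 !mxE pA // mul0r => ->.
rewrite inE negb_and => /orP[iB|/qB'//].
have : (p' *m (p^T *m q)) ord0 i = (p' *m (p'^T *m q')) ord0 i by rewrite pq.
by rewrite !mulmxA pp' mul1mx mxE big_ord1 qB // mulr0 => ->.
Qed.

Lemma segre_nonempty A B : segre A B !=set0 <-> A != finset.set0 /\ B != finset.set0.
Proof.
split=> [[_ [p [q [pp qq pA qB _]]]]|[/set0Pn[i iA] /set0Pn[j jB]]]; last first.
  by exists (delta_mx i j); apply: segre_delta.
have nz (u : 'rV[R]_4) (D : {set 'I_4}) : u *m u^T = 1%:M -> supported u D -> D != finset.set0.
  move=> uu uD; apply/negP => /eqP D0.
  have u0 : u = 0 by apply/rowP => i; rewrite uD ?mxE // D0 inE.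
  by move/matrixP/(_ ord0 ord0)/eqP: uu; rewrite u0 mul0mx !mxE eqxx eq_sym oner_eq0.
by split; [apply: nz pA|apply: nz qB].
Qed.

(** The matrix units with row in [A] and column in [B] reveal the supports. *)
Lemma segre_sub A B A' B' : A != finset.set0 -> B != finset.set0 ->
  segre A B `<=` segre A' B' -> A \subset A' /\ B \subset B'.
Proof.
move=> A0 B0 sub.
have mem i j : i \in A -> j \in B -> i \in A' /\ j \in B'.
  move=> iA jB; have [p [q [_ _ pA qB dE]]] := sub _ (segre_delta iA jB).
  have : (delta_mx i j : 'M[R]_4) i j = 1 by rewrite mxE !eqxx.
  rewrite dE mxE big_ord1 mxE => pq.
  split; apply: contraT => out; move/eqP: pq.
    by rewrite pA // mul0r eq_sym oner_eq0.
  by rewrite qB // mulr0 eq_sym oner_eq0.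
have [/set0Pn[i iA] /set0Pn[j jB]] := (A0, B0).
by split; apply/fintype.subsetP => k kD; [have [] := mem k j kD jB|have [] := mem i k iA kD].
Qed.

Lemma segre11 i j : segre [set i] [set j] = [set delta_mx i j; - delta_mx i j].
Proof.
apply/seteqP; split=> x; last first.
  case=> ->; first by apply: segre_delta; rewrite inE.
  have [p [q [pp qq pA qB dE]]] := @segre_delta [set i] [set j] i j (set11 i) (set11 j).
  exists (- p), q; split=> //; last by rewrite dE linearN mulNmx.
    by rewrite linearN mulNmx mulmxN opprK.
  by move=> k kA; rewrite mxE pA ?oppr0.
move=> [p [q [pp qq pA qB ->]]].
have sq (u : 'rV[R]_4) k : u *m u^T = 1%:M -> supported u [set k] ->
    exists2 e : R, e = 1 \/ e = -1 & u = e *: delta_mx 0 k.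
  move=> uu uk; have uE : u = u ord0 k *: delta_mx 0 k.
    apply/rowP => l; rewrite !mxE /=; case: (eqVneq l k) => [->|lk]; first by rewrite mulr1.
    by rewrite mulr0 uk // inE.
  exists (u ord0 k) => //; move/matrixP/(_ ord0 ord0): uu.
  rewrite !mxE eqxx (bigD1 k) //= big1 ?addr0 => [|l lk]; last by rewrite uk ?mul0r // inE.
  by rewrite mxE -expr2 mulr1n => /eqP; rewrite sqrf_eq1 => /orP[] /eqP; [left|right].
have [e e1 ->] := sq p i pp pA; have [f f1 ->] := sq q j qq qB.
rewrite -scalemxAr [(_ *: _)^T]linearZ /= -scalemxAl scalerA trmx_delta mul_delta_mx.
case: e1 => ->; case: f1 => ->; rewrite ?mulrNN ?mulrN ?mulNr !mulr1 ?scale1r ?scaleN1r;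
  by [left|right].
Qed.

Definition flat_segre (A B : {set 'I_4}) : set 'rV[R]_(4 * 4) :=
  (fun x => mxvec (quat_mx x)) @` segre A B.

Lemma flat_quat_inj : injective (fun x : 'M[R]_4 => mxvec (quat_mx x)).
Proof. by apply: (can_inj (g := fun v => quat_coord (vec_mx v))) => x; rewrite mxvecK quat_mxK. Qed.

Lemma flat_segreI A B A' B' :
  flat_segre A B `&` flat_segre A' B' = flat_segre (A :&: A') (B :&: B').
Proof.
rewrite /flat_segre -segreI; apply/seteqP; split=> [_ [[x xS <-] [y yS /flat_quat_inj yx]]|_ [x [xS xS'] <-]].
  by exists x => //; split=> //; rewrite -yx.
by split; exists x.
Qed.

Lemma flat_segre_sub A B A' B' : A != finset.set0 -> B != finset.set0 ->
  flat_segre A B `<=` flat_segre A' B' -> A \subset A' /\ B \subset B'.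
Proof.
move=> A0 B0 sub; apply: segre_sub => // x xS.
have [|y yS /flat_quat_inj <- //] := sub (mxvec (quat_mx x)).
by exists x.
Qed.

Lemma flat_segre_nonempty A B :
  flat_segre A B !=set0 <-> A != finset.set0 /\ B != finset.set0.
Proof.
rewrite -segre_nonempty; split=> [[_ [x xS _]]|[x xS]]; first by exists x.
by exists (mxvec (quat_mx x)), x.
Qed.

Lemma flat_HSO_segre : flat (HSO R 4) =
  [set v | exists2 A : {set 'I_4}, (A != finset.set0) && (A != [set: 'I_4]%SET) & flat_segre A (~: A)%SET v].
Proof.
apply/seteqP; split=> [_ [M [hM SOM] <-]|_ [A _ [x [p [q [pp qq pA qA ->]]] <-]]]; last first.
  have pq0 k : p ord0 k * q ord0 k = 0.
    have [kA|kA] := boolP (k \in A); last by rewrite pA ?mul0r.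
    by rewrite qA ?mulr0 // inE negbK.
  exists (quat_mx (p^T *m q)) => //; split; last first.
    by rewrite quat_mx_rank1; apply: SO_mul; [exact: quat_left_SO|exact: quat_right_SO].
  have x0 k : (p^T *m q) k k = 0 by rewrite mxE big_ord1 mxE pq0.
  by elim/ord4P; rewrite mxE /= !x0; ring.
pose x := quat_coord M.
have [|p [q [pp qq xE]]] := rank1_unit (SO4_rank1 SOM).
  have row i : \sum_k M i k ^+ 2 = 1.
    have /matrixP/(_ i i) := SOM.1; rewrite !mxE eqxx mulr1n => e; rewrite -[RHS]e.
    by apply: eq_bigr => k _; rewrite mxE expr2.
  (* [quat_coord] divides the squared norm by 4, and a matrix of SO(4) has four unit rows. *)
  transitivity ((\sum_i \sum_k M i k ^+ 2) / 4).
    by rewrite !big_ord_recl !big_ord0 !mxE /=; field.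
  by rewrite (eq_bigr (fun=> 1)) => [|i _]; rewrite ?row // sumr_const card_ord divff ?pnatr_eq0.
have x0 k : p ord0 k * q ord0 k = 0.
  transitivity (x k k); first by rewrite /x xE mxE big_ord1 mxE.
  by elim/ord4P: k; rewrite /x mxE /= !hM; ring.
have seg : segre [set k | p ord0 k != 0]%SET (~: [set k | p ord0 k != 0])%SET x.
  exists p, q; split=> //= k; first by rewrite inE negbK => /eqP.
  by rewrite !inE negbK => pk; have /eqP := x0 k; rewrite mulf_eq0 (negbTE pk) => /eqP.
have [A0 B0] : [set k | p ord0 k != 0]%SET != finset.set0 /\ (~: [set k | p ord0 k != 0])%SET != finset.set0.
  by apply/segre_nonempty; exists x.
exists [set k | p ord0 k != 0]%SET; last by exists x => //; rewrite quat_coordK.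
by rewrite A0 /=; apply: contra B0 => /eqP ->; rewrite finset.setCT.
Qed.

End SegreSets.

Arguments segre : clear implicits.
Arguments flat_segre : clear implicits.

(** * The pieces as linear copies of the models *)

Section SegreCopies.
Variable R : realType.

Lemma flat_quat_mximage m (f : 'rV[R]_m -> 'M[R]_4) (g : 'M[R]_4 -> 'rV[R]_m) :
  linear f -> linear g -> cancel f g ->
  exists (E : 'M[R]_(m, 4 * 4)) E', E *m E' = 1%:M /\
    forall Y, (fun x => mxvec (quat_mx x)) @` (f @` Y) = mximage E Y.
Proof.
move=> lf lg fK.
have lF : linear (fun y => mxvec (quat_mx (f y))).
  by move=> a x y; rewrite lf quat_mx_linear linearP.
have lG : linear (fun v : 'rV[R]_(4 * 4) => g (quat_coord (vec_mx v))).
  by move=> a x y; rewrite linearP quat_coord_linear lg.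
have [E EE] := linear_matrix lF; have [E' EE'] := linear_matrix lG.
exists E, E'; split.
  apply/row_matrixP => i; rewrite !rowE mulmxA EE EE' mxvecK quat_mxK fK.
  by rewrite mulmx1.
move=> Y; apply/seteqP; split=> [_ [_ [y Yy <-] <-]|_ [y Yy <-]].
  by exists y; rewrite ?EE.
by exists (f y); [exists y|rewrite EE].
Qed.

(** For injective [s], an isometric embedding of R^k onto the vectors supported on the image of
    [s]. *)
Definition select k (s : 'I_k -> 'I_4) : 'M[R]_(k, 4) := \matrix_(i, j) (s i == j)%:R.

Lemma selectK k (s : 'I_k -> 'I_4) : injective s -> select s *m (select s)^T = 1%:M.
Proof.
move=> injs; apply/matrixP => i j; rewrite !mxE (bigD1 (s i)) //= big1 => [|l ls].
  by rewrite !mxE eqxx mul1r addr0 (inj_eq injs) eq_sym.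
by rewrite !mxE eq_sym (negbTE ls) mul0r.
Qed.

Lemma supported_select k (s : 'I_k -> 'I_4) (A : {set 'I_4}) (p : 'rV[R]_4) :
  injective s -> A = [set s i | i : 'I_k]%SET -> supported p A ->
  p *m (select s)^T *m select s = p.
Proof.
move=> injs AE pA; apply/rowP => j.
have [jA|jA] := boolP (j \in A); last first.
  rewrite pA // mxE big1 // => i _; rewrite [select s i j]mxE; case: eqP => [ij|]; last by rewrite mulr0.
  by move: jA; rewrite AE -ij imset_f ?inE.
move: jA; rewrite AE => /imsetP[i _ ->].
rewrite mxE (bigD1 i) //= big1 => [|l li].
  rewrite [select s i _]mxE eqxx mulr1 addr0 mxE (bigD1 (s i)) //= big1 => [|l ls].
    by rewrite !mxE eqxx mulr1 addr0.
  by rewrite !mxE eq_sym (negbTE ls) mulr0.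
by rewrite [select s l _]mxE (inj_eq injs) (negbTE li) mulr0.
Qed.

Lemma select_supported k (s : 'I_k -> 'I_4) (A : {set 'I_4}) (y : 'rV[R]_k) :
  A = [set s i | i : 'I_k]%SET -> supported (y *m select s) A.
Proof.
move=> AE j jA; rewrite mxE big1 // => i _; rewrite mxE; case: eqP => [ij|]; last by rewrite mulr0.
by move: jA; rewrite AE -ij imset_f ?inE.
Qed.

Lemma set_enumeration k (A : {set 'I_4}) : #|A| = k ->
  exists2 s : 'I_k -> 'I_4, injective s & A = [set s i | i : 'I_k]%SET.
Proof.
move=> Ak; exists (fun i => enum_val (cast_ord (esym Ak) i)).
  by move=> i j /enum_val_inj /cast_ord_inj.
apply/setP => x; apply/idP/imsetP => [xA|[i _ ->]]; last exact: enum_valP.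
exists (cast_ord Ak (enum_rank_in xA x)) => //.
by rewrite cast_ordK enum_rankK_in.
Qed.

Lemma unit_sphere_mulmx k (y : 'rV[R]_k.+1) : unit_sphere R k y <-> y *m y^T = 1%:M.
Proof.
have e : (y *m y^T) ord0 ord0 = \sum_i y ord0 i ^+ 2.
  by rewrite mxE; apply: eq_bigr => i _; rewrite mxE expr2.
split=> [yS|yy]; last by rewrite /unit_sphere /= -e yy mxE eqxx.
by apply/matrixP => i j; rewrite !ord1 e yS mxE eqxx.
Qed.

Lemma select_unit k (s : 'I_k -> 'I_4) (y : 'rV[R]_k) : injective s ->
  (y *m select s) *m (y *m select s)^T = y *m y^T.
Proof. by move=> injs; rewrite trmx_mul mulmxA -(mulmxA y) selectK // mulmx1. Qed.

Lemma flat_segre1 k (A B : {set 'I_4}) : #|A| = 1%N -> #|B| = k.+1 ->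
  exists (E : 'M[R]_(k.+1, 4 * 4)) E', E *m E' = 1%:M /\
    flat_segre R A B = mximage E (unit_sphere R k).
Proof.
move=> /eqP/cards1P[a ->] /set_enumeration[s injs BE].
pose f (y : 'rV[R]_k.+1) : 'M[R]_4 := (delta_mx 0 a)^T *m (y *m select s).
pose g (x : 'M[R]_4) : 'rV[R]_k.+1 := row a x *m (select s)^T.
have lf : linear f by move=> c x y; rewrite /f mulmxDl -scalemxAl mulmxDr -scalemxAr.
have lg : linear g by move=> c x y; rewrite /g linearP mulmxDl -scalemxAl.
have dd : delta_mx (0 : 'I_1) a *m (delta_mx (0 : 'I_1) a)^T = 1%:M :> 'M[R]_1.
  by rewrite trmx_delta mul_delta_mx; apply/matrixP => i j; rewrite !ord1 !mxE.
have fK : cancel f g.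
  move=> y; rewrite /g /f rowE !mulmxA dd mul1mx -mulmxA selectK //.
  by rewrite mulmx1.
have [E [E' [EK EE]]] := flat_quat_mximage lf lg fK.
exists E, E'; split=> //; rewrite -EE /flat_segre; congr image.
apply/seteqP; split=> [x [p [q [pp qq pa qB ->]]]|_ [y /unit_sphere_mulmx yy <-]]; last first.
  exists (delta_mx 0 a), (y *m select s); split=> //.
  - by rewrite select_unit.
  - by move=> j; rewrite inE mxE /= => /negbTE ->.
  - exact: select_supported.
have pE : p = p ord0 a *: delta_mx 0 a.
  apply/rowP => l; rewrite !mxE /=; case: (eqVneq l a) => [->|la]; first by rewrite mulr1.
  by rewrite mulr0 pa // inE.
(* [p] is plus or minus a basis vector, and the sign moves to the other factor. *)
exists (p ord0 a *: (q *m (select s)^T)).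
  apply/unit_sphere_mulmx; rewrite [(_ *: _)^T]linearZ /= -scalemxAl -scalemxAr scalerA.
  rewrite trmx_mul trmxK mulmxA (supported_select injs BE qB) qq.
  move: pp; rewrite pE [(_ *: _)^T]linearZ /= -scalemxAl -scalemxAr scalerA dd !mxE !eqxx.
  by rewrite mulr1.
have -> : f (p ord0 a *: (q *m (select s)^T)) = p ord0 a *: ((delta_mx 0 a)^T *m q).
  by rewrite /f -scalemxAl (supported_select injs BE qB) -scalemxAr.
by rewrite [in RHS]pE [(_ *: delta_mx _ _)^T]linearZ /= -scalemxAl.
Qed.

Lemma segre_tr A B x : segre R A B x -> segre R B A x^T.
Proof.
by move=> [p [q [pp qq pA qB ->]]]; exists q, p; split=> //; rewrite trmx_mul trmxK.
Qed.

(** Transposition exchanges the two factors and is linear, so this reduces to the case where the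
    first support is a singleton. *)
Lemma flat_segre1r k (A B : {set 'I_4}) : #|A| = k.+1 -> #|B| = 1%N ->
  exists (E : 'M[R]_(k.+1, 4 * 4)) E', E *m E' = 1%:M /\
    flat_segre R A B = mximage E (unit_sphere R k).
Proof.
move=> Ak B1; have [E0 [E0' [EK0 BAE]]] := flat_segre1 B1 Ak.
pose f (y : 'rV[R]_k.+1) : 'M[R]_4 := (quat_coord (vec_mx (y *m E0)))^T.
pose g (x : 'M[R]_4) : 'rV[R]_k.+1 := mxvec (quat_mx x^T) *m E0'.
have lf : linear f.
  by move=> c x y; rewrite /f mulmxDl -scalemxAl linearP quat_coord_linear linearP.
have lg : linear g.
  by move=> c x y; rewrite /g linearP quat_mx_linear linearP mulmxDl -scalemxAl.
have fK : cancel f g.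
  by move=> y; rewrite /g /f trmxK quat_coordK vec_mxK -mulmxA EK0 mulmx1.
have [E [E' [EK EE]]] := flat_quat_mximage lf lg fK.
exists E, E'; split=> //; rewrite -EE /flat_segre; congr image.
apply/seteqP; split=> [x /segre_tr xS|_ [y yS <-]].
  have : flat_segre R B A (mxvec (quat_mx x^T)) by exists x^T.
  rewrite BAE => -[y yS yE]; exists y => //.
  by rewrite /f yE mxvecK quat_mxK trmxK.
have : mximage E0 (unit_sphere R k) (y *m E0) by exists y.
rewrite -BAE => -[x xS xE]; rewrite /f -xE mxvecK quat_mxK.
exact: segre_tr.
Qed.

(* p^T q has entries cos s cos t, ..., and the coordinates cos (s - t),
   sin (s - t), cos (s + t), sin (s + t) identify this surface with the torus. *)
Definition torus_mx (u : 'rV[R]_(2 + 2)) : 'M[R]_2 := \matrix_(i, j)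
  (nth 0 (nth [::] [:: [:: u ord0 i0 + u ord0 i2; u ord0 i3 - u ord0 i1];
                       [:: u ord0 i1 + u ord0 i3; u ord0 i0 - u ord0 i2]] i) j / 2).

Definition torus_coord (x : 'M[R]_2) : 'rV[R]_(2 + 2) :=
  let j0 : 'I_2 := ord0 in let j1 : 'I_2 := lift ord0 ord0 in
  \row_i nth 0 [:: x j0 j0 + x j1 j1; x j1 j0 - x j0 j1; x j0 j0 - x j1 j1; x j1 j0 + x j0 j1] i.

Lemma torus_mxK : cancel torus_mx torus_coord.
Proof. by move=> u; apply/rowP; elim/ord4P; rewrite mxE /= !mxE /=; field. Qed.

Lemma torus_coordK : cancel torus_coord torus_mx.
Proof. by move=> u; apply/matrixP; elim/ord2P; elim/ord2P; rewrite mxE /= !mxE /=; field. Qed.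

Lemma torus_mx_linear : linear torus_mx.
Proof. by move=> c u v; apply/matrixP; elim/ord2P; elim/ord2P; rewrite mxE /= !mxE /=; field. Qed.

Lemma torus_coord_linear : linear torus_coord.
Proof. by move=> c u v; apply/rowP; elim/ord4P; rewrite mxE /= !mxE /=; ring. Qed.

Lemma flat_segre2 (A B : {set 'I_4}) : #|A| = 2%N -> #|B| = 2%N ->
  exists (E : 'M[R]_(2 + 2, 4 * 4)) E', E *m E' = 1%:M /\
    flat_segre R A B = mximage E (torus R).
Proof.
move=> /set_enumeration[s injs AE] /set_enumeration[t injt BE].
pose f (u : 'rV[R]_(2 + 2)) : 'M[R]_4 := (select s)^T *m torus_mx u *m select t.
pose g (x : 'M[R]_4) : 'rV[R]_(2 + 2) := torus_coord (select s *m x *m (select t)^T).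
have lf : linear f.
  by move=> c x y; rewrite /f torus_mx_linear mulmxDr mulmxDl -scalemxAr -scalemxAl.
have lg : linear g.
  by move=> c x y; rewrite /g mulmxDr mulmxDl -scalemxAr -scalemxAl torus_coord_linear.
have sK (x : 'M[R]_2) : select s *m ((select s)^T *m x *m select t) *m (select t)^T = x.
  by rewrite !mulmxA selectK // mul1mx -mulmxA selectK // mulmx1.
have fK : cancel f g by move=> u; rewrite /g /f sK torus_mxK.
have [E [E' [EK EE]]] := flat_quat_mximage lf lg fK.
exists E, E'; split=> //; rewrite -EE /flat_segre; congr image.
apply/seteqP; split=> [x [p [q [pp qq pA qB ->]]]|_ [u /torusE[uS vS] <-]].
  have [p' pE] : exists p', p = p' *m select s.
    by exists (p *m (select s)^T); rewrite (supported_select injs AE pA).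
  have [q' qE] : exists q', q = q' *m select t.
    by exists (q *m (select t)^T); rewrite (supported_select injt BE qB).
  have pp' : unit_sphere R 1 p' by apply/unit_sphere_mulmx; rewrite -(select_unit _ injs) -pE.
  have qq' : unit_sphere R 1 q' by apply/unit_sphere_mulmx; rewrite -(select_unit _ injt) -qE.
  exists (torus_coord (p'^T *m q')); last first.
    by rewrite /f torus_coordK pE qE trmx_mul !mulmxA.
  move: pp' qq' => /unit_sphere1E pp' /unit_sphere1E qq'.
  apply/torusE; rewrite !mxE /= ?mxE !big_ord1 !mxE.
  (* Each circle equation is the two-square identity for the product of the squared norms of [p']
     and [q']. *)
  by split; rewrite -[RHS]mulr1 -{1}pp' -qq'; ring.
(* Conversely, the difference of the two circle equations says that the 2 x 2 determinant is zero,
   and their sum that the norm is 1. *)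
have [||p [q [pp qq xE]]] := @rank1_unit R 2 2 (torus_mx u).
- have det0 : torus_mx u ord0 ord0 * torus_mx u (lift ord0 ord0) (lift ord0 ord0) =
              torus_mx u ord0 (lift ord0 ord0) * torus_mx u (lift ord0 ord0) ord0.
    rewrite !mxE /=; apply/eqP; rewrite -subr_eq0; apply/eqP.
    transitivity (((u ord0 i0 ^+ 2 + u ord0 i1 ^+ 2) - (u ord0 i2 ^+ 2 + u ord0 i3 ^+ 2)) / 4).
      by field.
    by rewrite uS vS subrr mul0r.
  by elim/ord2P; elim/ord2P; elim/ord2P; elim/ord2P; lra.
- rewrite !big_ord_recl !big_ord0 !mxE /=.
  transitivity (((u ord0 i0 ^+ 2 + u ord0 i1 ^+ 2) + (u ord0 i2 ^+ 2 + u ord0 i3 ^+ 2)) / 2).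
    by field.
  by rewrite uS vS; field.
exists (p *m select s), (q *m select t); split.
- by rewrite select_unit.
- by rewrite select_unit.
- exact: select_supported.
- exact: select_supported.
- by rewrite /f xE trmx_mul !mulmxA.
Qed.

End SegreCopies.

(** * The cuboctahedron *)

Section ConvexCombination.
Variables (R : realType) (n : nat) (B : set 'rV[R]_n).
Hypothesis convB : convex.convex_set B.

Lemma convex_segment x y t : 0 <= t -> t <= 1 -> B x -> B y ->
  B (t *: x + (1 - t) *: y).
Proof.
move=> t0 t1 Bx By.
have := convB (Itv01 t0 t1) (mem_set Bx) (mem_set By).
by rewrite inE.
Qed.

Lemma convex_combination (I : finType) (l : I -> R) (y : I -> 'rV[R]_n) :
  (forall i, 0 <= l i) -> \sum_i l i = 1 -> (forall i, B (y i)) ->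
  B (\sum_i l i *: y i).
Proof.
move=> l0 l1 By.
(* Partial sums of the weights need not be 1, so the induction divides by them. *)
have H s : \sum_(i <- s) l i != 0 ->
    B ((\sum_(i <- s) l i)^-1 *: \sum_(i <- s) l i *: y i).
  elim: s => [|i s IHs]; first by rewrite big_nil eqxx.
  rewrite !big_cons; set S := \sum_(j <- s) l j; set Y := \sum_(j <- s) _.
  have S0 : 0 <= S by rewrite sumr_ge0.
  have [S00|Sn0] := eqVneq S 0.
    have -> : Y = 0.
      rewrite /Y big_seq big1 // => j js; have /eqP := S00.
      rewrite psumr_eq0 // => /allP/(_ j js) /= /eqP ->.
      by rewrite scale0r.
    by rewrite S00 !addr0 scalerA => li; rewrite mulVf // scale1r.
  move=> liS; have lS : 0 < l i + S by rewrite lt_def liS addr_ge0.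
  have -> : (l i + S)^-1 *: (l i *: y i + Y) =
      (l i / (l i + S)) *: y i + (1 - l i / (l i + S)) *: (S^-1 *: Y).
    rewrite scalerDr !scalerA; congr (_ *: _ + _ *: _); first by rewrite mulrC.
    by field; rewrite Sn0 liS.
  apply: convex_segment => //; last exact: IHs.
    by rewrite divr_ge0 ?addr_ge0.
  by rewrite ler_pdivrMr // mul1r lerDl.
by have := H (index_enum I); rewrite l1 oner_eq0 invr1 scale1r; apply.
Qed.

End ConvexCombination.

Section Cuboctahedron.
Variable R : realType.
Implicit Types (x : 'rV[R]_3) (A B : {set 'I_4}) (i j k : 'I_4).

(** The vertices of a regular tetrahedron inscribed in the cube; half the difference of two distinct
    ones is a vertex of the cuboctahedron. *)
Definition tetra : 'M[R]_(4, 3) := \matrix_(i, j)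
  nth 0 (nth [::] [:: [:: 1; 1; 1]; [:: 1; -1; -1]; [:: -1; 1; -1]; [:: -1; -1; 1]] i) j.

Lemma tetra_tr_mul : tetra^T *m tetra = 4%:M.
Proof.
by apply/matrixP; elim/ord3P; elim/ord3P; rewrite !mxE !big_ord_recl big_ord0 !mxE /=; ring.
Qed.

Lemma tetra_dot i j : (tetra *m tetra^T) i j = 4 * (i == j)%:R - 1.
Proof.
by elim/ord4P: i; elim/ord4P: j; rewrite !mxE !big_ord_recl big_ord0 !mxE /=; ring.
Qed.

(* The vertices of the cuboctahedron are the root_pt i j with i != j. The
   functions zc x i identify R^3 with the hyperplane sum zero in R^4 and send
   root_pt i j to e_i - e_j. *)
Definition root_pt i j : 'rV[R]_3 := 2^-1 *: (row i tetra - row j tetra).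

Definition zc x i : R := (x *m tetra^T) ord0 i / 2.

Lemma zc_linear (a : R) x y i : zc (a *: x + y) i = a * zc x i + zc y i.
Proof. by rewrite /zc mulmxDl -scalemxAl !mxE; field. Qed.

Lemma zcD x y i : zc (x + y) i = zc x i + zc y i.
Proof. by rewrite -[x]scale1r zc_linear mul1r scale1r. Qed.

Lemma zcZ (a : R) x i : zc (a *: x) i = a * zc x i.
Proof. by rewrite -[_ *: x]addr0 zc_linear [zc 0 _](_ : _ = 0) ?addr0 // /zc mul0mx mxE mul0r. Qed.

Lemma zc_root i j k : zc (root_pt i j) k = (k == i)%:R - (k == j)%:R.
Proof.
rewrite /zc /root_pt -scalemxAl mulmxBl !mxE.
have e l : (\sum_m row l tetra ord0 m * tetra^T m k) = 4 * (l == k)%:R - 1.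
  by rewrite -tetra_dot mxE; apply: eq_bigr => m _; rewrite mxE.
by rewrite !e ![_ == k]eq_sym; field.
Qed.

Lemma zc_sum x : \sum_k zc x k = 0.
Proof. by rewrite !big_ord_recl big_ord0 /zc !mxE !big_ord_recl !big_ord0 !mxE /=; field. Qed.

Lemma zcK x : x = 2^-1 *: \sum_k zc x k *: row k tetra.
Proof.
have -> : \sum_k zc x k *: row k tetra = 2^-1 *: (x *m tetra^T *m tetra).
  rewrite mulmx_sum_row scaler_sumr; apply: eq_bigr => k _.
  by rewrite scalerA mulrC.
by rewrite -mulmxA tetra_tr_mul mul_mx_scalar !scalerA -[LHS]scale1r; congr (_ *: _); field.
Qed.

Lemma zc_inj x y : zc x =1 zc y -> x = y.
Proof. by move=> xy; rewrite [x]zcK [y]zcK; congr (_ *: _); apply: eq_bigr => k _; rewrite xy. Qed.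

Lemma functional_zc x (c : 'cV[R]_3) :
  (x *m c) ord0 ord0 = \sum_k zc x k * ((tetra *m c) k ord0 / 2).
Proof.
rewrite {1}[x]zcK -scalemxAl mxE mulmx_suml summxE mulr_sumr; apply: eq_bigr => k _.
by rewrite -scalemxAl mxE -row_mul mxE; field.
Qed.

(** The l1 norm on the sum-zero vectors of R^4. The cuboctahedron will be its ball of radius 2,
    whose convexity is the triangle inequality. *)
Definition znorm x : R := \sum_k `|zc x k|.

Lemma znorm_segment x y t : 0 <= t -> t <= 1 ->
  znorm (t *: x + (1 - t) *: y) <= t * znorm x + (1 - t) * znorm y.
Proof.
move=> t0 t1; rewrite !mulr_sumr -big_split /=; apply: ler_sum => k _.
rewrite zcD !zcZ; apply: le_trans (ler_normD _ _) _.
by rewrite !normrM (ger0_norm t0) (@ger0_norm _ (1 - t)) // subr_ge0.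
Qed.

Definition vertices : set 'rV[R]_3 :=
  [set x | exists (s : 'S_3) (a b : bool),
       x = col_perm s (\row_(i < 3) [:: (-1) ^+ a; (-1) ^+ b; 0]`_i)].

Lemma vertices_znorm x : vertices x -> znorm x <= 2.
Proof.
move=> [s [a [b xE]]].
pose r : 'rV[R]_3 := \row_(i < 3) [:: (-1) ^+ a; (-1) ^+ b; 0]`_i.
have xr (j : 'I_3) : x ord0 j = r ord0 (s j) by rewrite xE mxE.
have zE k : zc x k = ((-1) ^+ a * tetra k ((s^-1)%g ord0) +
                      (-1) ^+ b * tetra k ((s^-1)%g (lift ord0 ord0))) / 2.
  rewrite /zc; congr (_ / 2); rewrite mxE (reindex_perm s^-1)%g /=.
  rewrite !big_ord_recl big_ord0 !xr !permKV !mxE /=; ring.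
have z01 k : [\/ zc x k = 0, zc x k = 1 | zc x k = -1].
  have t1 l : tetra k l = 1 \/ tetra k l = -1.
    by elim/ord4P: k; elim/ord3P: l; rewrite mxE /=; first [by left | by right].
  rewrite zE; have [-> | ->] := t1 ((s^-1)%g ord0);
    have [-> | ->] := t1 ((s^-1)%g (lift ord0 ord0)); case: (a); case: (b);
    rewrite ?expr0 ?expr1;
    first [by apply: Or31; field | by apply: Or32; field | by apply: Or33; field].
(* On the values 0, 1, -1 the absolute value is the square, and [zc] preserves the sum of squares,
   which is 2 at a vertex. *)
apply: le_trans (_ : \sum_k zc x k ^+ 2 <= 2).
  by apply: ler_sum => k _; case: (z01 k) => ->; rewrite ?normrN ?sqrrN ?normr0 ?normr1 ?expr0n ?expr1n.
have -> : \sum_k zc x k ^+ 2 = \sum_j x ord0 j ^+ 2.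
  by rewrite !big_ord_recl !big_ord0 /zc !mxE !big_ord_recl !big_ord0 !mxE /=; field.
rewrite (reindex_perm s^-1)%g !big_ord_recl big_ord0 !xr !permKV !mxE /=.
by rewrite !sqrr_sign expr0n /=; lra.
Qed.

Lemma vertices_intro x (j0 : 'I_3) : x ord0 j0 = 0 ->
  (forall j : 'I_3, j != j0 -> x ord0 j = 1 \/ x ord0 j = -1) -> vertices x.
Proof.
move=> x0 x1; pose j2 : 'I_3 := lift ord0 (lift ord0 ord0).
pose s := tperm j0 j2.
exists s, (x ord0 (s ord0) == -1), (x ord0 (s (lift ord0 ord0)) == -1).
have sign (j : 'I_3) : j != j0 -> x ord0 j = (-1) ^+ (x ord0 j == -1).
  by move=> /x1[] ->; rewrite ?eqxx // -subr_eq0 opprK -mulr2n pnatr_eq0.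
have sj (j : 'I_3) : j != j2 -> s j != j0.
  by apply: contra => /eqP sj; rewrite -[j](tpermK j0 j2) -/s sj tpermL.
have rE (i : 'I_3) : x ord0 (s i) = [:: (-1) ^+ (x ord0 (s ord0) == -1);
    (-1) ^+ (x ord0 (s (lift ord0 ord0)) == -1); 0]`_i.
  elim/ord3P: i => /=; [exact/sign/sj|exact/sign/sj|].
  by rewrite /s tpermR.
by apply/rowP => j; rewrite !mxE -rE tpermK.
Qed.

Lemma vertices_root i j : i != j -> vertices (root_pt i j).
Proof.
move=> ij.
(* The table gives the position of the zero coordinate of [root_pt i j]; its diagonal entries are
   fillers. *)
pose z : nat :=
  nth 0%N (nth [::] [:: [:: 0; 0; 1; 2]; [:: 0; 0; 2; 1]; [:: 1; 2; 0; 0]; [:: 2; 1; 0; 0]] i)%N j.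
apply: (@vertices_intro _ (inord z)).
  by elim/ord4P: i ij @z; elim/ord4P: j => // _ z; rewrite /z /= !mxE !inordK //=; field.
have : (z < 3)%N by rewrite /z; elim/ord4P: i ij @z; elim/ord4P: j.
move=> z3 k; rewrite -val_eqE /= inordK //.
elim/ord4P: i ij @z z3; elim/ord4P: j => // _ /= _; elim/ord3P: k => // _; rewrite !mxE /=;
  first [by left; field | by right; field].
Qed.

(** For the inclusion from right to left, the positive part [a] and the negative part [b] of the
    coordinates have the same mass m <= 1. When m > 0, the product weights a_i b_j / m^2 couple them
    into a convex combination of the [root_pt i j], and the weight 1 - m goes to the origin. *)
Lemma cuboctahedronE : cuboctahedron R = [set x | znorm x <= 2].
Proof.
apply/seteqP; split=> x.
  apply; split; last exact: vertices_znorm.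
  move=> y z t; rewrite !inE /= => y2 z2.
  apply: le_trans (znorm_segment _ _ _ _) _; rewrite ?ge0 ?le1 //.
  have t0 : 0 <= t%:num by rewrite ge0.
  have t1 : 0 <= 1 - t%:num by rewrite subr_ge0 le1.
  have := ler_wpM2l t0 y2; have := ler_wpM2l t1 z2; lra.
move=> /= x2 B [convB verB].
have Broot i j : i != j -> B (root_pt i j) by move=> /vertices_root /verB.
have root_opp i j : root_pt i j = - root_pt j i by rewrite /root_pt -scalerN opprB.
have B0 : B 0.
  have -> : 0 = 2^-1 *: root_pt i0 i1 + (1 - 2^-1) *: root_pt i1 i0.
    by rewrite (root_opp i1) scalerN -scalerBl (_ : _ - _ = 0) ?scale0r //; field.
  by apply: convex_segment => //; rewrite ?invr_ge0 ?invf_le1 ?ler1n //; apply: Broot.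
have Broot' i j : B (root_pt i j).
  have [->|] := eqVneq i j; last exact: Broot.
  by rewrite /root_pt subrr scaler0.
pose m := znorm x / 2.
pose a k := (`|zc x k| + zc x k) / 2; pose b k := (`|zc x k| - zc x k) / 2.
have a0 k : 0 <= a k by have := ler_norm (- zc x k); rewrite normrN /a; lra.
have b0 k : 0 <= b k by rewrite divr_ge0 // subr_ge0 ler_norm.
have am : \sum_k a k = m by rewrite -mulr_suml big_split /= zc_sum addr0.
have bm : \sum_k b k = m by rewrite -mulr_suml sumrB zc_sum subr0.
have m0 : 0 <= m by rewrite -am sumr_ge0.
have [mz|mn0] := eqVneq m 0.
  have -> // : x = 0.
  have a00 k : a k = 0.
    by apply/eqP; move/eqP: am; rewrite mz psumr_eq0 // => /allP/(_ k (mem_index_enum k)).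
  have b00 k : b k = 0.
    by apply/eqP; move/eqP: bm; rewrite mz psumr_eq0 // => /allP/(_ k (mem_index_enum k)).
  apply: zc_inj => k; have := a00 k; have := b00 k.
  rewrite /a /b [zc 0 k](_ : _ = 0) ?/zc ?mul0mx ?mxE ?mul0r // -/(zc x k).
  by rewrite /a /b; lra.
have -> : x = m *: (\sum_(ij : 'I_4 * 'I_4) (a ij.1 * b ij.2 / m ^+ 2) *: root_pt ij.1 ij.2) + (1 - m) *: 0.
  rewrite scaler0 addr0 -(pair_bigA _ (fun i j => (a i * b j / m ^+ 2) *: root_pt i j)) /=.
  apply: zc_inj => k; rewrite zcZ.
  have zs (I : finType) (F : I -> 'rV[R]_3) : zc (\sum_i F i) k = \sum_i zc (F i) k.
    elim/big_rec2: _ => [|i y y' _ <-]; last by rewrite zcD.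
    by rewrite /zc mul0mx mxE mul0r.
  rewrite zs; transitivity (m * \sum_i \sum_j (a i * b j / m ^+ 2) * ((k == i)%:R - (k == j)%:R)).
    2: by congr (_ * _); apply: eq_bigr => i _; rewrite zs; apply: eq_bigr => j _; rewrite zcZ zc_root.
  transitivity (m * (\sum_i \sum_j (a i / m ^+ 2 * (k == i)%:R) * b j
                   - \sum_i \sum_j a i * (b j / m ^+ 2 * (k == j)%:R))).
    have -> : \sum_i \sum_j (a i / m ^+ 2 * (k == i)%:R) * b j = a k / m.
      under eq_bigr do rewrite -mulr_sumr bm.
      rewrite (bigD1 k) //= big1 => [|i ik]; last by rewrite eq_sym (negbTE ik) mulr0 mul0r.
      by rewrite eqxx mulr1 addr0; field.
    have -> : \sum_i \sum_j a i * (b j / m ^+ 2 * (k == j)%:R) = b k / m.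
      rewrite -big_distrlr /= am (bigD1 k) //= big1 => [|i ik].
        by rewrite eqxx mulr1 addr0; field.
      by rewrite eq_sym (negbTE ik) mulr0.
    by rewrite /a /b; field.
  congr (_ * _); rewrite -sumrB; apply: eq_bigr => i _.
  by rewrite -sumrB; apply: eq_bigr => j _; ring.
apply: convex_segment => //; first by rewrite /m ler_pdivrMr // mul1r.
apply: convex_combination => //.
  by move=> ij; apply: divr_ge0; [apply: mulr_ge0|apply: exprn_ge0].
rewrite -(pair_bigA _ (fun i j => a i * b j / m ^+ 2)) /=.
under eq_bigr do rewrite -mulr_suml -mulr_sumr bm.
by rewrite -mulr_suml -mulr_suml am; field.
Qed.

End Cuboctahedron.

Section AffineDimension.
Variables (R : realType) (n : nat).

Lemma affine_dim_inj (F : set 'rV[R]_n) d d' :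
  affine_dim F d -> affine_dim F d' -> d = d'.
Proof.
have le e e' : affine_dim F e -> affine_dim F e' -> (e <= e')%N.
  move=> [x [U [Fx <- FU Umin]]] [y [V [Fy <- FV Vmin]]]; apply/dimvS/Umin => z Fz.
  have -> : z - x = (z - y) - (x - y) by rewrite opprB addrA subrK.
  by rewrite memvB ?FV.
by move=> dF d'F; apply/eqP; rewrite eqn_leq !le.
Qed.

Lemma dual_family_free (I : eqType) (s : seq I) (g : I -> 'rV[R]_n)
    (l : I -> 'rV[R]_n -> R) :
  uniq s -> (forall i, linear (l i : 'rV[R]_n -> R^o)) ->
  (forall i j, i \in s -> j \in s -> l i (g j) = (i == j)%:R) ->
  free [seq g i | i <- s].
Proof.
move=> + linl; elim: s => [|i s IHs] /=; first by rewrite nil_free.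
move=> /andP[si us] dual; rewrite free_cons IHs //; last first.
  by move=> j k js ks; apply: dual; rewrite inE ?js ?ks orbT.
rewrite andbT; apply/negP => gis.
pose li : {linear 'rV[R]_n -> R^o} := HB.pack (l i) (GRing.isLinear.Build _ _ _ _ (l i) (linl i)).
have : (<<[seq g j | j <- s]>> <= lker (linfun li))%VS.
  apply/span_subvP => _ /mapP[j js ->]; rewrite memv_ker lfunE /=.
  rewrite dual ?inE ?eqxx ?js ?orbT //; case: (eqVneq i j) => [ij|_]; last by rewrite eqxx.
  by rewrite ij js in si.
move=> /subvP/(_ _ gis); rewrite memv_ker lfunE /= dual ?mem_head //.
by rewrite eqxx oner_eq0.
Qed.

End AffineDimension.

(** * Faces of the cuboctahedron, their dimensions and vertices *)

Section CuboctahedronFaces.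
Variable R : realType.
Implicit Types (x : 'rV[R]_3) (A B : {set 'I_4}) (i j k : 'I_4).
Local Notation P := (cuboctahedron R).
Local Notation disjoint_sets A B := (fintype.disjoint (mem A) (mem B)).

(** Sign conditions replace the hull of the e_i - e_j: the positive part lives on [A], the negative
    part on [B]. Intersections become immediate, and the set is empty when [A] or [B] is. *)
Definition bipart_face A B : set 'rV[R]_3 :=
  [set x | znorm x = 2 /\
     forall k, (k \notin A -> zc x k <= 0) /\ (k \notin B -> 0 <= zc x k)].

Lemma bipart_faceI A B A' B' :
  bipart_face A B `&` bipart_face A' B' = bipart_face (A :&: A') (B :&: B').
Proof.
apply/seteqP; split=> x [].
  move=> [x2 xAB] [_ xAB']; split=> // k; have [kA kB] := xAB k; have [kA' kB'] := xAB' k.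
  by rewrite !inE !negb_and; split=> /orP[]; auto.
move=> x2 xAB; split; split=> // k; have [kA kB] := xAB k; rewrite !inE !negb_and in kA kB;
  by split=> kk; [apply: kA|apply: kB]; rewrite kk ?orbT.
Qed.

Lemma znorm_root i j : i != j -> znorm (root_pt R i j) = 2.
Proof.
move=> ij; rewrite /znorm (bigD1 i) //= (bigD1 j) 1?eq_sym //= big1 => [|k /andP[ki kj]].
  by rewrite !zc_root !eqxx (negbTE ij) eq_sym (negbTE ij) subr0 sub0r normrN normr1 addr0.
by rewrite zc_root (negbTE ki) (negbTE kj) subrr normr0.
Qed.

Lemma bipart_face_root A B i j : i != j -> disjoint_sets A B ->
  bipart_face A B (root_pt R i j) <-> (i \in A) && (j \in B).
Proof.
move=> ij disj; split=> [[_ F]|/andP[iA jB]].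
  apply/andP; split; apply: contraT => out.
    by have [/(_ out)] := F i; rewrite zc_root eqxx (negbTE ij) subr0 ler10.
  by have [_ /(_ out)] := F j; rewrite zc_root eqxx eq_sym (negbTE ij) sub0r oppr_ge0 ler10.
split; first exact: znorm_root.
move=> k; rewrite zc_root; split=> kk.
  rewrite (_ : (k == i) = false) ?sub0r ?oppr_le0 ?ler0n //.
  by apply: contraNF kk => /eqP ->.
rewrite (_ : (k == j) = false) ?subr0 ?ler0n //.
by apply: contraNF kk => /eqP ->.
Qed.

Lemma bipart_face_sum A B x : disjoint_sets A B -> bipart_face A B x ->
  [/\ forall k, k \notin A -> k \notin B -> zc x k = 0,
      \sum_(k in A) zc x k = 1 & \sum_(k in B) zc x k = -1].
Proof.
move=> disj [x2 F].
have z0 k : k \notin A -> k \notin B -> zc x k = 0.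
  by move=> kA kB; have [/(_ kA) le0 /(_ kB) ge0] := F k; apply/eqP; rewrite eq_le le0.
have BA k : k \in B -> k \notin A by move=> kB; rewrite (disjointFl disj kB).
have AB k : k \in A -> k \notin B by move=> kA; rewrite (disjointFr disj kA).
have split_sum (f : 'I_4 -> R) : (forall k, k \notin A -> k \notin B -> f k = 0) ->
    \sum_k f k = \sum_(k in A) f k + \sum_(k in B) f k.
  move=> f0; rewrite (bigID (fun k => k \in A)) /=; congr (_ + _).
  rewrite (bigID (fun k => k \in B)) /= [X in _ + X]big1 ?addr0 => [|k /andP[kA kB]]; last exact: f0.
  apply: eq_bigl => k; apply/andP/idP => [[]//|kB]; split=> //; exact: BA.
have s0 := zc_sum x; rewrite split_sum // in s0.
have s2 : \sum_(k in A) zc x k - \sum_(k in B) zc x k = 2.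
  rewrite -[RHS]x2 /znorm split_sum => [|k kA kB]; last by rewrite z0 ?normr0.
  rewrite -sumrN; congr (_ + _); apply: eq_bigr => k kk.
    by rewrite ger0_norm //; have [_] := F k; apply; apply: AB.
  by rewrite ler0_norm //; have [] := F k => + _; apply; apply: BA.
by split=> //; lra.
Qed.

Lemma bipart_face_sub A B A' B' : disjoint_sets A B -> disjoint_sets A' B' ->
  A != finset.set0 -> B != finset.set0 ->
  bipart_face A B `<=` bipart_face A' B' -> A \subset A' /\ B \subset B'.
Proof.
move=> disj disj' /set0Pn[a aA] /set0Pn[b bB] sub.
have mem i j : i \in A -> j \in B -> (i \in A') && (j \in B').
  move=> iA jB; have ij : i != j by apply: contraTneq iA => ->; rewrite (disjointFl disj jB).
  by apply/(bipart_face_root ij disj')/sub/(bipart_face_root ij disj); rewrite iA jB.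
by split; apply/fintype.subsetP => k kD; [have /andP[] := mem k b kD bB|have /andP[] := mem a k aA kD].
Qed.

Lemma bipart_face_face A B : disjoint_sets A B -> face P (bipart_face A B).
Proof.
(* The functional with weights 1 on [A], -1 on [B] and 0 elsewhere is at most [znorm], with equality
   under the sign conditions. The bound 2 becomes 4 because [zc] halves the coordinates. *)
move=> disj; pose al k : R := (k \in A)%:R - (k \in B)%:R.
pose c : 'cV[R]_3 := (tetra R)^T *m (\col_k al k).
have cE x : (x *m c) ord0 ord0 = 2 * \sum_k al k * zc x k.
  rewrite /c mulmxA mxE mulr_sumr; apply: eq_bigr => k _.
  by rewrite [(\col_k0 _) _ _]mxE /zc; field.
have al_le x k : al k * zc x k <= `|zc x k|.
  rewrite /al; case: (k \in A); case: (k \in B); rewrite ?subrr ?subr0 ?sub0r ?mul0r ?mul1r ?mulN1r //.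
    exact: ler_norm.
  by rewrite -normrN ler_norm.
exists c, 4; split=> [x|].
  rewrite cuboctahedronE /= cE => x2.
  have : \sum_k al k * zc x k <= znorm x by apply: ler_sum => k _; apply: al_le.
  by move: x2; lra.
rewrite cuboctahedronE; apply/seteqP; split=> x /=; rewrite cE.
  move=> [x2 F]; split; first by rewrite x2.
  have -> : \sum_k al k * zc x k = znorm x; last by rewrite x2; ring.
  apply: eq_bigr => k _; have [kA kB] := F k; rewrite /al.
  have [kinA|knA] := boolP (k \in A).
    by rewrite (disjointFr disj kinA) /= subr0 mul1r ger0_norm // kB // (disjointFr disj kinA).
  have [kinB|knB] := boolP (k \in B); first by rewrite sub0r mulN1r ler0_norm // kA.
  have -> : zc x k = 0 by apply/eqP; rewrite eq_le kA // kB.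
  by rewrite mulr0 normr0.
move=> [x2 al4].
have d0 k : 0 <= `|zc x k| - al k * zc x k by rewrite subr_ge0.
have sum0 : \sum_k (`|zc x k| - al k * zc x k) = 0.
  apply/eqP; rewrite eq_le sumr_ge0 // andbT sumrB -/(znorm x); lra.
have eqk k : al k * zc x k = `|zc x k|.
  move/eqP: sum0; rewrite psumr_eq0 // => /allP/(_ k (mem_index_enum k)).
  by rewrite subr_eq0 => /eqP.
split; first by rewrite /znorm -(eq_bigr _ (fun k _ => eqk k)); lra.
move=> k; have ek := eqk k; have n0 := normr_ge0 (zc x k); split=> kk; move: ek; rewrite /al (negbTE kk).
  by case: (k \in B) => /=; rewrite ?sub0r ?subr0 ?mulN1r ?mul0r => ek;
    have := ler_norm (zc x k); lra.
by case: (k \in A) => /=; rewrite ?subr0 ?mul1r ?mul0r => ek;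
  have := ler_norm (- zc x k); rewrite normrN; lra.
Qed.

(** A functional is maximal at the e_i - e_j with i in its argmax set [A] and j in its argmin set
    [B]. If its four weights agree, it is zero on sum-zero vectors and the face is everything. *)
Lemma face_cases F : face P F ->
  [\/ F = set0, F = P | exists A B, [/\ A != finset.set0, B != finset.set0,
                                   disjoint_sets A B & F = bipart_face A B]].
Proof.
move=> [c [b [Pb FE]]].
have [F0|/eqP/set0P[x0]] := pselect (F = set0); first by constructor 1.
rewrite FE => -[x0P /= x0b].
pose al k := (tetra R *m c) k ord0 / 2.
have cE x : (x *m c) ord0 ord0 = \sum_k zc x k * al k by exact: functional_zc.
pose i := [arg max_(i > ord0) al i]%O; pose j := [arg min_(i < ord0) al i]%O.
have maxi k : al k <= al i by rewrite /i; case: arg_maxP => // l _; apply.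
have minj k : al j <= al k by rewrite /j; case: arg_minP => // l _; apply.
have wpos x k : 0 <= (`|zc x k| + zc x k) / 2 * (al i - al k).
  apply: mulr_ge0; last by rewrite subr_ge0.
  by have := ler_norm (- zc x k); rewrite normrN; lra.
have wneg x k : 0 <= (`|zc x k| - zc x k) / 2 * (al k - al j).
  apply: mulr_ge0; last by rewrite subr_ge0.
  by have := ler_norm (zc x k); lra.
(* Complementary slackness: the gap is a sum of nonnegative terms, positive part times [al i - al k]
   and negative part times [al k - al j], so each term is zero on the face. *)
have sumw x : \sum_k ((`|zc x k| + zc x k) / 2 * (al i - al k) +
    (`|zc x k| - zc x k) / 2 * (al k - al j)) =
    znorm x / 2 * (al i - al j) - (x *m c) ord0 ord0.
  transitivity (\sum_k (`|zc x k| * ((al i - al j) / 2) + zc x k * ((al i + al j) / 2)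
                        - zc x k * al k)).
    by apply: eq_bigr => k _; field.
  by rewrite sumrB big_split /= -mulr_suml -mulr_suml zc_sum mul0r addr0 -cE /znorm; field.
have sumw_ge0 x : 0 <= znorm x / 2 * (al i - al j) - (x *m c) ord0 ord0.
  by rewrite -sumw sumr_ge0 // => k _; rewrite addr_ge0.
have [alE|alD] := eqVneq (al i) (al j).
  constructor 2; have cE0 x : (x *m c) ord0 ord0 = 0.
    rewrite cE (eq_bigr (fun k => zc x k * al i)) => [|k _].
      by rewrite -mulr_suml zc_sum mul0r.
    by congr (_ * _); apply/eqP; rewrite eq_le maxi alE minj.
  by apply/seteqP; split=> x; [case|move=> xP; split=> //=; rewrite cE0 -x0b cE0].
have ij : i != j by apply: contraNneq alD => ->.
have altd : 0 < al i - al j by rewrite subr_gt0 lt_def alD maxi.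
have root_in : P (root_pt R i j) by rewrite cuboctahedronE /= znorm_root.
have rootE : (root_pt R i j *m c) ord0 ord0 = al i - al j.
  rewrite cE (eq_bigr (fun k => (k == i)%:R * al k - (k == j)%:R * al k)) => [|k _].
    have delta l : \sum_k (k == l)%:R * al k = al l.
      by rewrite (bigD1 l) //= eqxx mul1r big1 ?addr0 // => k /negbTE ->; rewrite mul0r.
    by rewrite sumrB !delta.
  by rewrite zc_root mulrBl.
have bE : b = al i - al j.
  apply/eqP; rewrite eq_le; apply/andP; split; last by rewrite -rootE; apply: Pb.
  have := sumw_ge0 x0; rewrite x0b subr_ge0 => /le_trans; apply.
  move: x0P; rewrite cuboctahedronE /= => x02.
  by apply: ler_piMl; [exact: ltW|rewrite ler_pdivrMr // mul1r].
constructor 3; exists [set k | al k == al i]%SET, [set k | al k == al j]%SET; split.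
- by apply/set0Pn; exists i; rewrite inE.
- by apply/set0Pn; exists j; rewrite inE.
- rewrite -setI_eq0; apply/eqP/setP => k; rewrite !inE.
  by apply/negP => /andP[/eqP -> /eqP /eqP]; rewrite (negbTE alD).
apply/seteqP; split=> x.
  rewrite cuboctahedronE => -[/= x2]; rewrite bE => xb.
  have x2' : znorm x / 2 <= 1 by rewrite ler_pdivrMr // mul1r.
  have sum0 := sumw x; have := sumw_ge0 x; rewrite xb => ge0.
  have n1 : znorm x / 2 = 1.
    apply/eqP; rewrite eq_le x2' /=.
    by move: ge0; rewrite -[X in _ - X]mul1r -mulrBl pmulr_lge0 // subr_ge0.
  rewrite xb n1 mul1r subrr in sum0.
  have w0 k : (`|zc x k| + zc x k) / 2 * (al i - al k) = 0 /\
              (`|zc x k| - zc x k) / 2 * (al k - al j) = 0.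
    move/eqP: sum0; rewrite psumr_eq0 => [|l _]; last by rewrite addr_ge0.
    move=> /allP/(_ k (mem_index_enum k)) /=.
    by rewrite paddr_eq0 // => /andP[/eqP -> /eqP ->].
  split; first by move: n1; lra.
  move=> k; have [wi wj] := w0 k; rewrite !inE; split=> ak.
    move/eqP: wi; rewrite mulf_eq0 subr_eq0 [al i == _]eq_sym (negbTE ak) orbF => /eqP h.
    by have := normr_ge0 (zc x k); lra.
  move/eqP: wj; rewrite mulf_eq0 subr_eq0 (negbTE ak) orbF => /eqP h.
  by have := normr_ge0 (zc x k); lra.
move=> [x2 xAB]; split; first by rewrite cuboctahedronE /= x2.
rewrite /= bE.
have : \sum_k ((`|zc x k| + zc x k) / 2 * (al i - al k) +
    (`|zc x k| - zc x k) / 2 * (al k - al j)) = 0.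
  rewrite big1 // => k _; have [ki kj] := xAB k; rewrite !inE in ki kj.
  have [e|/ki zi] := eqVneq (al k) (al i).
    have zk : 0 <= zc x k by apply: kj; rewrite e.
    by rewrite ger0_norm // e; ring.
  have [e|/kj zj] := eqVneq (al k) (al j); first by rewrite ler0_norm // e; ring.
  have -> : zc x k = 0 by apply/eqP; rewrite eq_le zi.
  by rewrite normr0; ring.
by rewrite sumw x2 divff ?pnatr_eq0 // mul1r => /eqP; rewrite subr_eq0 => /eqP <-.
Qed.

Lemma bipart_face_affine_dim A B : A != finset.set0 -> B != finset.set0 ->
  disjoint_sets A B -> affine_dim (bipart_face A B) (#|A| + #|B|).-2.
Proof.
move=> /set0Pn[a aA] /set0Pn[b bB] disj.
(* The directions are spanned by e_k - e_a for k in A and e_k - e_b for k in B; [D] drops a and b,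
   where the difference is zero, and the functions [zc] at the points of [D] are dual to the
   rest. *)
pose base k := if k \in A then a else b.
pose g k : 'rV[R]_3 := root_pt R k (base k).
pose D := ((A :\ a) :|: (B :\ b))%SET.
have Dcard : #|D| = (#|A| + #|B|).-2.
  rewrite cardsU (cardsD1 a A) aA (cardsD1 b B) bB.
  have -> : (A :\ a) :&: (B :\ b) = finset.set0.
    apply/setP => k; rewrite !inE; apply/negP => /andP[/andP[_ kA] /andP[_ kB]].
    by rewrite (disjointFr disj kA) in kB.
  by rewrite cards0 subn0 addnS.
have bA : b \notin A by rewrite (disjointFl disj bB).
have aB : a \notin B by rewrite (disjointFr disj aA).
have baseD k l : k \in D -> (k == base l) = false.
  rewrite /base !inE; case: ifP => _ /orP[/andP[ka kA]|/andP[kb kB]].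
  - exact: negbTE.
  - by apply: contraNF aB => /eqP <-.
  - by apply: contraNF bA => /eqP <-.
  - exact: negbTE.
have freeD : free [seq g k | k <- enum D].
  apply: (@dual_family_free _ _ _ _ _ (fun k x => zc x k)); first exact: enum_uniq.
    by move=> k c x y; rewrite zc_linear.
  by move=> k l; rewrite !mem_enum => kD lD; rewrite zc_root (baseD k l kD) subr0.
have ab : a != b by apply: contraNneq bA => <-.
exists (root_pt R a b), <<[seq g k | k <- enum D]>>%VS; split.
- by apply/(bipart_face_root ab disj); rewrite aA bB.
- by move: freeD; rewrite /free => /eqP ->; rewrite size_map -cardE Dcard.
- move=> x Fx; have [z0 sA sB] := bipart_face_sum disj Fx.
  have -> : x - root_pt R a b = \sum_k zc x k *: g k.
    have e1 : \sum_k zc x k *: row (base k) (tetra R) = row a (tetra R) - row b (tetra R).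
      rewrite (bigID (fun k => k \in A)) /=; congr (_ + _).
        rewrite (eq_bigr (fun k => zc x k *: row a (tetra R))) => [|k kA].
          by rewrite -scaler_suml sA scale1r.
        by rewrite /base kA.
      rewrite (eq_bigr (fun k => zc x k *: row b (tetra R))) => [|k kA].
        rewrite -scaler_suml -scaleN1r; congr (_ *: _); rewrite -sB.
        rewrite [LHS](bigID (fun k => k \in B)) /= [X in _ + X]big1 ?addr0 => [|k /andP[kA kB]]; last exact: z0.
        apply: eq_bigl => k; apply/andP/idP => [[]//|kB]; split=> //.
        by rewrite (disjointFl disj kB).
      by rewrite /base (negbTE kA).
    rewrite {1}[x]zcK -scalerBr; under [RHS]eq_bigr do rewrite scalerA mulrC -scalerA scalerBr.
    by rewrite -scaler_sumr sumrB e1.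
  rewrite memv_suml // => k _; have [kD|kD] := boolP (k \in D).
    by rewrite memvZ // memv_span // map_f // mem_enum.
  move: kD; rewrite !inE negb_or !negb_and !negbK => /andP[ka kb].
  have [kA|kA] := boolP (k \in A).
    move: ka; rewrite kA orbF => /eqP ->.
    by rewrite /g /base aA /root_pt subrr !scaler0 mem0v.
  have [kB|kB] := boolP (k \in B); last by rewrite z0 // scale0r mem0v.
  move: kb; rewrite kB orbF => /eqP ->.
  by rewrite /g /base (negbTE bA) /root_pt subrr !scaler0 mem0v.
- move=> V FV; apply/span_subvP => v /mapP[k]; rewrite mem_enum !inE => kD ->; move: kD.
  have neq i j : i \in A -> j \in B -> i != j.
    by move=> iA jB; apply: contraTneq iA => ->; rewrite (disjointFl disj jB).
  move=> /orP[/andP[ka kA]|/andP[kb kB]].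
    have -> : g k = root_pt R k b - root_pt R a b.
      by rewrite /g /base kA /root_pt -scalerBr opprB addrA subrK.
    by apply/FV/(bipart_face_root (neq _ _ kA bB) disj); rewrite kA bB.
  have -> : g k = - (root_pt R a k - root_pt R a b).
    by rewrite /g /base (disjointFl disj kB) /root_pt -scalerBr -scalerN; congr (_ *: _);
       apply/rowP => i; rewrite !mxE; ring.
  by rewrite memvN; apply/FV/(bipart_face_root (neq _ _ aA kB) disj); rewrite aA kB.
Qed.

Lemma cuboctahedron_affine_dim : affine_dim P 3.
Proof.
have i01 : i0 != i1 by [].
exists (root_pt R i0 i1), fullv; split.
- by rewrite cuboctahedronE /= znorm_root.
- by rewrite dimvf.
- by move=> x _; rewrite memvf.
move=> V PV; pose g k := root_pt R k i0.
have gV k : k != i0 -> g k \in V.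
  move=> k0; have root_P i j : i != j -> P (root_pt R i j).
    by move=> ij; rewrite cuboctahedronE /= znorm_root.
  have k0' : i0 != k by rewrite eq_sym.
  (* Half the difference of two opposite vertices, each taken relative to the base point. *)
  have -> : g k = 2^-1 *: ((root_pt R k i0 - root_pt R i0 i1) - (root_pt R i0 k - root_pt R i0 i1)).
    by apply/rowP => l; rewrite /g /root_pt !mxE; field.
  by apply/memvZ/memvB; apply: PV; apply: root_P.
pose D := ([set: 'I_4] :\ i0)%SET.
have freeD : free [seq g k | k <- enum D].
  apply: (@dual_family_free _ _ _ _ _ (fun k x => zc x k)); first exact: enum_uniq.
    by move=> k c x y; rewrite zc_linear.
  move=> k l; rewrite !mem_enum !inE => /andP[k0 _] _.
  by rewrite zc_root (negbTE k0) subr0.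
have spanV : (<<[seq g k | k <- enum D]>> <= V)%VS.
  by apply/span_subvP => v /mapP[k]; rewrite mem_enum !inE andbT => k0 ->; apply: gV.
have dimD : \dim <<[seq g k | k <- enum D]>> = 3.
  move: freeD; rewrite /free => /eqP ->; rewrite size_map -cardE.
  by have := cardsD1 i0 [set: 'I_4]%SET; rewrite cardsT card_ord inE => -[].
have -> : fullv = <<[seq g k | k <- enum D]>>%VS by apply/eqP; rewrite eq_sym eqEdim subvf dimD dimvf.
exact: spanV.
Qed.

Lemma affine_dim_set0 (d : nat) : ~ affine_dim (set0 : set 'rV[R]_3) d.
Proof. by move=> [x [U []]]. Qed.

Lemma face_dim F d : face P F -> affine_dim F d -> (d < 3)%N ->
  exists A B, [/\ A != finset.set0, B != finset.set0, disjoint_sets A B,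
    (#|A| + #|B|)%N = d.+2 & F = bipart_face A B].
Proof.
move=> /face_cases[->|->|[A [B [A0 B0 disj ->]]]] Fd d3; first by case: (affine_dim_set0 Fd).
  by move: d3; rewrite (affine_dim_inj Fd cuboctahedron_affine_dim).
exists A, B; split=> //; rewrite -(affine_dim_inj (bipart_face_affine_dim A0 B0 disj) Fd).
by move: A0 B0; rewrite -!card_gt0; lia.
Qed.

Lemma facetsE : facets P =
  [set F | exists2 A : {set 'I_4}, (A != finset.set0) && (A != finset.setT) & F = bipart_face A (~: A)%SET].
Proof.
apply/seteqP; split=> F.
  move=> [faceF [d Pd Fd]].
  have d2 : d = 2%N by have := affine_dim_inj Pd cuboctahedron_affine_dim => -[].
  rewrite d2 in Fd; have [//|A [B [A0 B0 disj AB ->]]] := face_dim faceF Fd.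
  have BE : B = (~: A)%SET.
    apply/eqP; rewrite eqEcard; apply/andP; split.
      by rewrite -finset.disjoints_subset disjoint_sym.
    by move: (cardsC A) AB; rewrite card_ord; lia.
  exists A; last by rewrite BE.
  by rewrite A0 /=; apply: contra B0 => /eqP AT; rewrite BE AT finset.setCT.
move=> [A /andP[A0 AT] ->].
have disj : disjoint_sets A (~: A) by rewrite finset.disjoints_subset finset.setCK.
have C0 : ~: A != finset.set0.
  by apply: contra AT => /eqP cA0; rewrite -[A]finset.setCK cA0 finset.setC0.
split; first exact: bipart_face_face.
exists 2%N; first exact: cuboctahedron_affine_dim.
by have := bipart_face_affine_dim A0 C0 disj; rewrite cardsC card_ord.
Qed.

Lemma edgeE F : edge P F <->
  exists A B, [/\ A != finset.set0, B != finset.set0, disjoint_sets A B,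
    (#|A| + #|B|)%N = 3%N & F = bipart_face A B].
Proof.
split=> [[faceF Fd]|[A [B [A0 B0 disj AB ->]]]]; first exact: face_dim faceF Fd _.
split; first exact: bipart_face_face.
by have := bipart_face_affine_dim A0 B0 disj; rewrite AB.
Qed.

Lemma vertexE F : vertex P F <->
  exists A B, [/\ A != finset.set0, B != finset.set0, disjoint_sets A B,
    (#|A| + #|B|)%N = 2%N & F = bipart_face A B].
Proof.
split=> [[faceF Fd]|[A [B [A0 B0 disj AB ->]]]]; first exact: face_dim faceF Fd _.
split; first exact: bipart_face_face.
by have := bipart_face_affine_dim A0 B0 disj; rewrite AB.
Qed.

(** The vertices correspond to the pairs in A x B: 2 x 2 for a square, 1 x 3 for a triangle. *)
Lemma bipart_face_vertices A B : disjoint_sets A B ->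
  has_vertices P (bipart_face A B) (#|A| * #|B|).
Proof.
move=> disj; rewrite /has_vertices.
have neq i j : i \in A -> j \in B -> i != j.
  by move=> iA jB; apply: contraTneq iA => ->; rewrite (disjointFl disj jB).
have disj1 i j : i != j -> disjoint_sets [set i]%SET [set j]%SET by move=> ij; rewrite disjoints1 inE.
have n1 i : [set i]%SET != finset.set0 by apply/set0Pn; exists i; rewrite inE.
have -> : [set v | vertex P v /\ v `<=` bipart_face A B] =
  (fun ij : 'I_4 * 'I_4 => bipart_face [set ij.1] [set ij.2]) @` [set` finset.setX A B].
  apply/seteqP; split=> [v [/vertexE[A1 [B1 [A10 B10 disjv c2 ->]]]]|v [[i j] /= ]].
    move=> /(bipart_face_sub disjv disj A10 B10)[AA BB].
    have [cA cB] : #|A1| = 1%N /\ #|B1| = 1%N.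
      by move: A10 B10 c2; rewrite -!card_gt0; lia.
    move/eqP/cards1P: cA AA => [i ->]; move/eqP/cards1P: cB BB => [j ->].
    rewrite !finset.sub1set => jB iA; exists (i, j) => //=; by rewrite inE /= iA.
  rewrite inE /= => /andP[iA jB] <-; split.
    by apply/vertexE; exists [set i]%SET, [set j]%SET; rewrite !cards1; split=> //; apply/disj1/neq.
  have -> : bipart_face [set i] [set j] = bipart_face (A :&: [set i]) (B :&: [set j]).
    by congr bipart_face; apply/setP => k; rewrite !inE; case: eqP => [->|]; rewrite ?iA ?jB ?andbF.
  by rewrite -bipart_faceI => x [].
rewrite -cardsX; apply: card_image_finset => -[i j] [i' j']; rewrite !inE /=.
move=> /andP[iA jB] /andP[iA' jB'] e.
have [] := bipart_face_sub (disj1 _ _ (neq _ _ iA jB)) (disj1 _ _ (neq _ _ iA' jB')) (n1 i) (n1 j).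
  by rewrite e.
by rewrite !finset.sub1set !inE => /eqP -> /eqP ->.
Qed.

End CuboctahedronFaces.

Arguments bipart_face : clear implicits.

(** * Components and facets *)

Section Components.
Variable R : realType.
Implicit Types S A B : {set 'I_4}.

Definition proper_set S : bool := (S != finset.set0) && (S != finset.setT).

Definition component S : set 'rV[R]_(4 * 4) := flat_segre R S (~: S)%SET.

Definition facet_of S : set 'rV[R]_3 := bipart_face R S (~: S)%SET.

Lemma proper_setC S : proper_set S -> ~: S != finset.set0.
Proof.
by move=> /andP[_]; apply: contra => /eqP S0; rewrite -[S]finset.setCK S0 finset.setC0.
Qed.

Lemma card_setC4 S : (#|S| + #|(~: S)%SET|)%N = 4%N.
Proof. by rewrite cardsC card_ord. Qed.

Lemma proper_set_card S : proper_set S -> (0 < #|S|)%N /\ (0 < #|(~: S)%SET|)%N.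
Proof. by move=> pS; have := proper_setC pS; case/andP: pS => S0 _ C0; rewrite !card_gt0. Qed.

Lemma card_proper_set S : (0 < #|S| < 4)%N -> proper_set S.
Proof.
move=> /andP[S0 S4]; rewrite /proper_set -card_gt0 S0 /=.
by apply: contraTneq S4 => ->; rewrite cardsT card_ord.
Qed.

Lemma disjointC S : fintype.disjoint (mem S) (mem (~: S)%SET).
Proof. by rewrite finset.disjoints_subset finset.setCK. Qed.

Lemma sphere_component S : proper_set S -> #|S| != 2%N ->
  [/\ irreducible (component S), has_dim (component S) 2,
      isomorphic (component S) (sphere R 2) & real_degree (component S) 2].
Proof.
move=> pS S2; have [S0 C0] := proper_set_card pS; have c4 := card_setC4 S.
have [S1|S1] := eqVneq #|S| 1%N.
  have C3 : #|(~: S)%SET| = 3%N by lia.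
  have [E [E' [EK CE]]] := flat_segre1 R S1 C3.
  by rewrite /component CE; apply: sphere_copy EK.
have S3 : #|S| = 3%N by lia.
have C1 : #|(~: S)%SET| = 1%N by lia.
have [E [E' [EK CE]]] := flat_segre1r R S3 C1.
by rewrite /component CE; apply: sphere_copy EK.
Qed.

Lemma torus_component S : #|S| = 2%N ->
  [/\ irreducible (component S), has_dim (component S) 2,
      isomorphic (component S) (prod_set (sphere R 1) (sphere R 1)) /\
      isomorphic (component S) (prod_set (flat (SO R 2)) (flat (SO R 2))) &
      real_degree (component S) 4].
Proof.
move=> S2; have C2 : #|(~: S)%SET| = 2%N by have := card_setC4 S; lia.
have [E [E' [EK CE]]] := flat_segre2 R S2 C2.
by rewrite /component CE; apply: torus_copy EK.
Qed.

Lemma component_sub S S' : proper_set S -> component S `<=` component S' -> S = S'.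
Proof.
move=> pS; have C0 := proper_setC pS; have /andP[S0 _] := pS.
move=> /(flat_segre_sub S0 C0)[SS']; rewrite finset.setCS => S'S.
by apply/eqP; rewrite finset.eqEsubset SS' S'S.
Qed.

Lemma HSO4_components :
  irreducible_components (flat (HSO R 4)) = component @` [set S | proper_set S].
Proof.
rewrite flat_HSO_segre; apply: (@irreducible_components_finite _ _ _ proper_set).
  move=> S pS; have [/torus_component[]//|S2] := eqVneq #|S| 2%N.
  by have [] := sphere_component pS S2.
by move=> S S' pS _; apply: component_sub.
Qed.

Lemma circle_intersection A B : A != finset.set0 -> B != finset.set0 ->
  (#|A| + #|B|)%N = 3%N ->
  [/\ has_dim (flat_segre R A B) 1, isomorphic (flat_segre R A B) (flat (SO R 2)) &
      isomorphic (flat_segre R A B) (sphere R 1)].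
Proof.
rewrite -!card_gt0 => A0 B0 AB; have [A1|A1] := eqVneq #|A| 1%N.
  have B2 : #|B| = 2%N by lia.
  by have [E [E' [EK ->]]] := flat_segre1 R A1 B2; apply: circle_copy EK.
have A2 : #|A| = 2%N by lia.
have B1 : #|B| = 1%N by lia.
by have [E [E' [EK ->]]] := flat_segre1r R A2 B1; apply: circle_copy EK.
Qed.

Lemma single_nonzero n (f : 'I_n -> R) :
  (forall j, [\/ f j = 0, f j = 1 | f j = -1]) -> \sum_j f j ^+ 2 = 1 ->
  exists! j, f j <> 0.
Proof.
move=> f01 sum1.
have [j fj] : exists j, f j <> 0.
  apply: contrapT => /forallNP f0; move/eqP: sum1; rewrite big1 => [|j _].
    by rewrite eq_sym oner_eq0.
  by have /contrapT -> := f0 j; rewrite expr0n.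
have sq k : f k <> 0 -> f k ^+ 2 = 1.
  by case: (f01 k) => -> // _; rewrite ?sqrrN expr1n.
exists j; split=> // k fk; apply: contrapT => /eqP jk.
move: sum1; rewrite (bigD1 j) //= sq // (bigD1 k) 1?eq_sym //= sq //.
set rest := \sum_(_ | _) _; have : 0 <= rest by rewrite sumr_ge0 // => l _; rewrite sqr_ge0.
by lra.
Qed.

Lemma orthogonal_row n (M : 'M[R]_n) i : M *m M^T = 1%:M -> \sum_j M i j ^+ 2 = 1.
Proof.
move/matrixP/(_ i i); rewrite !mxE eqxx mulr1n => e; rewrite -[RHS]e.
by apply: eq_bigr => j _; rewrite mxE expr2.
Qed.

(** The matrix is orthogonal with integer entries, so each row and column, of norm 1, has a single
    nonzero entry, equal to 1 or -1. *)
Lemma quat_delta_signed_permutation i j :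
  signed_permutation (quat_mx (delta_mx i j) : 'M[R]_4).
Proof.
set M := quat_mx _.
have unit k : delta_mx (0 : 'I_1) k *m (delta_mx (0 : 'I_1) k)^T = 1%:M :> 'M[R]_1.
  by rewrite trmx_delta mul_delta_mx; apply/matrixP => a b; rewrite !ord1 !mxE.
have [MM _] : SO R 4 M.
  rewrite /M -[delta_mx i j](_ : (delta_mx (0 : 'I_1) i)^T *m delta_mx 0 j = _).
    by rewrite quat_mx_rank1; apply: SO_mul; [exact: quat_left_SO|exact: quat_right_SO].
  by rewrite trmx_delta mul_delta_mx.
have row a : \sum_b M a b ^+ 2 = 1 by exact: orthogonal_row.
have col b : \sum_a M a b ^+ 2 = 1.
  have /(orthogonal_row b) e : M^T *m M^T^T = 1%:M by rewrite trmxK; apply: mulmx1C.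
  by rewrite -[RHS]e; apply: eq_bigr => a _; rewrite [M^T _ _]mxE.
have M01 a b : [\/ M a b = 0, M a b = 1 | M a b = -1].
  have /intrP[z zE] : M a b \is a Num.int.
    by elim/ord4P: a; elim/ord4P: b; rewrite /M mxE /= !mxE;
      rewrite ?(rpredD, rpredB, rpredN, rpred_nat).
  have : (z ^+ 2)%:~R <= 1%:~R :> R.
    by rewrite rmorphXn /= -zE -(row a) (bigD1 b) //= lerDl sumr_ge0 // => c _; rewrite sqr_ge0.
  rewrite ler_int zE => z1.
  have [->|[->|->]] : z = 0 \/ z = 1 \/ z = -1 by move: z1; rewrite expr2; nia.
  - exact: Or31.
  - exact: Or32.
  - exact: Or33.
split=> [a|b|a b nz]; first exact: single_nonzero.
  exact: (single_nonzero (f := fun a => M a b)).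
by case: (M01 a b) => // e; [left|right].
Qed.

Lemma point_intersection A B : A != finset.set0 -> B != finset.set0 ->
  (#|A| + #|B|)%N = 2%N -> exists2 M : 'M[R]_4, signed_permutation M &
  flat_segre R A B = [set mxvec M; mxvec (- M)].
Proof.
rewrite -!card_gt0 => A0 B0 AB.
have /eqP/cards1P[i ->] : #|A| = 1%N by lia.
have /eqP/cards1P[j ->] : #|B| = 1%N by lia.
exists (quat_mx (delta_mx i j)); first exact: quat_delta_signed_permutation.
have qN x : quat_mx (- x) = - quat_mx x :> 'M[R]_4.
  by apply/matrixP; elim/ord4P; elim/ord4P; rewrite mxE /= !mxE /=; ring.
rewrite /flat_segre segre11 -qN; apply/seteqP; split=> [_ [x [->|->] <-]|x [->|->]].
- by left.
- by right.
- by exists (delta_mx i j) => //; left.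
- by exists (- delta_mx i j) => //; right.
Qed.

Lemma finite_no_curve n (X : set 'rV[R]_n) : finite_set X -> ~ has_dim X 1.
Proof. by move=> finX [/(irreducible_chain_finite finX)]. Qed.

Lemma has_dim_nonempty n (X : set 'rV[R]_n) d : has_dim X d -> X !=set0.
Proof.
by move=> [[Z [irrZ _]] _]; have [[_ [z Zz] _] ZX] := irrZ 0%N isT; exists z; apply: ZX.
Qed.

End Components.

Arguments component : clear implicits.
Arguments facet_of : clear implicits.

Lemma card_proper_sets : #|[set S : {set 'I_4} | proper_set S]%SET| = 14%N.
Proof.
have c16 : #|{: {set 'I_4}}| = 16%N by rewrite -cardsT -powersetT card_powerset cardsT card_ord.
have -> : [set S : {set 'I_4} | proper_set S]%SET =
          ([set: {set 'I_4}] :\ finset.set0 :\ finset.setT)%SET.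
  by apply/setP => S; rewrite !inE andbT andbC.
have := cardsD1 finset.set0 [set: {set 'I_4}]%SET.
have := cardsD1 (finset.setT : {set 'I_4}) ([set: {set 'I_4}] :\ finset.set0)%SET.
rewrite !inE cardsT c16 /=.
have -> : (finset.setT != finset.set0 :> {set 'I_4}) by apply/set0Pn; exists ord0; rewrite inE.
by rewrite /= !add1n => -> [] <-.
Qed.

Lemma card_2sets : #|[set S : {set 'I_4} | #|S| == 2%N]%SET| = 6%N.
Proof. by rewrite card_draws card_ord. Qed.

(** * The bijection between components and facets *)

Section Main.
Variable R : realType.
Implicit Types S : {set 'I_4}.
Local Notation S1 := (sphere R 1).
Local Notation X := (flat (HSO R 4)).
Local Notation comps := (irreducible_components X).
Local Notation P := (cuboctahedron R).
Local Notation tori := [set C | [/\ comps C, isomorphic C (prod_set S1 S1) & real_degree C 4]].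
Local Notation spheres := [set C | [/\ comps C, isomorphic C (sphere R 2) & real_degree C 2]].
Local Notation T := (@component R).

Lemma comps_image : comps = T @` [set` [set S : {set 'I_4} | proper_set S]%SET].
Proof.
rewrite HSO4_components; congr image; apply/seteqP.
by split=> S /=; rewrite inE.
Qed.

Lemma card2_proper S : #|S| = 2%N -> proper_set S.
Proof. by move=> S2; apply: card_proper_set; rewrite S2. Qed.

(** A component of a set with 1 or 3 elements has degree 2, so uniqueness of the degree excludes it
    here. *)
Lemma tori_image : tori = T @` [set` [set S : {set 'I_4} | #|S| == 2%N]%SET].
Proof.
apply/seteqP; split=> [C [/= + _ deg4]|_ [S /= + <-]].
  rewrite HSO4_components => -[S /= pS CE]; exists S => //=; rewrite inE.
  apply: contraT => S2; have [_ _ _ deg2] := sphere_component R pS S2.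
  by rewrite -CE in deg4; have := has_degree_inj deg2 deg4.
rewrite inE => /eqP S2; have [irr _ [iso _] deg] := torus_component R S2.
by split=> //; rewrite HSO4_components; exists S => //; apply: card2_proper.
Qed.

Lemma spheres_image :
  spheres = T @` [set` [set S : {set 'I_4} | proper_set S && (#|S| != 2%N)]%SET].
Proof.
apply/seteqP; split=> [C [/= + _ deg2]|_ [S /= + <-]].
  rewrite HSO4_components => -[S /= pS CE]; exists S => //=; rewrite inE pS.
  apply/negP => /eqP S2; have [_ _ _ deg4] := torus_component R S2.
  by rewrite -CE in deg2; have := has_degree_inj deg2 deg4.
rewrite inE => /andP[pS S2]; have [irr _ iso deg] := sphere_component R pS S2.
by split=> //; rewrite HSO4_components; exists S.
Qed.

Lemma component_inj S S' : proper_set S -> T S = T S' -> S = S'.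
Proof. by move=> pS e; apply: (@component_sub R) => //; rewrite e. Qed.

Lemma facet_inj S S' : proper_set S -> facet_of R S = facet_of R S' -> S = S'.
Proof.
move=> pS e; have /andP[S0 _] := pS.
have sub : facet_of R S `<=` facet_of R S' by rewrite e.
have [] := bipart_face_sub (disjointC S) (disjointC S') S0 (proper_setC pS) sub.
by rewrite finset.setCS => SS' S'S; apply/eqP; rewrite finset.eqEsubset SS' S'S.
Qed.

Lemma facets_image : facets P = facet_of R @` [set S | proper_set S].
Proof.
by rewrite facetsE; apply/seteqP; split=> F; [move=> [S pS ->]; exists S|move=> [S pS <-]; exists S].
Qed.

(** [xget] chooses the index set of a component, which is unique; the default only concerns sets
    that are not components. *)
Definition facet_map (C : set 'rV[R]_(4 * 4)) : set 'rV[R]_3 :=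
  facet_of R (xget finset.set0 [set S | proper_set S /\ T S = C]).

Lemma facet_mapE S : proper_set S -> facet_map (T S) = facet_of R S.
Proof.
move=> pS; rewrite /facet_map; case: xgetP => [S' _ [pS' e]|/(_ S)[]//].
by rewrite (component_inj pS' e).
Qed.

Lemma facet_map_bij : set_bij comps (facets P) facet_map.
Proof.
rewrite HSO4_components facets_image; split.
- by move=> _ [S pS <-]; rewrite facet_mapE //; exists S.
- move=> C C'; rewrite !inE => -[S pS <-] [S' pS' <-]; rewrite !facet_mapE //.
  by move=> /(facet_inj pS) ->.
- by move=> _ [S pS <-]; exists (T S); [exists S|rewrite facet_mapE].
Qed.

(** With 4 - |S| for the complement, the product is 4 for |S| = 2 and 3 for |S| = 1 or 3, so the
    vertex count recognizes the two kinds of facets. *)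
Lemma facet_vertices S k :
  has_vertices P (facet_of R S) k <-> (#|S| * #|(~: S)%SET|)%N = k.
Proof.
have cardF := bipart_face_vertices R (disjointC S).
split=> [Fk|<- //]; apply/card_eq_II.
by apply: card_eq_trans Fk; rewrite card_eq_sym.
Qed.

Lemma facet_map_tori :
  facet_map @` tori = [set F | facets P F /\ has_vertices P F 4].
Proof.
rewrite tori_image facets_image; apply/seteqP; split=> F.
  move=> [_ [S /= + <-] <-]; rewrite inE => /eqP S2; rewrite facet_mapE ?card2_proper //.
  split; first by exists S => //; apply: card2_proper.
  by apply/facet_vertices; have := card_setC4 S; rewrite S2; lia.
move=> [[S pS <-] /facet_vertices c4]; exists (T S); last by rewrite facet_mapE.
exists S => //=; rewrite inE; have := card_setC4 S.
by move: c4; case: #|S| => [|[|[|[|n]]]] //; lia.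
Qed.

Lemma facet_map_spheres :
  facet_map @` spheres = [set F | facets P F /\ has_vertices P F 3].
Proof.
rewrite spheres_image facets_image; apply/seteqP; split=> F.
  move=> [_ [S /= + <-] <-]; rewrite inE => /andP[pS S2]; rewrite facet_mapE //.
  split; first by exists S.
  apply/facet_vertices; have := card_setC4 S; have := proper_set_card pS.
  by move: S2; case: #|S| => [|[|[|[|n]]]] //; lia.
move=> [[S pS <-] /facet_vertices c3]; exists (T S); last by rewrite facet_mapE.
exists S => //=; rewrite inE pS /=; have := card_setC4 S.
by move: c3; case: #|S| => [|[|[|n]]] //; lia.
Qed.

(** The sum is 4 minus the size of the symmetric difference of [S] and [S']. *)
Lemma intersection_cases S S' : S != S' ->
  (#|(S :&: S')%SET| + #|(~: S :&: ~: S')%SET| <= 3)%N.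
Proof.
move=> SS'; have c4 := card_setC4 S; rewrite leqNgt; apply: contra SS' => le.
have le1 : (#|(S :&: S')%SET| <= #|S|)%N.
  exact: subset_leq_card (finset.subsetIl S S').
have le2 : (#|(~: S :&: ~: S')%SET| <= #|(~: S)%SET|)%N.
  exact: subset_leq_card (finset.subsetIl (~: S)%SET (~: S')%SET).
have arith (a b s c : nat) :
    (s + c = 4 -> 3 < a + b -> a <= s -> b <= c -> (s <= a) && (c <= b))%N by lia.
have /andP[leS leC] := arith _ _ _ _ c4 le le1 le2.
have eS : (S :&: S')%SET = S by apply/eqP; rewrite eqEcard finset.subsetIl.
have eC : (~: S :&: ~: S')%SET = (~: S)%SET by apply/eqP; rewrite eqEcard finset.subsetIl.
rewrite finset.eqEsubset; apply/andP; split; first exact/finset.setIidPl.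
by rewrite -finset.setCS; apply/finset.setIidPl.
Qed.

Lemma facet_map_intersections C D : comps C -> comps D -> C <> D ->
  (has_dim (C `&` D) 1 <->
     exists e, [/\ edge P e, e `<=` facet_map C & e `<=` facet_map D]) /\
  ((C `&` D !=set0 /\ finite_set (C `&` D)) <->
     vertex P (facet_map C `&` facet_map D)) /\
  (has_dim (C `&` D) 1 ->
     isomorphic (C `&` D) (flat (SO R 2)) /\ isomorphic (C `&` D) S1) /\
  (C `&` D !=set0 -> finite_set (C `&` D) ->
     exists2 M : 'M[R]_4, signed_permutation M &
       C `&` D = [set mxvec M; mxvec (- M)]).
Proof.
rewrite HSO4_components => -[S pS <-] [S' pS' <-] TT'.
have SS' : S != S' by apply/eqP => e; apply: TT'; rewrite e.
have le3 := intersection_cases SS'.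
rewrite !facet_mapE // /component flat_segreI /facet_of bipart_faceI.
set A := (S :&: S')%SET in le3 *; set B := (~: S :&: ~: S')%SET in le3 *.
have disj : fintype.disjoint (mem A) (mem B).
  apply: disjointWl (finset.subsetIl S S') _.
  exact: disjointWr (finset.subsetIl (~: S)%SET (~: S')%SET) (disjointC S).
(* For nonempty [A] and [B] the total is 2 or 3, so a nonempty intersection is a pair of points or a
   circle, and finiteness tells these apart. *)
have sum2 : A != finset.set0 -> B != finset.set0 -> (#|A| + #|B|)%N != 3%N ->
    (#|A| + #|B|)%N = 2%N.
  rewrite -!card_gt0; have arith (a b : nat) :
    (a + b <= 3 -> 0 < a -> 0 < b -> a + b != 3 -> a + b = 2)%N by lia.
  exact: arith le3.
have finite2 : A != finset.set0 -> B != finset.set0 -> (#|A| + #|B|)%N = 2%N ->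
    finite_set (flat_segre R A B).
  by move=> A0 B0 AB; have [M _ ->] := point_intersection R A0 B0 AB; apply: finite_set2.
have curve3 : has_dim (flat_segre R A B) 1 ->
    [/\ A != finset.set0, B != finset.set0 & (#|A| + #|B|)%N = 3%N].
  move=> dim1; have /flat_segre_nonempty[A0 B0] := has_dim_nonempty dim1.
  split=> //; apply/eqP/contraT => /(sum2 A0 B0) /(finite2 A0 B0) fin.
  by case: (finite_no_curve fin).
have point2 : flat_segre R A B !=set0 -> finite_set (flat_segre R A B) ->
    [/\ A != finset.set0, B != finset.set0 & (#|A| + #|B|)%N = 2%N].
  move=> /flat_segre_nonempty[A0 B0] fin; split=> //; apply: sum2 => //.
  apply/eqP => AB; have [dim1 _ _] := circle_intersection R A0 B0 AB.
  exact: finite_no_curve fin dim1.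
split; last split; last split.
- split=> [/curve3[A0 B0 AB]|[e [/edgeE[A' [B' [A'0 B'0 disj' AB' ->]]] eS eS']]].
    exists (bipart_face R A B); split; first by apply/edgeE; exists A, B.
      by rewrite /A /B -bipart_faceI => x [].
    by rewrite /A /B -bipart_faceI => x [].
  (* The index sets of an edge lying in both facets are contained in [A] and [B], whence 3 <= |A| +
     |B| <= 3. *)
  have [AS BS] := bipart_face_sub disj' (disjointC S) A'0 B'0 eS.
  have [AS' BS'] := bipart_face_sub disj' (disjointC S') A'0 B'0 eS'.
  have AA : A' \subset A by rewrite finset.subsetI AS.
  have BB : B' \subset B by rewrite finset.subsetI BS.
  have [lA lB] := (subset_leq_card AA, subset_leq_card BB).
  rewrite -!card_gt0 in A'0 B'0.
  have A0 : A != finset.set0 by rewrite -card_gt0; apply: leq_trans lA.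
  have B0 : B != finset.set0 by rewrite -card_gt0; apply: leq_trans lB.
  have AB : (#|A| + #|B|)%N = 3%N.
    by apply/eqP; rewrite eqn_leq le3 -[in leqLHS]AB' leq_add.
  by have [] := circle_intersection R A0 B0 AB.
- split=> [[ne fin]|/vertexE[A' [B' [A'0 B'0 disj' AB' e]]]].
    by have [A0 B0 AB] := point2 ne fin; apply/vertexE; exists A, B.
  (* This inclusion shows that [A] and [B] are nonempty, which the reverse inclusion requires. *)
  have [AA BB] : A' \subset A /\ B' \subset B.
    by apply: (@bipart_face_sub R) => //; rewrite e.
  have [A0 B0] : A != finset.set0 /\ B != finset.set0.
    by split; [apply: contra A'0|apply: contra B'0] => /eqP E0;
      [move: AA|move: BB]; rewrite E0 finset.subset0.
  have [lA lB] : A \subset A' /\ B \subset B'.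
    by apply: (@bipart_face_sub R) => //; rewrite e.
  have [cA cB] := (subset_leq_card lA, subset_leq_card lB).
  have AB : (#|A| + #|B|)%N = 2%N.
    rewrite -!card_gt0 in A0 B0; apply/eqP; rewrite eqn_leq -[in leqRHS]AB' leq_add //=.
    by rewrite -[2%N]/(1 + 1)%N leq_add.
  by split; [apply/flat_segre_nonempty|apply: finite2].
- move=> /curve3[A0 B0 AB].
  by have [] := circle_intersection R A0 B0 AB.
- by move=> ne fin; have [A0 B0 AB] := point2 ne fin; apply: point_intersection.
Qed.

End Main.

Theorem theorem1p1 (R : realType) :
  let S1 := sphere R 1 in
  let SO2 := flat (SO R 2) in
  let X : set 'rV[R]_(4 * 4) := flat (HSO R 4) in
  let comps := irreducible_components X in
  let tori := [set C | [/\ comps C, isomorphic C (prod_set S1 S1) &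
                           real_degree C 4]] in
  let spheres := [set C | [/\ comps C, isomorphic C (sphere R 2) &
                              real_degree C 2]] in
  let P := cuboctahedron R in
  [/\ X = \bigcup_(C in comps) C,
      comps #= `I_14 /\ (forall C, comps C -> has_dim C 2),
      tori #= `I_6 /\ spheres #= `I_8,
      comps = tori `|` spheres &
  exists phi : set 'rV[R]_(4 * 4) -> set 'rV[R]_3,
    set_bij comps (facets P) phi /\
    ((forall C, tori C -> isomorphic C (prod_set SO2 SO2)) /\
     phi @` tori = [set F | facets P F /\ has_vertices P F 4]) /\
    phi @` spheres = [set F | facets P F /\ has_vertices P F 3] /\
    (forall C D, comps C -> comps D -> C <> D ->
       (has_dim (C `&` D) 1 <->
          exists e, [/\ edge P e, e `<=` phi C & e `<=` phi D]) /\
       ((C `&` D !=set0 /\ finite_set (C `&` D)) <->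
          vertex P (phi C `&` phi D)) /\
       (has_dim (C `&` D) 1 ->
          isomorphic (C `&` D) SO2 /\ isomorphic (C `&` D) S1) /\
       (C `&` D !=set0 -> finite_set (C `&` D) ->
          exists2 M : 'M[R]_4, signed_permutation M &
            C `&` D = [set mxvec M; mxvec (- M)]))].
Proof.
move=> S1 SO2 X comps tori spheres P.
have card8 : #|[set S : {set 'I_4} | proper_set S && (#|S| != 2%N)]%SET| = 8%N.
  have := cardsID [set S : {set 'I_4} | #|S| == 2%N]%SET [set S : {set 'I_4} | proper_set S]%SET.
  rewrite card_proper_sets (_ : _ :&: _ = [set S : {set 'I_4} | #|S| == 2%N]%SET); last first.
    by apply/setP => S; rewrite !inE andbC; case: eqP => // /card2_proper ->.
  rewrite card_2sets (_ : _ :\: _ = [set S : {set 'I_4} | proper_set S && (#|S| != 2%N)]%SET).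
    by lia.
  by apply/setP => S; rewrite !inE andbC.
have injT (D : {set {set 'I_4}}) : (forall S, S \in D -> proper_set S) ->
    {in D &, injective (@component R)}.
  by move=> Dproper S S' SD S'D; apply: component_inj; apply: Dproper.
split.
- rewrite /comps /X HSO4_components {1}flat_HSO_segre; apply/seteqP; split=> v.
    by move=> [S pS vS]; exists (component R S) => //; exists S.
  by move=> [_ [S pS <-] vS]; exists S.
- split.
    rewrite /comps /X comps_image -card_proper_sets; apply: card_image_finset.
    by apply: injT => S; rewrite inE.
  rewrite /comps /X HSO4_components => _ [S pS <-].
  have [/(torus_component R)[]//|S2] := eqVneq #|S| 2%N.
  by have [] := sphere_component R pS S2.
- split.
    rewrite /tori /comps /X tori_image -card_2sets; apply: card_image_finset.
    by apply: injT => S; rewrite inE => /eqP/card2_proper.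
  rewrite /spheres /comps /X spheres_image -card8; apply: card_image_finset.
  by apply: injT => S; rewrite inE => /andP[].
- rewrite /tori /spheres /comps /X tori_image spheres_image comps_image.
  rewrite -image_setU; congr image; apply/seteqP; split=> S; rewrite /= !inE.
    by move=> pS; have [S2|S2] := eqVneq #|S| 2%N; [left|right; rewrite pS].
  by move=> [/eqP/card2_proper//|/andP[]].
- exists (@facet_map R); split; first exact: facet_map_bij.
  split; first split; last split.
  + move=> C; rewrite /tori /comps /X tori_image => -[S /= + <-].
    by rewrite inE => /eqP /(torus_component R)[_ _ [_ iso] _].
  + exact: facet_map_tori.
  + exact: facet_map_spheres.
  + exact: facet_map_intersections.
Qed.
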